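(* Let $u_0\in L^2(\Omega)$ and let $$u(t)=\sum_{n=0}^\infty E_{\alpha,1}(-\lambda_nt^\alpha)\langle u_0,\phi_n\rangle_{\Omega}\,\phi_n,\qquad 0\leqslant t\leqslant T,$$ be the weak solution of the time fractional subdiffusion problem with $f=0$ and initial value $u_0$. Then $$\langle u',v\rangle_{H^{(1-\alpha)/2}(0,T;\dot H^1(\Omega))}+\langle\mathrm D_{0+}^{1-\alpha}\nabla u,\nabla v\rangle_{H^{(1-\alpha)/2}(0,T;L^2(\Omega))}=0$$ for all $v\in H^{(1-\alpha)/2}(0,T;\dot H^1(\Omega))$, and $$\|u'\|_{(H^{(1-\alpha)/2}(0,T;\dot H^1(\Omega)))^*}+\|u\|_{C([0,T];L^2(\Omega))}+\|u\|_{H^{(1-\alpha)/2}(0,T;\dot H^1(\Omega))}+\epsilon_{\alpha,\gamma}\|u\|_{L^2(0,T;\dot H^\gamma(\Omega))}\leqslant C_{\alpha,T}\|u_0\|_{L^2(\Omega)},$$ where $\epsilon_{\alpha,\gamma}:=\sqrt{2-\gamma}+\sqrt{|2\alpha-1|}$, with $\gamma=\min\{2,1/\alpha\}$ if $\alpha\neq1/2$ and $1\leqslant\gamma<2$ arbitrary if $\alpha=1/2$, and $C_{\alpha,T}>0$ depends only on $\alpha$ and $T$.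
   Context: Setting: $\alpha\in(0,1)$, $T>0$, $\Omega\subset\mathbb R^d$ ($d=1,2,3$) is a convex polyhedral domain. The problem is $u'-\mathrm D_{0+}^{1-\alpha}\Delta u=0$ in $\Omega\times(0,T)$, $u=0$ on $\partial\Omega\times(0,T)$, $u(\cdot,0)=u_0$. $E_{a,b}(z)=\sum_{k\geqslant0}z^k/\Gamma(ak+b)$ is the Mittag-Leffler function. Spatial spaces: $\{\phi_n\}_{n\in\mathbb N}\subset H_0^1(\Omega)\cap H^2(\Omega)$ is an orthonormal basis of $L^2(\Omega)$ with $-\Delta\phi_n=\lambda_n\phi_n$, $\lambda_n>0$ non-decreasing, $\lambda_n\to\infty$. For $r\in\mathbb R$, $\dot H^r(\Omega)=\{\sum_nc_n\phi_n:\sum_n\lambda_n^rc_n^2<\infty\}$ with norm $(\sum_n\lambda_n^rc_n^2)^{1/2}$. $\langle p,q\rangle_\Omega=\int_\Omega pq$. Time spaces: for a separable Hilbert space $X$ with orthonormal basis $\{e_i\}$, $H^r(0,T;X)=\{v\in L^2(0,T;X):\sum_i\|(v,e_i)_X\|_{H^r(0,T)}^2<\infty\}$ with norm the square root of this sum, $H^r(0,T)$ being the standard Sobolev space ($r\geqslant 0$). $\langle\cdot,\cdot\rangle_X$ denotes the duality pairing between $X^*$ and $X$. Fractional operators: $(\mathrm I_{0+}^\gamma v)(t)=\frac1{\Gamma(\gamma)}\int_0^t(t-s)^{\gamma-1}v(s)\,ds$ for $\gamma>0$ and $\mathrm D_{0+}^{\gamma}=\frac{d}{dt}\mathrm I_{0+}^{1-\gamma}$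 for $0<\gamma<1$ (derivatives in the distributional sense in time). $u'$ and $\mathrm D_{0+}^{1-\alpha}\nabla u$ are regarded as elements of the dual spaces of $H^{(1-\alpha)/2}(0,T;\dot H^1(\Omega))$ and of $H^{(1-\alpha)/2}(0,T;L^2(\Omega))$ (vector-valued), respectively. *)

(* Defs.v *)
From HB Require Import structures.
From mathcomp Require Import all_boot all_order all_algebra.
From mathcomp Require Import all_classical all_reals all_analysis.
Set Implicit Arguments.
Unset Strict Implicit.
Unset Printing Implicit Defensive.
Import Order.TTheory GRing.Theory Num.Theory.
Import numFieldNormedType.Exports.
Local Open Scope classical_set_scope.
Local Open Scope ring_scope.

(* Lebesgue measure on R^n, R^n being 'rV[R]_n with the sigma-algebra
   generated by the coordinates, i.e. the Borel sigma-algebra. *)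
Section measurable_rV.
Context {R : realType} {n : nat}.

Let coord : 'I_n -> 'rV[R]_n -> R := fun i x => x ord0 i.

Let rV_set0 : g_sigma_preimage coord set0.
Proof. exact: sigma_algebra0. Qed.

Let rV_setC A : g_sigma_preimage coord A -> g_sigma_preimage coord (~` A).
Proof. exact: sigma_algebraC. Qed.

Let rV_bigcup (F : (set 'rV[R]_n)^nat) :
  (forall i, g_sigma_preimage coord (F i)) ->
  g_sigma_preimage coord (\bigcup_i (F i)).
Proof. exact: sigma_algebra_bigcup. Qed.

HB.instance Definition _ := @isMeasurable.Build (measure_tuple_display R.-ocitv)
  'rV[R]_n (g_sigma_preimage coord) rV_set0 rV_setC rV_bigcup.

End measurable_rV.

Section lebesgue_rV.
Context {R : realType}.

Lemma measurable_coord n (i : 'I_n) :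
  measurable_fun [set: 'rV[R]_n] (fun x : 'rV[R]_n => x ord0 i).
Proof.
move=> _ Y mY; rewrite setTI; apply: sub_sigma_algebra => /=.
rewrite -bigcup_seq/=; exists i => /=; first by rewrite mem_index_enum.
by exists Y => //; rewrite setTI.
Qed.

Lemma measurable_fun_rVP d (U : measurableType d) n (f : U -> 'rV[R]_n) :
  (forall i, measurable_fun [set: U] (fun x => f x ord0 i)) ->
  measurable_fun [set: U] f.
Proof.
move=> mf.
suff H : g_sigma_preimage (fun i => (fun y : 'rV[R]_n => y ord0 i) \o f)
    `<=` measurable.
  move=> _ A mA; rewrite setTI; apply: H.
  by rewrite g_sigma_preimage_comp; exists A => //; rewrite setTI.
apply: smallest_sub; first exact: sigma_algebra_measurable.
case: n => [|n] in f mf *; first by rewrite big_ord0.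
rewrite -bigcup_mkord_ord; apply: bigcup_sub => i Ii.
by move=> A [B mB <-]; exact: mf.
Qed.

Definition cons_rV n (p : R * 'rV[R]_n) : 'rV[R]_n.+1 :=
  \row_i oapp (fun j => p.2 ord0 j) p.1 (unlift ord0 i).

Definition uncons_rV n (x : 'rV[R]_n.+1) : R * 'rV[R]_n :=
  (x ord0 ord0, \row_j x ord0 (lift ord0 j)).

Lemma cons_rVK n : cancel (@cons_rV n) (@uncons_rV n).
Proof.
case=> a x; rewrite /uncons_rV mxE unlift_none /=; congr (_, _).
by apply/rowP => j; rewrite !mxE liftK.
Qed.

Lemma measurable_cons_rV n :
  measurable_fun [set: measurableTypeR R * 'rV[R]_n] (@cons_rV n).
Proof.
apply: measurable_fun_rVP => i.
under eq_fun do rewrite mxE.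
case: (unliftP ord0 i) => [j _|_] /=; last exact: measurable_fst.
exact: measurableT_comp (measurable_coord j) measurable_snd.
Qed.

Lemma measurable_uncons_rV n :
  measurable_fun [set: 'rV[R]_n.+1]
    (@uncons_rV n : _ -> measurableTypeR R * 'rV[R]_n).
Proof.
apply/measurable_fun_pair; first exact: measurable_coord.
apply: measurable_fun_rVP => i.
by under eq_fun do rewrite mxE; exact: measurable_coord.
Qed.

Section lebesgue_rV_step.
Variables (n : nat) (m : {sigma_finite_measure set 'rV[R]_n -> \bar R}).

Definition lebesgue_rV_step : set 'rV[R]_n.+1 -> \bar R :=
  pushforward (@lebesgue_measure R \x m)%E (@cons_rV n).

Let step_preimage A : measurable A -> measurable (@cons_rV n @^-1` A).
Proof.
by move=> mA; rewrite -[X in measurable X]setTI; exact: measurable_cons_rV.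
Qed.

Let step0 : lebesgue_rV_step set0 = 0%E.
Proof. by rewrite /lebesgue_rV_step /pushforward preimage_set0 measure0. Qed.

Let step_ge0 A : (0 <= lebesgue_rV_step A)%E.
Proof. by rewrite /lebesgue_rV_step /pushforward; exact: measure_ge0. Qed.

Let step_sigma_additive : semi_sigma_additive lebesgue_rV_step.
Proof.
move=> F mF tF mUF; rewrite /lebesgue_rV_step /pushforward preimage_bigcup.
apply: measure_semi_sigma_additive.
- by move=> k; exact: step_preimage.
- apply/trivIsetP => /= i j _ _ ij; rewrite -preimage_setI.
  by move/trivIsetP : tF => /(_ _ _ _ _ ij) ->//; rewrite preimage_set0.
- by rewrite -preimage_bigcup; exact: step_preimage.
Qed.

HB.instance Definition _ := isMeasure.Build _ _ _ lebesgue_rV_step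
  step0 step_ge0 step_sigma_additive.

Lemma lebesgue_rV_step_sigma_finite : sigma_finite setT lebesgue_rV_step.
Proof.
have /sigma_finiteP[F [TF ndF Foo]] := sigma_finiteT (@lebesgue_measure R).
have /sigma_finiteP[G [TG ndG Goo]] := sigma_finiteT m.
exists (fun k => @uncons_rV n @^-1` (F k `*` G k)).
  rewrite -preimage_bigcup; apply/seteqP; split=> // x _.
  have [k _ Fk] : (\bigcup_k F k) (uncons_rV x).1 by rewrite -TF.
  have [l _ Gl] : (\bigcup_k G k) (uncons_rV x).2 by rewrite -TG.
  exists (maxn k l) => //; split.
    by move: Fk; exact/subsetPset/ndF/leq_maxl.
  by move: Gl; exact/subsetPset/ndG/leq_maxr.
move=> k; have [mF Fk] := Foo k; have [mG Gk] := Goo k; split.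
  rewrite -[X in measurable X]setTI.
  by apply: measurable_uncons_rV => //; exact: measurableX.
rewrite /lebesgue_rV_step /pushforward -comp_preimage.
rewrite (_ : _ \o _ = id); last by apply/funext => p /=; rewrite cons_rVK.
by rewrite preimage_id product_measure1E// lte_mul_pinfty// ge0_fin_numE.
Qed.

HB.instance Definition _ := Measure_isSigmaFinite.Build _ _ _
  lebesgue_rV_step lebesgue_rV_step_sigma_finite.

End lebesgue_rV_step.

(* R^0 is a point; R^(n+1) = R x R^n. *)
Fixpoint lebesgue_rV n : {sigma_finite_measure set 'rV[R]_n -> \bar R} :=
  match n with
  | 0 => dirac (0 : 'rV[R]_0)
  | n'.+1 => lebesgue_rV_step (lebesgue_rV n')
  end.

End lebesgue_rV.

Section special_functions.
Context {R : realType}.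

Definition Gamma (x : R) : R :=
  \int[lebesgue_measure]_(t in `]0, +oo[) (t `^ (x - 1) * expR (- t)).

Definition mittag_leffler (a b z : R) : R :=
  limn (series (fun k : nat => z ^+ k / Gamma (a * k%:R + b))).

End special_functions.

Section hilbert.
Context {R : realType} {V : lmodType R}.

(* A separable Hilbert space of vectors of V with an orthonormal basis indexed
   by hidx; the axioms are not part of the record.  Elements of V may represent
   classes (functions modulo a.e. equality), so hip may be only semidefinite. *)
Record hilbert := Hilbert {
  hdom : set V;
  hip : V -> V -> R;
  hidx : choiceType;
  hbasis : hidx -> V }.

Variable X : hilbert.

Definition hnorm (v : V) : R := Num.sqrt (hip X v v).

Definition hsum (a : nat -> V) (s : V) : Prop :=
  hdom X s /\ (fun N : nat => hnorm (s - \sum_(n < N) a n)) @ \oo --> (0 : R).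

(* Bochner integral over D of an X-valued function, characterised by its inner
   products with the elements of X; unique up to vectors of norm 0. *)
Definition hintegral (D : set R) (f : R -> V) : V :=
  xget 0 [set w | hdom X w /\ forall y, hdom X y ->
    lebesgue_measure.-integrable D (fun s => (hip X (f s) y)%:E) /\
    hip X w y = \int[lebesgue_measure]_(s in D) hip X (f s) y].

(* The Riemann-Liouville integral I_{0+}^g. *)
Definition frac_int (g : R) (v : R -> V) (t : R) : V :=
  (Gamma g)^-1 *: hintegral `]0, t[ (fun s => (t - s) `^ (g - 1) *: v s).

Variable T : R.

(* Elements of L^2(0,T;X) are represented by functions which are X-valued
   everywhere on ]0,T[; as X is separable, Bochner measurability is Borel
   measurability, tested on balls. *)
Definition L2time (v : R -> V) : Prop :=
  [/\ forall t, 0 < t < T -> hdom X (v t),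
      forall x e, hdom X x ->
        measurable (`]0, T[ `&` [set t | hnorm (v t - x) < e]) &
      (\int[lebesgue_measure]_(t in `]0%R, T[) (hnorm (v t) ^+ 2)%:E < +oo)%E].

Definition L2time_norm (v : R -> V) : \bar R :=
  ((\int[lebesgue_measure]_(t in `]0%R, T[) (hnorm (v t) ^+ 2)%:E) `^ 2^-1)%E.

(* Square of the Sobolev-Slobodeckij norm of H^r(0,T), for 0 < r < 1. *)
Definition sobolev_time_normsq (r : R) (f : R -> R) : \bar R :=
  (\int[lebesgue_measure]_(t in `]0%R, T[) (f t ^+ 2)%:E +
   \int[lebesgue_measure]_(t in `]0%R, T[) \int[lebesgue_measure]_(s in `]0%R, T[)
     ((f t - f s) ^+ 2 / `|t - s| `^ (1 + 2 * r))%:E)%E.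

Definition Htime_norm (r : R) (v : R -> V) : \bar R :=
  ((\esum_(i in [set: hidx X])
      sobolev_time_normsq r (fun t => hip X (v t) (hbasis i))) `^ 2^-1)%E.

Definition Htime (r : R) (v : R -> V) : Prop :=
  L2time v /\ (Htime_norm r v < +oo)%E.

Definition Htime_dual_norm (r : R) (F : (R -> V) -> R) : \bar R :=
  ereal_sup [set `|F v|%:E | v in [set v | Htime r v /\ (Htime_norm r v <= 1)%E]].

(* The values of F outside H^r(0,T;X) are irrelevant. *)
Definition Htime_dual (r : R) (F : (R -> V) -> R) : Prop :=
  (forall (a : R) v w, Htime r v -> Htime r w ->
     F (a *: v + w) = a * F v + F w) /\
  (Htime_dual_norm r F < +oo)%E.

Definition continuous_time (v : R -> V) : Prop :=
  (forall t, 0 <= t <= T -> hdom X (v t)) /\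
  (forall t, 0 <= t <= T ->
     (fun s => hnorm (v s - v t)) @ within `[0, T] (nbhs t) --> (0 : R)).

Definition C_norm (v : R -> V) : \bar R :=
  ereal_sup [set (hnorm (v t))%:E | t in `[0, T]].

Definition test_time (f : R -> R) : Prop :=
  (forall k t, derivable (derive1n k f) t 1) /\
  (exists K, [/\ compact K, K `<=` `]0, T[ & forall t, ~ K t -> f t = 0]).

End hilbert.

Arguments hilbert {R} V.

Section time_derivative.
Context {R : realType} {V : lmodType R}.

(* F is the distributional derivative w' on ]0,T[, where w(t) acts on Y through
   the inner product of the pivot space P: <w', f y> = - int f' (w, y)_P.
   For 0 < r < 1/2 test functions are dense in H^r(0,T;Y), so that at most one
   F in the dual of H^r(0,T;Y) has this property. *)
Definition is_time_derivative (P Y : hilbert V) (T : R) (w : R -> V)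
    (F : (R -> V) -> R) : Prop :=
  forall f y, test_time T f -> hdom Y y ->
    F (fun t => f t *: y) =
    - \int[lebesgue_measure]_(t in `]0, T[) (derive1 f t * hip P (w t) y).

(* F = D_{0+}^g v = d/dt I_{0+}^{1-g} v, for 0 < g < 1. *)
Definition is_frac_derivative (X : hilbert V) (T g : R) (v : R -> V)
    (F : (R -> V) -> R) : Prop :=
  is_time_derivative X X T (frac_int X (1 - g) v) F.

End time_derivative.

Section space.
Context {R : realType} {d : nat}.
Variable Omega : set 'rV[R]_d.

(* The interior of a convex polytope, if nonempty. *)
Definition convex_polyhedral_domain : Prop :=
  [/\ Omega !=set0, bounded_set Omega &
      exists (m : nat) (A : 'M[R]_(m, d)) (b : 'I_m -> R),
        Omega = [set x | forall i, \sum_j A i j * x ord0 j < b i]].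

Definition partial (i : 'I_d) (f : 'rV[R]_d -> R) : 'rV[R]_d -> R :=
  'D_(delta_mx ord0 i) f.

Definition smooth (f : 'rV[R]_d -> R) : Prop :=
  forall (s : seq 'I_d) x, differentiable (foldr partial f s) x.

Definition test_space (f : 'rV[R]_d -> R) : Prop :=
  smooth f /\
  exists K, [/\ compact K, K `<=` Omega & forall x, ~ K x -> f x = 0].

Definition L2 (f : 'rV[R]_d -> R) : Prop :=
  measurable_fun Omega f /\
  (lebesgue_rV d).-integrable Omega (fun x => (f x ^+ 2)%:E).

Definition ip (f g : 'rV[R]_d -> R) : R :=
  \int[lebesgue_rV d]_(x in Omega) (f x * g x).

Definition L2norm (f : 'rV[R]_d -> R) : R := Num.sqrt (ip f f).

Definition is_weak_partial (i : 'I_d) (f g : 'rV[R]_d -> R) : Prop :=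
  forall psi, test_space psi -> ip f (partial i psi) = - ip g psi.

(* The weak partial derivative in L^2, if any. *)
Definition weak_partial (i : 'I_d) (f : 'rV[R]_d -> R) : 'rV[R]_d -> R :=
  xget (fun=> 0) [set g | L2 g /\ is_weak_partial i f g].

Definition weak_grad (f : 'rV[R]_d -> R) : 'rV[R]_d -> 'rV[R]_d :=
  fun x => \row_i weak_partial i f x.

Definition weak_laplacian (f : 'rV[R]_d -> R) : 'rV[R]_d -> R :=
  fun x => \sum_(i < d) weak_partial i (weak_partial i f) x.

(* The Sobolev space H^k. *)
Fixpoint sobolev (k : nat) (f : 'rV[R]_d -> R) : Prop :=
  L2 f /\
  match k with
  | 0 => True
  | k'.+1 => forall i, exists2 g, sobolev k' g & is_weak_partial i f g
  end.

(* H^1_0: the closure of the test functions in H^1. *)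
Definition sobolev10 (f : 'rV[R]_d -> R) : Prop :=
  sobolev 1 f /\
  exists psi : nat -> 'rV[R]_d -> R,
    [/\ forall k, test_space (psi k),
        (fun k => L2norm (f - psi k)) @ \oo --> (0 : R) &
        forall i, (fun k => L2norm (weak_partial i f - partial i (psi k)))
                    @ \oo --> (0 : R)].

Variables (phi : nat -> 'rV[R]_d -> R) (lam : nat -> R).

Definition L2_hilbert : hilbert ('rV[R]_d -> R) :=
  @Hilbert _ _ L2 ip nat phi.

Definition dirichlet_eigenbasis : Prop :=
  [/\ forall n, sobolev10 (phi n) /\ sobolev 2 (phi n),
      forall m n, ip (phi m) (phi n) = (m == n)%:R,
      forall f, L2 f -> hsum L2_hilbert (fun n => ip f (phi n) *: phi n) f,
      forall n, {ae lebesgue_rV d, forall x, Omega x ->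
                   - weak_laplacian (phi n) x = lam n * phi n x} &
      [/\ forall n, 0 < lam n,
          {homo lam : m n / (m <= n)%N >-> m <= n} &
          lam @ \oo --> +oo]].

(* L^2(Omega)^d, with the basis (phi_n e_j). *)
Definition L2vec_hilbert : hilbert ('rV[R]_d -> 'rV[R]_d) :=
  @Hilbert _ _
    [set v : 'rV[R]_d -> 'rV[R]_d | forall j, L2 (fun x => v x ord0 j)]
    (fun v w : 'rV[R]_d -> 'rV[R]_d =>
       \sum_(j < d) ip (fun x => v x ord0 j) (fun x => w x ord0 j))
    (nat * 'I_d)%type
    (fun p x => phi p.1 x *: delta_mx ord0 p.2).

(* The space with norm (\sum_n lam_n^r (f, phi_n)^2)^(1/2), for r >= 0, so that
   its elements are functions in L^2(Omega). *)
Definition dotH (r : R) : hilbert ('rV[R]_d -> R) :=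
  @Hilbert _ _
    [set f | L2 f /\
       (\sum_(0 <= n <oo) (lam n `^ r * ip f (phi n) ^+ 2)%:E < +oo)%E]
    (fun f g => limn (series (fun n => lam n `^ r * ip f (phi n) * ip g (phi n))))
    nat
    (fun n => lam n `^ (- r / 2) *: phi n).

End space.

(* Main.v *)
(* Everything reduces to the relaxation function e(t) = E_{a,1}(-lam t^a), which
   solves e + lam I^a e = 1, and to p = -e'/lam = t^(a-1) E_{a,a}(-lam t^a).
   Comparison with the kernel t^(a-1)/Gamma(a) on short time steps gives p >= 0;
   hence e decreases from 1 and e <= Gamma(a+1) / (lam t^a).  From
   (e(s) - e(t))^2 <= lam e(s) int_s^t p and Tonelli's theorem, lam times the
   squared H^((1-a)/2) norm of e is bounded uniformly in lam.

   Both functionals u' and D^(1-a) grad u have the form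
   h |-> sum_n c_n sqrt(lam_n) int_0^T p_n h_n, up to sign, where c_n and h_n are
   the coefficients of u_0 and of the test function.  This is bounded by
   p^2 t^(1-a) <= p / Gamma(a), Young's inequality and the Hardy inequality
   int t^(a-1) h^2 <= C |h|^2 in H^((1-a)/2), and it is the distributional
   derivative because e = 1 - lam int_0^t p.

   In space, Green's formula for eigenfunctions in H^1_0 makes the
   grad phi_n / sqrt(lam_n) orthonormal in L^2; by the Riesz-Fischer theorem the
   weak gradient of an element of dotH^1 is the sum of its expansion in them, and
   Bessel's inequality controls the coefficients of a general vector field. *)

From HB Require Import structures.
Require Import Defs.
From mathcomp Require Import all_boot all_order all_algebra.
From mathcomp Require Import all_classical all_reals all_analysis.
From mathcomp Require Import measurable_realfun ring lra.
Set Implicit Arguments.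
Unset Strict Implicit.
Unset Printing Implicit Defensive.
Import Order.TTheory GRing.Theory Num.Theory.
Import numFieldNormedType.Exports.
Local Open Scope classical_set_scope.
Local Open Scope ring_scope.

(** * Changes of variables *)

(** The constant may depend on [alpha] and [T] only, so every estimate in time has to be uniform in
    [lam]. The source of uniformity is [lam * int_0^t p = 1 - e t <= 1]: the weight of [dotH 1] and
    the duality pairing each cost one factor [lam], and this identity absorbs it. Everything
    therefore rests on the sign of [p], which cannot be read off its alternating series. It is
    extracted from the Volterra equation satisfied by [p], and the point of the continuation
    argument is that its step length depends on [lam] but not on the position, so that finitely many
    steps reach any given time. In space, weak derivatives and Bochner integrals are chosen objects,
    determined only up to norm 0. Statements about them pass through inner products with fixed
    elements, and vectors are compared through the norm of their difference. Density of test
    functions comes from the membership of the eigenfunctions in [H^1_0]. *)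

Section lebesgue_affine.
Context {R : realType}.
Local Notation mu := (@lebesgue_measure R).

(** The image of Lebesgue measure under [x |-> c * x + a], scaled by [c], agrees with Lebesgue
    measure on half-open intervals, hence on all measurable sets; the image-measure formula then
    gives the claim. *)
Lemma integral_affine (c a : R) (f : R -> \bar R) : 0 < c ->
  measurable_fun [set: R] f -> (forall x, (0 <= f x)%E) ->
  (\int[mu]_x f (c * x + a)%R = (c^-1)%:E * \int[mu]_x f x)%E.
Proof.
move=> c0 mf f0.
pose phi : measurableTypeR R -> measurableTypeR R := fun x => c * x + a.
have mphi : measurable_fun [set: measurableTypeR R] phi.
  by apply: measurable_funD => //; exact: measurable_funM.
have cN0 : 0 <= c by exact: ltW.
have := @ge0_integral_pushforward _ _ (measurableTypeR R) (measurableTypeR R) R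
  phi mphi mu setT f measurableT mf (fun x _ => f0 x).
set nu0 := (X in (integral X _ _ = _ -> _)%E) => H.
have nuE A : measurable A -> mu A = mscale (NngNum cN0) nu0 A.
  apply: lebesgue_measure_unique => _ [[x y]] _ <-.
  rewrite /nu0 /= /mscale /= /pushforward.
  have -> : phi @^-1` [set` `]x, y]] = [set` `](x - a) / c, (y - a) / c]].
    apply/seteqP; split => z /=; rewrite !in_itv /= /phi.
      by rewrite ltr_pdivrMr// ler_pdivlMr// ltrBlDr lerBrDr mulrC.
    by rewrite ltr_pdivrMr// ler_pdivlMr// ltrBlDr lerBrDr mulrC.
  rewrite !lebesgue_measure_itv /= !lte_fin ltr_pM2r ?invr_gt0// ltrD2r.
  case: ifPn => xy; last by rewrite mule0.
  by rewrite -!EFinD -EFinM; congr (_%:E); field; rewrite gt_eqF.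
have -> : (\int[mu]_x f x = c%:E * \int[nu0]_x f x)%E.
  rewrite -[c%:E]/((NngNum cN0)%:num%:E) -ge0_integral_mscale//.
  by apply: eq_measure_integral => A mA _; exact: nuE.
rewrite H preimage_setT muleA -EFinM mulVf ?gt_eqF//.
by rewrite mul1e.
Qed.

Lemma integral_shift (a : R) (f : R -> \bar R) :
  measurable_fun [set: R] f -> (forall x, (0 <= f x)%E) ->
  (\int[mu]_x f (x - a)%R = \int[mu]_x f x)%E.
Proof.
move=> mf f0; have := @integral_affine 1 (- a) f ltr01 mf f0.
by under eq_integral do rewrite mul1r; rewrite invr1 mul1e.
Qed.

Lemma lebesgue_tonelli (f : R * R -> \bar R) :
  measurable_fun [set: measurableTypeR R * measurableTypeR R] f ->
  (forall z, (0 <= f z)%E) ->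
  (\int[mu]_x \int[mu]_y f (x, y) = \int[mu]_y \int[mu]_x f (x, y))%E.
Proof. move=> mf f0; exact: (@fubini_tonelli _ _ _ _ _ mu mu f mf f0). Qed.

End lebesgue_affine.

(** * The Gamma function and fractional kernels *)

Section Gamma_function.
Context {R : realType}.
Local Notation mu := (@lebesgue_measure R).

Lemma integral_powR_itv (b e t : R) : b != 0 -> 0 < e -> e < t ->
  (\int[mu]_(s in `[e, t]) (s `^ (b - 1))%:E = (t `^ b / b - e `^ b / b)%:E)%E.
Proof.
move=> b0 e0 et; rewrite EFinB.
have pos x : x \in `[e, t] -> 0 < x by rewrite in_itv/= => /andP[/(lt_le_trans e0)].
have dP (x : R) : 0 < x -> is_derive x 1 (fun s : R => s `^ b / b) (x `^ (b - 1)).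
  move=> x0; have := is_derive1_powR b x0 => H.
  have -> : (fun s : R => s `^ b / b) = b^-1 \*: (@powR R ^~ b).
    by apply/funext => s; rewrite /= mulrC.
  apply: is_derive_eq; rewrite scalerA mulVf// scale1r//.
apply: (@continuous_FTC2 _ _ (fun s => s `^ b / b)) => //.
- apply: derivable_within_continuous => x /pos x0.
  by apply: derivable_powR; rewrite in_itv/= x0.
- have ct (x : R) : 0 < x -> {for x, continuous (fun s : R => s `^ b / b)}.
    move=> x0; apply/differentiable_continuous/derivable1_diffP.
    by have := dP x x0.
  split.
  + by move=> x xe; have := dP x (pos _ (subset_itv_oo_cc xe)).
  + by apply: cvg_at_right_filter; exact: ct.
  + by apply: cvg_at_left_filter; apply: ct; exact: lt_trans et.
- move=> x /subset_itv_oo_cc/pos x0; rewrite derive1E.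
  by have := dP x x0 => H; rewrite derive_val.
Qed.

Lemma integral_powR_le (b t : R) : 0 < b -> 0 < t ->
  (\int[mu]_(s in `]0%R, t]) (s `^ (b - 1))%:E <= (t `^ b / b)%:E)%E.
Proof.
move=> b0 t0.
pose F i := [set` `[i.+1%:R^-1, t : R]].
have UF : \bigcup_i F i = [set` `]0, t]].
  apply/seteqP; split => [x [i _]|x]; rewrite /F /= !in_itv /=.
    by move=> /andP[ix ->]; rewrite andbT (lt_le_trans _ ix)// invr_gt0.
  move=> /andP[x0 xt].
  have [i ix] : exists i : nat, x^-1 < i.+1%:R.
    by exists (Num.truncn x^-1); exact: truncnS_gt.
  exists i => //=; rewrite in_itv/= xt andbT.
  by rewrite -[leRHS]invrK lef_pV2 ?posrE ?invr_gt0// ltW.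
rewrite -UF.
have mf : measurable_fun [set: R] (fun s : R => (s `^ (b - 1))%:E).
  by apply/measurable_EFinP; exact: measurable_powR.
have cvF : (\int[mu]_(x in F i) (x `^ (b - 1))%:E)%E @[i --> \oo] -->
       (\int[mu]_(x in \bigcup_i F i) (x `^ (b - 1))%:E)%E.
  apply: ge0_nondecreasing_set_cvg_integral.
  - move=> n m nm; rewrite subsetEset => x; rewrite /F /= !in_itv/=.
    move=> /andP[nx ->]; rewrite andbT; apply: le_trans nx.
    by rewrite lef_pV2 ?posrE// ler_nat.
  - by move=> i; exact: measurable_itv.
  - by move=> i; exact: measurable_funTS.
  - by move=> i x _; rewrite lee_fin powR_ge0.
rewrite -(cvg_lim _ cvF)//; apply: lime_le; first by apply/cvg_ex; eexists; exact: cvF.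
apply: nearW => i; rewrite /F.
have p0 : 0 <= t `^ b / b by rewrite divr_ge0 ?powR_ge0// ltW.
have [it|it] := ltP i.+1%:R^-1 t.
  rewrite integral_powR_itv ?gt_eqF// lee_fin gerBl// divr_ge0 ?powR_ge0// ltW//.
(* When [t <= 1 / (i + 1)], the interval [F i] contains at most the point [t], so the integral over
   it vanishes. *)
rewrite (@integral_Sset1 _ _ _ t) ?lee_fin//.
move=> x /=; rewrite in_itv/= => /andP[ix xt]; apply/eqP.
by rewrite eq_le xt (le_trans it ix).
Qed.

Lemma measurable_Gamma_integrand (b : R) :
  measurable_fun [set: R] (fun t : R => t `^ (b - 1) * expR (- t)).
Proof.
apply: measurable_funM; first exact: measurable_powR.
by apply: measurableT_comp => //; exact: measurable_expR.
Qed.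

Lemma Gamma_integrand_bound (b : R) : exists C : R, 0 <= C /\
  forall t : R, 1 <= t -> t `^ (b - 1) * expR (- t) <= C * expR (- (2^-1) * t).
Proof.
(* As [|b - 1| / M <= 1/2], the bound [ln t <= t / M + |ln M|] lets half of the exponential absorb
   the power of [t]; the summand 1 keeps [M] positive when [b = 1]. *)
pose M := 2 * `|b - 1| + 1.
have M0 : 0 < M by rewrite ltr_wpDl// mulr_ge0.
exists (expR (`|b - 1| * `|ln M|)); split; first exact: expR_ge0.
move=> t t1; have t0 : 0 < t by exact: lt_le_trans t1.
rewrite /powR gt_eqF// -!expRD ler_expR.
have h : (b - 1) * ln t <= `|b - 1| * (t / M + `|ln M|).
  apply: (@le_trans _ _ (`|b - 1| * ln t)).
    by rewrite ler_wpM2r ?ln_ge0// ler_norm.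
  rewrite ler_wpM2l//.
  have -> : ln t = ln (t / M) + ln M.
    by rewrite -lnM ?posrE ?divr_gt0// divfK// gt_eqF.
  rewrite lerD ?ler_norm//.
  have := @le_ln1Dx R (t / M - 1); rewrite subrKC => H.
  rewrite (le_trans (H _)) ?gerBl//.
  by rewrite ltrBrDl subrr divr_gt0.
have h2 : `|b - 1| * (t / M) <= t / 2.
  rewrite mulrCA ler_wpM2l ?(ltW t0)// ler_pdivrMr//.
  by rewrite /M mulrDr mulrA mulVf// mul1r mulr1 lerDl.
rewrite mulrDr in h; lra.
Qed.

Lemma Gamma_lty (b : R) : 0 < b ->
  (\int[mu]_(t in `]0%R, +oo[) (t `^ (b - 1) * expR (- t))%:E < +oo)%E.
Proof.
move=> b0; have [C [C0 hC]] := Gamma_integrand_bound b.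
have mf := measurable_Gamma_integrand b.
have [mf0 mf1] : measurable_fun (`]0%R, 1%R] : set R) (fun t : R => t `^ (b - 1) * expR (- t)) /\
   measurable_fun (`]1%R, +oo[ : set R) (fun t : R => t `^ (b - 1) * expR (- t)).
  by split; exact: measurable_funTS.
rewrite (@itv_bndbnd_setU _ _ _ (BRight 1)) ?bnd_simp//.
rewrite ge0_integral_setU//=; last 3 first.
- by apply/measurable_EFinP; exact: measurable_funTS.
- by move=> x _; rewrite lee_fin mulr_ge0 ?powR_ge0 ?expR_ge0.
- apply/disj_setPS => x [] /=; rewrite !in_itv/= andbT => /andP[_ +]; rewrite ltNge => ->.
  by [].
apply: lte_add_pinfty.
  apply: (@le_lt_trans _ _ (\int[mu]_(s in `]0%R, 1%R]) (s `^ (b - 1))%:E)%E).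
    apply: ge0_le_integral => //.
    - by move=> x _; rewrite lee_fin mulr_ge0 ?powR_ge0 ?expR_ge0.
    - exact/measurable_EFinP.
    - by apply/measurable_EFinP; apply: measurable_funTS; exact: measurable_powR.
    - move=> x /=; rewrite in_itv/= => /andP[x0 _].
      by rewrite lee_fin ler_piMr ?powR_ge0// -expR0 ler_expR lerNl oppr0 ltW.
  by apply: le_lt_trans (integral_powR_le b0 ltr01) _; rewrite ltry.
(* The factor 2 undoes the normalisation of the exponential density of rate 1/2, whose total mass is
   1. *)
apply: (@le_lt_trans _ _ (\int[mu]_t ((C * 2)%:E * (exponential_pdf 2^-1 t)%:E))%E).
  have mp : measurable_fun [set: R] (fun t : R => ((C * 2)%:E * (exponential_pdf 2^-1 t)%:E)%E).
    apply: measurable_funeM; apply/measurable_EFinP; exact: measurable_exponential_pdf.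
  have p0 (t : R) : (0 <= (C * 2)%:E * (exponential_pdf 2^-1 t)%:E)%E.
    by rewrite mule_ge0// lee_fin ?mulr_ge0// exponential_pdf_ge0.
  apply: (@le_trans _ _ (\int[mu]_(t in `]1%R, +oo[) ((C * 2)%:E * (exponential_pdf 2^-1 t)%:E))%E).
    apply: ge0_le_integral => //.
    - by move=> x _; rewrite lee_fin mulr_ge0 ?powR_ge0 ?expR_ge0.
    - exact/measurable_EFinP.
    - exact: measurable_funTS.
    - move=> x /=; rewrite in_itv/= andbT => x1.
      rewrite exponential_pdfE ?(ltW (lt_trans _ x1))// -EFinM lee_fin.
      by rewrite mulrA mulfK// hC// ltW.
  exact: ge0_subset_integral.
rewrite ge0_integralZl ?integral_exponential_pdf ?mule1 ?ltry//.
- by apply/measurable_EFinP; exact: measurable_exponential_pdf.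
- by move=> x _; rewrite lee_fin exponential_pdf_ge0.
- by rewrite lee_fin mulr_ge0.
Qed.

Lemma Gamma_EFin (b : R) : 0 < b ->
  ((Gamma b)%:E = \int[mu]_(t in `]0%R, +oo[) (t `^ (b - 1) * expR (- t))%:E)%E.
Proof.
move=> b0; rewrite /Gamma /Rintegral fineK// ge0_fin_numE ?Gamma_lty//.
by apply: integral_ge0 => x _; rewrite lee_fin mulr_ge0 ?powR_ge0 ?expR_ge0.
Qed.

(** Only the window [[M, M + 1]] of length 1 is kept. As [M] is free, such bounds do the work of
    Stirling's formula in the convergence of the Mittag-Leffler series. *)
Lemma Gamma_ge_itv (b M m : R) : 0 < b -> 0 < M -> 0 <= m ->
  (forall t, M <= t <= M + 1 -> m <= t `^ (b - 1)) ->
  m * expR (- (M + 1)) <= Gamma b.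
Proof.
move=> b0 M0 m0 hm; rewrite -lee_fin Gamma_EFin//.
have mf := measurable_Gamma_integrand b.
have p0 (x : R) : (0 <= (x `^ (b - 1) * expR (- x))%:E)%E.
  by rewrite lee_fin mulr_ge0 ?powR_ge0 ?expR_ge0.
apply: (@le_trans _ _ (\int[mu]_(t in `[M, (M + 1)%R]) (t `^ (b - 1) * expR (- t))%:E)%E).
  apply: (@le_trans _ _ (\int[mu]_(t in `[M, (M + 1)%R]) (m * expR (- (M + 1)))%:E)%E).
    rewrite integral_cst//= lebesgue_measure_itv/= lte_fin ltrDl ltr01.
    by rewrite -EFinD addrAC subrr add0r mule1.
  apply: ge0_le_integral => //.
  - by move=> x _; rewrite lee_fin mulr_ge0 ?expR_ge0.
  - by apply/measurable_EFinP; exact: measurable_funTS.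
  - move=> x /=; rewrite in_itv/= => xM; rewrite lee_fin ler_pM ?expR_ge0 ?hm//.
    by rewrite ler_expR lerN2; case/andP: xM.
apply: ge0_subset_integral => //.
- by apply/measurable_EFinP; exact: measurable_funTS.
- by move=> x /=; rewrite !in_itv/= andbT => /andP[/(lt_le_trans M0)].
Qed.

Lemma Gamma_gt0 (b : R) : 0 < b -> 0 < Gamma b.
Proof.
move=> b0; pose m := Num.min (1 : R) (2 `^ (b - 1)).
have m0 : 0 < m by rewrite lt_min ltr01 powR_gt0.
apply: lt_le_trans (Gamma_ge_itv b0 ltr01 (ltW m0) _); first by rewrite mulr_gt0 ?expR_gt0.
move=> t /andP[t1 t2]; rewrite /m ge_min; have [b1|b1] := leP 1 b.
  rewrite (_ : 1 <= t `^ (b - 1))// -[leLHS](congr1 (fun f => f (b - 1)) (@powR1 R)).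
  by apply: ge0_ler_powR; rewrite ?subr_ge0 ?nnegrE ?(le_trans ler01 t1).
apply/orP; right; rewrite -[b - 1]opprK !powRN lef_pV2 ?posrE ?powR_gt0 ?(lt_le_trans _ t1)//; last first.
  by rewrite invr_gt0 powR_gt0// (lt_le_trans _ t1).
rewrite -!powRN; apply: ge0_ler_powR; rewrite ?nnegrE ?oppr_ge0 ?subr_le0 ?(le_trans ler01 t1) ?(ltW b1)//.
Qed.

Lemma mule_Vl_eq (x c : R) (X Y : \bar R) : 0 < x ->
  (c%:E * X = (x^-1)%:E * Y)%E -> (Y = (x * c)%:E * X)%E.
Proof.
move=> x0 H; rewrite EFinM -muleA H muleA -EFinM mulfV ?gt_eqF//.
by rewrite mul1e.
Qed.

(** The Riemann-Liouville kernel, extended by 0 to [t <= 0]: causal convolutions become integrals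
    over the whole line, to which translations and Tonelli's theorem apply directly. *)
Definition kern (b t : R) : R := if 0 < t then t `^ (b - 1) / Gamma b else 0.

Lemma kern_ge0 (b t : R) : 0 < b -> 0 <= kern b t.
Proof.
move=> b0; rewrite /kern; case: ifPn => // _.
by rewrite divr_ge0 ?powR_ge0// ltW// Gamma_gt0.
Qed.

Lemma kern_gt0 (b t : R) : 0 < b -> 0 < t -> 0 < kern b t.
Proof. by move=> b0 t0; rewrite /kern t0 divr_gt0 ?powR_gt0// Gamma_gt0. Qed.

Lemma kernE (b t : R) : 0 < t -> kern b t = t `^ (b - 1) / Gamma b.
Proof. by move=> t0; rewrite /kern t0. Qed.

Lemma kern_le0 (b t : R) : t <= 0 -> kern b t = 0.
Proof. by move=> t0; rewrite /kern ltNge t0. Qed.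

Lemma kern_scale (b c t : R) : 0 < c -> kern b (c * t) = c `^ (b - 1) * kern b t.
Proof.
move=> c0; rewrite /kern pmulr_rgt0//; case: ifPn => t0; last by rewrite mulr0.
by rewrite powRM ?(ltW c0) ?(ltW t0)// mulrA.
Qed.

Lemma kern_patch (b : R) :
  kern b = ((fun t => t `^ (b - 1) / Gamma b) \_ (`]0, +oo[ : set R)).
Proof.
apply/funext => t; rewrite /kern patchE.
have [t0|t0] := ltP 0 t; first by rewrite mem_set//= in_itv/= t0.
by rewrite memNset//= in_itv/= ltNge t0.
Qed.

Lemma measurable_kern (b : R) : measurable_fun [set: R] (kern b).
Proof.
rewrite kern_patch; apply/measurable_restrict => //; rewrite setTI.
by apply: measurable_funTS; apply: measurable_funM => //; exact: measurable_powR.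
Qed.

Lemma integral_kern_expR (b : R) : 0 < b ->
  (\int[mu]_t (kern b t * expR (- t))%:E = 1)%E.
Proof.
move=> b0; have G0 := Gamma_gt0 b0.
transitivity (((Gamma b)^-1)%:E * \int[mu]_(t in `]0%R, +oo[) (t `^ (b - 1) * expR (- t))%:E)%E; last first.
  by rewrite -Gamma_EFin// -EFinM mulVf ?gt_eqF.
rewrite -ge0_integralZl//; last 3 first.
- by apply/measurable_EFinP; apply: measurable_funTS; exact: measurable_Gamma_integrand.
- by move=> x _; rewrite lee_fin mulr_ge0 ?powR_ge0 ?expR_ge0.
- by rewrite lee_fin invr_ge0 ltW.
rewrite [RHS]integral_mkcond; apply: eq_integral => t _; rewrite patchE /kern.
have [t0|t0] := ltP 0 t.
  by rewrite mem_set//= ?in_itv/= ?t0// -EFinM; congr (_%:E); rewrite mulrCA mulrA.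
by rewrite memNset//= ?in_itv/= ?ltNge ?t0// mul0r.
Qed.

Lemma measurable_comp_fst (f : R -> R) : measurable_fun [set: R] f ->
  measurable_fun [set: measurableTypeR R * measurableTypeR R] (fun z => f z.1).
Proof. by move=> mf; exact: (measurableT_comp mf measurable_fst). Qed.

Lemma measurable_comp_snd (f : R -> R) : measurable_fun [set: R] f ->
  measurable_fun [set: measurableTypeR R * measurableTypeR R] (fun z => f z.2).
Proof. by move=> mf; exact: (measurableT_comp mf measurable_snd). Qed.

Lemma measurable_comp_sub (f : R -> R) : measurable_fun [set: R] f ->
  measurable_fun [set: measurableTypeR R * measurableTypeR R] (fun z => f (z.1 - z.2)).
Proof.
move=> mf; apply: (measurableT_comp mf).
exact: measurable_funB measurable_fst measurable_snd.
Qed.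

(** A Beta integral: homogeneity of the kernels makes the convolution equal to [B * t^(a + b - 1)]
    for [t > 0], and the constant is found by integrating against [exp(- t)], because this weight
    factors along the convolution and gives each kernel total mass 1. *)
Lemma integral_kern_conv (a b t : R) : 0 < a -> 0 < b ->
  (\int[mu]_s (kern a (t - s) * kern b s)%:E = (kern (a + b) t)%:E)%E.
Proof.
move=> a0 b0.
have ab0 : 0 < a + b by exact: addr_gt0.
have mk (x : R) : measurable_fun [set: R] (fun s => (kern a (x - s) * kern b s)%:E).
  apply/measurable_EFinP; apply: measurable_funM; last exact: measurable_kern.
  by apply: measurableT_comp; [exact: measurable_kern|exact: measurable_funB].
have k0 (x s : R) : (0 <= (kern a (x - s) * kern b s)%:E)%E.
  by rewrite lee_fin mulr_ge0 ?kern_ge0.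
pose B := (\int[mu]_s (kern a (1 - s) * kern b s)%:E)%E.
have B0 : (0 <= B)%E by apply: integral_ge0.
have scal (x : R) : 0 < x ->
    (\int[mu]_s (kern a (x - s) * kern b s)%:E = (x `^ (a + b - 1))%:E * B)%E.
  move=> x0; have := integral_affine 0 x0 (mk x) (k0 x).
  rewrite (_ : (\int[mu]_x0 _)%E = ((x `^ (a - 1) * x `^ (b - 1))%:E * B)%E); last first.
    rewrite /B -ge0_integralZl.
    - apply: eq_integral => s _; rewrite addr0 -EFinM; congr (_%:E).
      by rewrite -{1}[x]mulr1 -mulrBr !kern_scale// mulrACA.
    - exact: measurableT.
    - exact: mk.
    - by move=> s _; exact: k0.
    - by rewrite lee_fin mulr_ge0 ?powR_ge0.
  move=> /(mule_Vl_eq x0) ->; congr (_%:E * _)%E.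
  rewrite -powRD; last by rewrite (gt_eqF x0) implybT.
  rewrite (_ : a + b - 1 = 1 + (a - 1 + (b - 1))); last by ring.
  by rewrite [RHS]powRD ?(gt_eqF x0) ?implybT// powRr1// ltW.
have neg (x : R) : x <= 0 -> (\int[mu]_s (kern a (x - s) * kern b s)%:E = 0)%E.
  move=> x0; rewrite integral0_eq// => s _; have [s0|s0] := leP s 0.
    by rewrite [kern b s]kern_le0// mulr0.
  by rewrite [kern a _]kern_le0 ?mul0r// subr_le0 (le_trans x0)// ltW.
(* Since [exp(- x) = exp(- (x - s)) * exp(- s)], the double integral of [f] is 1 in one order and
   [Gamma (a + b) * B] in the other. *)
pose f (z : measurableTypeR R * measurableTypeR R) : \bar R :=
  ((kern a (z.1 - z.2) * expR (- (z.1 - z.2)))%:E * (kern b z.2 * expR (- z.2))%:E)%E.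
have mf1 : measurable_fun [set: R] (fun s => kern a s * expR (- s)).
  apply: measurable_funM; first exact: measurable_kern.
  by apply: measurableT_comp => //; exact: measurable_expR.
have mf2 : measurable_fun [set: R] (fun s => kern b s * expR (- s)).
  apply: measurable_funM; first exact: measurable_kern.
  by apply: measurableT_comp => //; exact: measurable_expR.
have mf : measurable_fun [set: measurableTypeR R * measurableTypeR R] f.
  apply: emeasurable_funM; apply/measurable_EFinP.
    exact: measurable_comp_sub mf1.
  exact: measurable_comp_snd mf2.
have f0 z : (0 <= f z)%E.
  by rewrite /f -EFinM lee_fin !mulr_ge0 ?kern_ge0 ?expR_ge0.
have e1 (s : R) : (0 <= (kern a s * expR (- s))%:E)%E.
  by rewrite lee_fin mulr_ge0 ?kern_ge0 ?expR_ge0.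
have e2 (s : R) : (0 <= (kern b s * expR (- s))%:E)%E.
  by rewrite lee_fin mulr_ge0 ?kern_ge0 ?expR_ge0.
have me1 : measurable_fun [set: R] (fun s => (kern a s * expR (- s))%:E).
  by apply/measurable_EFinP; exact: mf1.
have rhs : (\int[mu]_s \int[mu]_x f (x, s) = 1)%E.
  rewrite -(integral_kern_expR b0); apply: eq_integral => s _.
  rewrite /f /= ge0_integralZr.
  - rewrite (integral_shift s me1 e1) integral_kern_expR// mul1e//.
  - exact: measurableT.
  - apply/measurable_EFinP; apply: (measurableT_comp mf1).
    exact: measurable_funB.
  - by move=> x _; exact: e1.
  - exact: e2.
have G0 := Gamma_gt0 ab0.
have lhs (x : R) : (\int[mu]_s f (x, s) =
    ((kern (a + b) x * expR (- x))%:E * ((Gamma (a + b))%:E * B)))%E.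
  transitivity ((expR (- x))%:E * \int[mu]_s (kern a (x - s) * kern b s)%:E)%E.
    rewrite -ge0_integralZl.
    - apply: eq_integral => s _; rewrite /f /= -!EFinM; congr (_%:E).
      have -> : expR (- x) = expR (- (x - s)) * expR (- s).
        by rewrite -expRD; congr expR; ring.
      by ring.
    - exact: measurableT.
    - exact: mk.
    - by move=> s _; exact: k0.
    - by rewrite lee_fin expR_ge0.
  have [x0|x0] := ltP 0 x.
    rewrite scal// kernE// !muleA -!EFinM; congr (_%:E * _)%E.
    by field; rewrite gt_eqF.
  by rewrite neg// mule0 kern_le0// mul0r mul0e.
have := lebesgue_tonelli mf f0; rewrite rhs.
under eq_integral do rewrite lhs.
rewrite ge0_integralZr; last 4 first.
- exact: measurableT.
- apply/measurable_EFinP; apply: measurable_funM; first exact: measurable_kern.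
  by apply: measurableT_comp => //; exact: measurable_expR.
- by move=> x _; rewrite lee_fin mulr_ge0 ?kern_ge0 ?expR_ge0.
- by rewrite mule_ge0// lee_fin ltW.
rewrite integral_kern_expR// mul1e => GB.
have BE : B = ((Gamma (a + b))^-1)%:E.
  rewrite -[LHS]mul1e -(mulVf (lt0r_neq0 G0)) EFinM -muleA GB mule1//.
have [t0|t0] := ltP 0 t; first by rewrite scal// BE kernE.
by rewrite neg// kern_le0.
Qed.

End Gamma_function.

(** * Mittag-Leffler series *)

Section nonnegative_series.
Context {R : realType}.

Lemma nneseries_ge_term (u : nat -> \bar R) n : (forall k, (0 <= u k)%E) ->
  (u n <= \sum_(0 <= k <oo) u k)%E.
Proof.
move=> u0; apply: le_trans (nneseries_lim_ge n.+1 _); last by [].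
by rewrite big_nat_recr//= leeDr// sume_ge0.
Qed.

Lemma nneseries_EFin (u : nat -> R) : (forall n, 0 <= u n) -> cvgn (series u) ->
  (\sum_(0 <= k <oo) (u k)%:E = (limn (series u))%:E)%E.
Proof.
move=> u0 cu; apply/cvg_lim => //.
rewrite (_ : (fun n => _) = EFin \o series u).
  by apply: cvg_EFin; [exact: nearW|exact: cu].
by apply/funext => n; rewrite /series /= sumEFin.
Qed.

End nonnegative_series.

Section powers_and_series.
Context {R : realType}.

Lemma gt0_powRD (t x y : R) : 0 < t -> t `^ (x + y) = t `^ x * t `^ y.
Proof. by move=> t0; rewrite powRD// (gt_eqF t0) implybT. Qed.

Lemma cvg_seriesM (c : R) (u : nat -> R) : cvgn (series u) ->
  series (fun n => c * u n) @ \oo --> c * limn (series u).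
Proof.
move=> cu; rewrite (_ : series _ = (fun n => c * series u n)).
  by apply: cvgM => //; exact: cvg_cst.
by apply/funext => n; rewrite /series /= mulr_sumr.
Qed.

Lemma is_cvg_seriesM (c : R) (u : nat -> R) : cvgn (series u) ->
  cvgn (series (fun n => c * u n)).
Proof. by move=> cu; apply/cvg_ex; eexists; exact: cvg_seriesM. Qed.

Lemma lim_seriesM (c : R) (u : nat -> R) : cvgn (series u) ->
  limn (series (fun n => c * u n)) = c * limn (series u).
Proof. by move=> cu; apply/cvg_lim => //; exact: cvg_seriesM. Qed.

Lemma le0_ler_powR (c x y : R) : c <= 0 -> 0 < x -> x <= y -> y `^ c <= x `^ c.
Proof.
move=> c0 x0 xy; have y0 : 0 < y by exact: lt_le_trans xy.
rewrite -(opprK c) !(powRN _ (- c)) lef_pV2 ?posrE ?powR_gt0//.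
by apply: ge0_ler_powR; rewrite ?nnegrE ?oppr_ge0 ?(ltW x0) ?(ltW y0).
Qed.

Lemma ge0_integrable d (T : measurableType d) (mu : {measure set T -> \bar R})
    (D : set T) (f : T -> R) : measurable D -> measurable_fun D f ->
  (forall x, D x -> 0 <= f x) -> (\int[mu]_(x in D) (f x)%:E < +oo)%E ->
  mu.-integrable D (EFin \o f).
Proof.
move=> mD mf f0 foo; apply/integrableP; split; first exact/measurable_EFinP.
apply: le_lt_trans foo; rewrite le_eqVlt; apply/orP; left; apply/eqP.
by apply: eq_integral => x /set_mem Dx /=; rewrite ger0_norm// f0.
Qed.

Lemma integrableMr_cst d (T : measurableType d) (mu : {measure set T -> \bar R})
    (D : set T) (f : T -> R) (c : R) : measurable D ->
  mu.-integrable D (EFin \o f) -> mu.-integrable D (EFin \o (fun x => f x * c)).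
Proof.
by move=> mD fi; have := integrableZr mD c fi; exact: eq_integrable.
Qed.

Lemma integrableMl_cst d (T : measurableType d) (mu : {measure set T -> \bar R})
    (D : set T) (f : T -> R) (c : R) : measurable D ->
  mu.-integrable D (EFin \o f) -> mu.-integrable D (EFin \o (fun x => c * f x)).
Proof.
by move=> mD fi; have := integrableZl mD c fi; exact: eq_integrable.
Qed.

End powers_and_series.

Section integral_of_series.
Context d (T : measurableType d) {R : realType}.
Variables (mu : {measure set T -> \bar R}) (D : set T).
Hypothesis mD : measurable D.

Lemma measurable_fun_series (f : nat -> T -> R) :
  (forall n, measurable_fun D (f n)) ->
  (forall x, D x -> cvgn (series (f ^~ x))) ->
  measurable_fun D (fun x => limn (series (f ^~ x))).
Proof.
move=> mf cf; apply: (@measurable_fun_cvg _ _ _ _ (fun n x => series (f ^~ x) n)) => //.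
by move=> n; apply: measurable_sum => i; exact: mf.
Qed.

Lemma Rintegral_sum (I : Type) (r : seq I) (f : I -> T -> R) :
  (forall i, mu.-integrable D (EFin \o f i)) ->
  \int[mu]_(x in D) (\sum_(i <- r) f i x) = \sum_(i <- r) \int[mu]_(x in D) f i x.
Proof.
move=> fi; elim: r => [|i r IH].
  rewrite big_nil; under eq_Rintegral do rewrite big_nil.
  by rewrite Rintegral_cst// mul0r.
rewrite big_cons -IH -RintegralD//.
  by apply: eq_Rintegral => x _; rewrite big_cons.
apply: (@eq_integrable _ _ _ mu D mD (fun x => \sum_(i <- r) (EFin \o f i) x)%E).
  by move=> x _ /=; rewrite sumEFin.
by apply: integrable_sum => // k _; exact: fi.
Qed.

(** Dominated convergence for the partial sums, with the sum of the [|f n|] as majorant; monotone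
    convergence shows that this majorant is integrable. *)
Lemma Rintegral_series (f : nat -> T -> R) :
  (forall n, measurable_fun D (f n)) ->
  (\sum_(0 <= n <oo) \int[mu]_(x in D) `|f n x|%:E < +oo)%E ->
  (forall x, D x -> cvgn (series (f ^~ x))) ->
  mu.-integrable D (fun x => (limn (series (f ^~ x)))%:E) /\
  series (fun n => \int[mu]_(x in D) f n x) @ \oo -->
    \int[mu]_(x in D) limn (series (f ^~ x)).
Proof.
move=> mf foo cf.
have mnf n : measurable_fun D (fun x => `|f n x|%:E).
  by apply/measurable_EFinP; exact: measurableT_comp.
pose g x := (\sum_(0 <= n <oo) `|f n x|%:E)%E.
have g0 x : D x -> (0 <= g x)%E by move=> _; apply: nneseries_ge0 => *; rewrite lee_fin.
have gE : (\int[mu]_(x in D) g x = \sum_(0 <= n <oo) \int[mu]_(x in D) `|f n x|%:E)%E.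
  by rewrite /g integral_nneseries// => n x _; rewrite lee_fin.
have ig : mu.-integrable D g.
  apply/integrableP; split; first by apply: ge0_emeasurable_sum => // n x _; rewrite lee_fin.
  rewrite (eq_integral g) ?gE// => x /set_mem Dx; rewrite gee0_abs//; exact: g0.
have fi n : mu.-integrable D (EFin \o f n).
  apply/integrableP; split; first exact/measurable_EFinP.
  apply: le_lt_trans foo.
  apply: (@nneseries_ge_term _ (fun n => \int[mu]_(x in D) `|f n x|%:E)%E).
  by move=> k; apply: integral_ge0 => x _; rewrite lee_fin.
have mlim := measurable_fun_series mf cf.
have [|||||H1 _ H3] := @dominated_convergence _ _ _ mu D mD
  (fun n x => (series (f ^~ x) n)%:E) (fun x => (limn (series (f ^~ x)))%:E) g.
- by move=> n; apply/measurable_EFinP; apply: measurable_sum => i; exact: mf.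
- exact/measurable_EFinP.
- by apply: aeW => x Dx; apply: cvg_EFin; [exact: nearW|exact: cf].
- exact: ig.
- apply: aeW => x n Dx; rewrite /=.
  apply: le_trans (nneseries_lim_ge n _); last by move=> *; rewrite lee_fin.
  rewrite /series /= sumEFin lee_fin; exact: ler_norm_sum.
split => //.
have IE : (\int[mu]_(x in D) (limn (series (f ^~ x)))%:E =
   (\int[mu]_(x in D) limn (series (f ^~ x)))%:E)%E.
  by rewrite /Rintegral fineK//; exact: integrable_fin_num.
move: H3; rewrite IE => /fine_cvgP[_].
rewrite (_ : (fine \o _) = series (fun n => \int[mu]_(x in D) f n x))//.
apply/funext => n /=; rewrite /series /= -[LHS]/(Rintegral mu D (fun x => \sum_(0 <= k < n) f k x)).
by rewrite Rintegral_sum.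
Qed.

End integral_of_series.

Section Mittag_Leffler_series.
Context {R : realType}.
Local Notation mu := (@lebesgue_measure R).

(** For [b < 1] the power [t^(b - 1)] decreases, and on [[M, M + 1]], where [t <= 2 * M], it is at
    least [2^(b - 1) * M^(b - 1)]; the factor 1/2 bounds [2^(b - 1)] from below because [b > 0]. *)
Lemma Gamma_ge_half (b M : R) : 0 < b -> 1 <= M ->
  2^-1 * M `^ (b - 1) * expR (- (M + 1)) <= Gamma b.
Proof.
move=> b0 M1; have M0 : 0 < M by exact: lt_le_trans M1.
apply: Gamma_ge_itv; rewrite ?mulr_ge0 ?powR_ge0//.
move=> t /andP[Mt tM]; have t0 : 0 < t by exact: lt_le_trans Mt.
have [b1|b1] := leP 1 b.
  apply: (@le_trans _ _ (M `^ (b - 1))).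
    by rewrite ler_piMl ?powR_ge0// invf_le1// ler1n.
  by apply: ge0_ler_powR; rewrite ?subr_ge0 ?nnegrE ?(ltW M0) ?(ltW t0).
have h : (2 * M) `^ (b - 1) <= t `^ (b - 1).
  apply: le0_ler_powR; rewrite ?subr_le0 ?(ltW b1)//; lra.
apply: le_trans h; rewrite powRM ?(ltW M0)// ler_wpM2r ?powR_ge0//.
rewrite -powR_inv1//; apply: ler_powR; first by rewrite ler1n.
by rewrite lerBDr addrC subrr ltW.
Qed.

Lemma Mittag_Leffler_cvg (a b x : R) : 0 < a -> 0 < b ->
  cvgn (series (fun k : nat => x ^+ k / Gamma (a * k%:R + b))).
Proof.
move=> a0 b0; apply: normed_cvg.
have ab0 (k : nat) : 0 < a * k%:R + b by rewrite ltr_wpDl// mulr_ge0// ltW.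
(* [M] will solve [M^a = y], so that the lower bound on [Gamma (a * k + b)] grows like [y^k] and the
   terms are dominated by a geometric series of ratio [|x| / y < 1]. *)
pose y := 2 * `|x| + 1; have y1 : 1 <= y by rewrite lerDr mulr_ge0.
have y0 : 0 < y by exact: lt_le_trans y1.
pose M := y `^ a^-1.
have M1 : 1 <= M.
  by rewrite /M -(powRr0 y) ler_powR// invr_ge0 ltW.
have M0 : 0 < M by exact: lt_le_trans M1.
have MaE : M `^ a = y by rewrite /M -powRrM mulVf ?gt_eqF// powRr1// ltW.
pose C := 2 * expR (M + 1) * M `^ (1 - b).
have C0 : 0 <= C by rewrite !mulr_ge0 ?powR_ge0 ?expR_ge0.
apply: (@series_le_cvg _ _ (geometric C (`|x| / y))) => [n|n|n|].
- exact: normr_ge0.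
- by rewrite /geometric /= mulr_ge0// exprn_ge0// divr_ge0// ltW.
- rewrite /= normrM normrX normrV ?unitfE ?gt_eqF ?Gamma_gt0//.
  rewrite (ger0_norm (ltW (Gamma_gt0 (ab0 n)))) /geometric /= expr_div_n mulrCA.
  rewrite ler_wpM2l ?exprn_ge0//.
  have h0 : 0 < 2^-1 * M `^ (a * n%:R + b - 1) * expR (- (M + 1)).
    by rewrite !mulr_gt0 ?powR_gt0 ?expR_gt0.
  have := Gamma_ge_half (ab0 n) M1; rewrite -(@lef_pV2 R) ?posrE ?Gamma_gt0//.
  move/le_trans; apply; rewrite le_eqVlt; apply/orP; left; apply/eqP.
  have -> : a * n%:R + b - 1 = a * n%:R - (1 - b) by ring.
  rewrite gt0_powRD// powRN powRrM MaE powR_mulrn ?(ltW y0)//.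
  rewrite expRN /C; field; rewrite !gt_eqF ?expR_gt0 ?powR_gt0 ?exprn_gt0//.
- apply: is_cvg_geometric_series.
  rewrite ger0_norm ?divr_ge0 ?(ltW y0)// ltr_pdivrMr// mul1r.
  by rewrite /y; have := normr_ge0 x; lra.
Qed.

Lemma Gamma1 : Gamma 1 = 1 :> R.
Proof.
apply: EFin_inj; rewrite Gamma_EFin// -(integral_exponential_pdf (@ltr01 R)).
have mpdf : measurable_fun [set: R] (fun x : R => (exponential_pdf (1 : R) x)%:E).
  by apply/measurable_EFinP; exact: measurable_exponential_pdf.
have -> : (\int[mu]_x (exponential_pdf 1 x)%:E = \int[mu]_(x in `[0%R, +oo[) (exponential_pdf 1 x)%:E)%E.
  rewrite [RHS]integral_mkcond; apply: eq_integral => x _; rewrite patchE.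
  case: ifPn => //; rewrite notin_setE /= in_itv/= andbT => /negP; rewrite -ltNge => x0.
  by rewrite lt0_exponential_pdf.
rewrite -integral_itv_obnd_cbnd; last exact: measurable_funTS.
apply: eq_integral => x; rewrite inE/= in_itv/= andbT => x0.
by rewrite exponential_pdfE ?(ltW x0)// subrr powRr0 !mul1r mulN1r.
Qed.

Variables (a lam : R).
Hypotheses (a0 : 0 < a) (lam0 : 0 < lam).

Let ab0 (b : R) (k : nat) : 0 < b -> 0 < a * k%:R + b.
Proof. by move=> b0; rewrite ltr_wpDl// mulr_ge0// ltW. Qed.

(** Summed over [j], these terms give [t^(b - 1) * E_{a,b}(- lam * t^a)], extended by 0 to [t <= 0].
    Written with kernels, convolution with [kern c] acts on each term by the shift [b -> b + c]. *)
Definition ml_term (b : R) (j : nat) (t : R) : R := (- lam) ^+ j * kern (a * j%:R + b) t.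

Definition ml_fun (b t : R) : R := limn (series (fun j => ml_term b j t)).

Lemma ml_termE (b : R) (j : nat) (t : R) : 0 < b -> 0 < t ->
  ml_term b j t = t `^ (b - 1) * ((- lam * t `^ a) ^+ j / Gamma (a * j%:R + b)).
Proof.
move=> b0 t0; rewrite /ml_term kernE// exprMn -(powR_mulrn j (powR_ge0 t a)) -powRrM.
have -> : a * j%:R + b - 1 = a * j%:R + (b - 1) by ring.
rewrite (gt0_powRD _ (b - 1) t0); ring.
Qed.

Lemma norm_ml_term (b : R) (j : nat) (t : R) : 0 < b -> `|ml_term b j t| = lam ^+ j * kern (a * j%:R + b) t.
Proof.
move=> b0; rewrite normrM normrX normrN (ger0_norm (ltW lam0)).
by rewrite (ger0_norm (kern_ge0 _ (ab0 j b0))).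
Qed.

Lemma ml_fun_le0 (b t : R) : t <= 0 -> ml_fun b t = 0.
Proof.
move=> t0; rewrite /ml_fun (_ : (fun j => _) = cst 0); last first.
  by apply/funext => j; rewrite /ml_term kern_le0// mulr0.
rewrite (_ : series _ = cst 0) ?lim_cst//.
by apply/funext => n; rewrite /series /= big1.
Qed.

Lemma ml_term_cvg (b t : R) : 0 < b -> cvgn (series (fun j => ml_term b j t)).
Proof.
move=> b0; have [t0|t0] := leP t 0.
  rewrite (_ : series _ = cst 0); first exact: is_cvg_cst.
  by apply/funext => n; rewrite /series /= big1// => j _; rewrite /ml_term kern_le0// mulr0.
rewrite (_ : (fun j => _) = t `^ (b - 1) *: (fun j => (- lam * t `^ a) ^+ j / Gamma (a * j%:R + b))).
  by apply: is_cvg_seriesZ; exact: Mittag_Leffler_cvg.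
by apply/funext => j; rewrite ml_termE.
Qed.

Lemma ml_funE (b t : R) : 0 < b -> 0 < t ->
  ml_fun b t = t `^ (b - 1) * mittag_leffler a b (- lam * t `^ a).
Proof.
move=> b0 t0; rewrite /ml_fun /mittag_leffler.
rewrite (_ : (fun j => _) = t `^ (b - 1) *: (fun j => (- lam * t `^ a) ^+ j / Gamma (a * j%:R + b))).
  by rewrite lim_seriesZ//; exact: Mittag_Leffler_cvg.
by apply/funext => j; rewrite ml_termE.
Qed.

Lemma ml_norm_cvg (b t : R) : 0 < b -> cvgn (series (fun j => lam ^+ j * kern (a * j%:R + b) t)).
Proof.
move=> b0; have [t0|t0] := leP t 0.
  rewrite (_ : series _ = cst 0); first exact: is_cvg_cst.
  by apply/funext => n; rewrite /series /= big1// => j _; rewrite kern_le0// mulr0.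
rewrite (_ : (fun j => _) = t `^ (b - 1) *: (fun j => (lam * t `^ a) ^+ j / Gamma (a * j%:R + b))).
  by apply: is_cvg_seriesZ; exact: Mittag_Leffler_cvg.
apply/funext => j; apply: etrans; last exact: (erefl (t `^ (b - 1) * ((lam * t `^ a) ^+ j / Gamma (a * j%:R + b)))).
rewrite kernE// exprMn -(powR_mulrn j (powR_ge0 t a)) -powRrM.
have -> : a * j%:R + b - 1 = a * j%:R + (b - 1) by ring.
by rewrite (gt0_powRD _ (b - 1) t0); ring.
Qed.

(** Absolute values turn the Mittag-Leffler series into one with positive terms, monotone in [t];
    the remaining power is the singularity of [kern b] at 0. *)
Lemma ml_fun_bound (b t tau : R) : 0 < b -> 0 < t -> t <= tau ->
  `|ml_fun b t| <= t `^ (b - 1) * mittag_leffler a b (lam * tau `^ a).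
Proof.
move=> b0 t0 tT; rewrite ml_funE// normrM (ger0_norm (powR_ge0 _ _)).
rewrite ler_wpM2l ?powR_ge0//.
have nE : (fun k => `|(- lam * t `^ a) ^+ k / Gamma (a * k%:R + b)|) =
    (fun k : nat => (lam * t `^ a) ^+ k / Gamma (a * k%:R + b)).
  apply/funext => k.
  rewrite normrM normrX normrM normrN (ger0_norm (ltW lam0)) (ger0_norm (powR_ge0 _ _)).
  by rewrite ger0_norm// invr_ge0 ltW// Gamma_gt0// ab0.
have cN : cvgn (series (fun k => `|(- lam * t `^ a) ^+ k / Gamma (a * k%:R + b)|)).
  by rewrite nE; exact: Mittag_Leffler_cvg.
apply: (@le_trans _ _ (limn (series (fun k => `|(- lam * t `^ a) ^+ k / Gamma (a * k%:R + b)|)))).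
  exact: (lim_series_norm cN).
rewrite nE.
apply: lim_series_le => [||k]; [exact: Mittag_Leffler_cvg|exact: Mittag_Leffler_cvg|].
rewrite ler_wpM2r ?invr_ge0 ?(ltW (Gamma_gt0 (ab0 k b0)))// lerXn2r ?nnegrE ?mulr_ge0 ?powR_ge0 ?(ltW lam0)//.
rewrite ler_wpM2l ?(ltW lam0)//; apply: ge0_ler_powR; rewrite ?nnegrE ?(ltW a0) ?(ltW t0)//.
exact: le_trans (ltW t0) tT.
Qed.

Lemma measurable_ml_fun (b : R) : 0 < b -> measurable_fun [set: R] (ml_fun b).
Proof.
move=> b0; apply: measurable_fun_series => [|x _]; last exact: ml_term_cvg.
by move=> n; apply: measurable_funM => //; exact: measurable_kern.
Qed.

(** The term of index 0 is [kern b], and shifting the index in the rest turns [a * (j + 1) + b] into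
    [a * j + (b + a)]. For [b = a] and [b = 1] this becomes, with [ml_fun_conv], the Volterra
    equations of [p] and [e]. *)
Lemma ml_fun_rec (b t : R) : 0 < b -> ml_fun b t = kern b t - lam * ml_fun (b + a) t.
Proof.
move=> b0; have ba0 : 0 < b + a by exact: addr_gt0.
have c1 := @ml_term_cvg b t b0; have c2 := @ml_term_cvg (b + a) t ba0.
rewrite /ml_fun; apply/cvg_lim => //.
rewrite -(cvg_shiftS (series (fun j => ml_term b j t))).
have -> : (fun n => series (fun j => ml_term b j t) n.+1) =
    (fun n => kern b t - lam * series (fun j => ml_term (b + a) j t) n).
  apply/funext => n; rewrite /series /= big_nat_recl//.
  rewrite {1}/ml_term expr0 mul1r mulr0 add0r; congr (_ + _).
  rewrite mulr_sumr -sumrN; apply: eq_bigr => i _; rewrite /ml_term exprS.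
  have -> : a * i.+1%:R + b = a * i%:R + (b + a) by rewrite -natr1; ring.
  by ring.
apply: cvgB; first exact: cvg_cst.
by apply: cvgM => //; exact: cvg_cst.
Qed.

(** Termwise, by the semigroup property of the kernels. The absolute values of the terms convolve to
    those of the series at [b + c], which is absolutely convergent, so sum and integral may be
    exchanged. *)
Lemma ml_fun_conv (b c t : R) : 0 < b -> 0 < c ->
  mu.-integrable setT (fun s => (kern c (t - s) * ml_fun b s)%:E) /\
  \int[mu]_s (kern c (t - s) * ml_fun b s) = ml_fun (b + c) t.
Proof.
move=> b0 c0; have bc0 : 0 < b + c by exact: addr_gt0.
pose f j s := kern c (t - s) * ml_term b j s.
have mkc : measurable_fun [set: R] (fun s => kern c (t - s)).
  by apply: (measurableT_comp (measurable_kern c)); exact: measurable_funB.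
have mt j : measurable_fun [set: R] (fun s => (kern c (t - s) * kern (a * j%:R + b) s)).
  exact: measurable_funM mkc (measurable_kern _).
have mf j : measurable_fun [set: R] (f j).
  apply: (measurable_funM mkc).
  exact: measurable_funM (measurable_cst _) (measurable_kern _).
have k0 j s : 0 <= kern c (t - s) * kern (a * j%:R + b) s.
  by rewrite mulr_ge0 ?kern_ge0 ?ab0.
have Kc j : (\int[mu]_s (kern c (t - s) * kern (a * j%:R + b) s)%:E = (kern (a * j%:R + (b + c)) t)%:E)%E.
  rewrite (integral_kern_conv t c0 (ab0 j b0)) (_ : c + _ = a * j%:R + (b + c))//; ring.
have nf j : (\int[mu]_s `|f j s|%:E = (lam ^+ j * kern (a * j%:R + (b + c)) t)%:E)%E.
  rewrite EFinM -Kc -ge0_integralZl.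
  - apply: eq_integral => s _; rewrite -EFinM; congr (_%:E).
    by rewrite normrM norm_ml_term// ger0_norm ?kern_ge0// mulrCA.
  - exact: measurableT.
  - by apply/measurable_EFinP; exact: mt.
  - by move=> s _; rewrite lee_fin.
  - by rewrite lee_fin exprn_ge0// ltW.
have If j : \int[mu]_s f j s = ml_term (b + c) j t.
  have ik : mu.-integrable setT (EFin \o (fun s => kern c (t - s) * kern (a * j%:R + b) s)).
    apply: ge0_integrable => //; first exact: mt.
    by rewrite Kc ltry.
  transitivity (\int[mu]_s ((- lam) ^+ j * (kern c (t - s) * kern (a * j%:R + b) s))).
    by apply: eq_Rintegral => s _; rewrite /f /ml_term mulrCA.
  rewrite RintegralZl//; congr (_ * _); by rewrite /Rintegral Kc.
have [||H1 H2] := @Rintegral_series _ _ _ mu setT measurableT f mf.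
- under eq_eseriesr do rewrite nf.
  rewrite nneseries_EFin ?ltry//; last exact: ml_norm_cvg.
  by move=> n; rewrite mulr_ge0 ?exprn_ge0 ?(ltW lam0)// kern_ge0 ?ab0.
- by move=> s _; exact: is_cvg_seriesM (@ml_term_cvg b s b0).
have fE s : limn (series (f ^~ s)) = kern c (t - s) * ml_fun b s.
  exact: lim_seriesM (@ml_term_cvg b s b0).
split; first by move: H1; apply: eq_integrable => // s _; rewrite fE.
under eq_Rintegral do rewrite -fE.
move/cvg_lim : H2 => <-//.
rewrite /ml_fun; congr (limn (series _)); apply/funext => j; exact: If.
Qed.

End Mittag_Leffler_series.

(** * Sign, monotonicity and decay of the relaxation function *)

Section Mittag_Leffler_sign.
Context {R : realType}.
Local Notation mu := (@lebesgue_measure R).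
Variables (a lam : R).
Hypotheses (a0 : 0 < a) (a1 : a < 1) (lam0 : 0 < lam).

Let k (t : R) := kern a t.
Let p (t : R) := ml_fun a lam a t.

Let mp : measurable_fun [set: R] p. Proof. exact: measurable_ml_fun. Qed.
Let mk : measurable_fun [set: R] k. Proof. exact: measurable_kern. Qed.

(** The Volterra equation of [p], from the recursion at [b = a]; all sign information below is drawn
    from it. *)
Let pE t : p t = k t - lam * \int[mu]_s (k (t - s) * p s).
Proof.
have [_ ->] := ml_fun_conv a0 lam0 t a0 a0.
by rewrite /p [LHS]ml_fun_rec.
Qed.

Let int_p t : mu.-integrable setT (fun s => (k (t - s) * p s)%:E).
Proof. by have [] := ml_fun_conv a0 lam0 t a0 a0. Qed.

Lemma kern_nonincreasing (x y : R) : 0 < x -> x <= y -> kern a y <= kern a x.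
Proof.
move=> x0 xy; have y0 : 0 < y by exact: lt_le_trans xy.
rewrite !kernE// ler_wpM2r ?invr_ge0 ?(ltW (Gamma_gt0 a0))//.
by apply: le0_ler_powR; rewrite ?subr_le0 ?(ltW a1).
Qed.

(* [k (t - s) / k t = (1 - s / t) ^ (a - 1)] is nonincreasing in [t]. *)
Lemma kern_log_convex (s t1 t2 : R) : 0 < s -> s < t1 -> t1 <= t2 ->
  k (t2 - s) * k t1 <= k (t1 - s) * k t2.
Proof.
move=> s0 st1 t12.
have t10 : 0 < t1 by exact: lt_trans st1.
have t20 : 0 < t2 by exact: lt_le_trans t12.
have h1 : 0 < t1 - s by rewrite subr_gt0.
have h2 : 0 < t2 - s by rewrite subr_gt0 (lt_le_trans st1).
have G0 := Gamma_gt0 a0.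
rewrite /k !kernE// mulrACA [leRHS]mulrACA ler_wpM2r ?mulr_ge0 ?invr_ge0 ?(ltW G0)//.
rewrite -!powRM ?(ltW h1) ?(ltW h2) ?(ltW t10) ?(ltW t20)//.
apply: le0_ler_powR; rewrite ?subr_le0 ?(ltW a1) ?mulr_gt0//.
by rewrite !mulrBl [t1 * t2]mulrC lerB// ler_pM2l.
Qed.

Lemma kern1 (t : R) : 0 < t -> kern 1 t = 1.
Proof. by move=> t0; rewrite kernE// subrr powRr0 Gamma1 invr1 mulr1. Qed.

(** [kern 1] is the indicator of the positive half-line, so up to a translation this integral is the
    convolution of [kern b] with [kern 1]. *)
Lemma integral_kern_itv (b x y : R) : 0 < b -> x <= y ->
  (\int[mu]_(s in `[x, y]) (kern b (y - s))%:E = (kern (b + 1) (y - x))%:E)%E.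
Proof.
move=> b0 xy; rewrite -(integral_kern_conv _ b0 ltr01).
have mkb : measurable_fun [set: R] (fun s => kern b (y - s)).
  by apply: (measurableT_comp (measurable_kern b)); exact: measurable_funB.
rewrite -[RHS](@integral_shift R x); last 2 first.
- apply/measurable_EFinP; apply: measurable_funM (measurable_kern _).
  by apply: (measurableT_comp (measurable_kern b)); exact: measurable_funB.
- by move=> s; rewrite lee_fin mulr_ge0 ?kern_ge0.
rewrite -integral_itv_obnd_cbnd; last by apply/measurable_EFinP; exact: measurable_funTS.
rewrite integral_mkcond; apply: eq_integral => s _; rewrite patchE.
have -> : y - x - (s - x) = y - s by ring.
case: ifPn; rewrite ?inE ?notin_setE /= in_itv/=.
  by move=> /andP[xs _]; rewrite (@kern1 (s - x)) ?subr_gt0// mulr1.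
move=> /negP; rewrite negb_and -!leNgt -ltNge => /orP[sx|ys].
  by rewrite [kern 1 _]kern_le0 ?mulr0// subr_le0.
by rewrite kern_le0 ?mul0r// subr_le0 ltW.
Qed.

(** The Volterra integral is cut at [x] into the past [A] and the recent part [B]. Since [p >= 0] up
    to [x], [kern_log_convex] makes [H / k] nondecreasing for [H = k - lam * A], and
    [H x = p x >= 0]; thus [H >= 0] after [x]. As [k] at most halves between [x] and [t], also
    [H <= 2 * H t] there, and the shortness of the step bounds [lam * |B|] by a quarter of the
    supremum [M] of [|p|]. Then [M <= 2 * H t + M / 4], hence [lam * B t] is at most two thirds of
    [H t]. *)
Let step (x h : R) : 0 < x -> h <= x -> lam * kern (a + 1) h <= 4^-1 ->
  (forall s, s <= x -> 0 <= p s) -> forall t, x <= t <= x + h -> 0 <= p t.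
Proof.
move=> x0 hx hh px t /andP[xt txh].
have t0 : 0 < t by exact: lt_le_trans xt.
pose A y := \int[mu]_(s in `]-oo, x[) (k (y - s) * p s).
pose B y := \int[mu]_(s in `[x, +oo[) (k (y - s) * p s).
have UE : `]-oo, x[ `|` `[x, +oo[ = [set: R].
  apply/seteqP; split => // s _ /=.
  by rewrite !in_itv/= andbT; have [sx|xs] := ltP s x; [left|right].
have AB y : \int[mu]_s (k (y - s) * p s) = A y + B y.
  rewrite /A /B -Rintegral_setU//=.
  - by rewrite UE.
  - by rewrite UE; exact: int_p.
  - apply/disj_setPS => s [] /=; rewrite !in_itv/= andbT => sx xs.
    by move: (lt_le_trans sx xs); rewrite ltxx.
have iA y : mu.-integrable `]-oo, x[ (fun s => (k (y - s) * p s)%:E).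
  exact: (integrableS measurableT).
have iB y : mu.-integrable `[x, +oo[ (fun s => (k (y - s) * p s)%:E).
  exact: (integrableS measurableT).
have Bbound y N : x <= y -> 0 <= N -> (forall s, x <= s -> s <= y -> `|p s| <= N) ->
    `|B y| <= N * kern (a + 1) (y - x).
  move=> xy N0 hN; rewrite /B -lee_fin EFinM -integral_kern_itv//.
  have mky : measurable_fun [set: R] (fun s => (kern a (y - s))%:E).
    apply/measurable_EFinP; apply: (measurableT_comp (measurable_kern a)).
    exact: measurable_funB.
  rewrite -ge0_integralZl; last 4 first.
  - exact: measurable_itv.
  - exact: measurable_funTS.
  - by move=> s _; rewrite lee_fin kern_ge0.
  - by rewrite lee_fin.
  rewrite EFin_normr_Rintegral; [|exact: measurable_itv|exact: iB].
  have miB : measurable_fun (`[x, +oo[ : set (measurableTypeR R)) (fun s => (k (y - s) * p s)%:E).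
    by have /integrableP[] := iB y.
  apply: (le_trans (le_abse_integral _ _ miB)); first exact: measurable_itv.
  rewrite [leRHS]integral_mkcond [leLHS]integral_mkcond.
  apply: ge0_le_integral; first exact: measurableT.
  - by move=> s _; apply: erestrict_ge0.
  - apply/(measurable_restrictT _ _).1; first exact: measurable_itv.
    exact: measurableT_comp miB.
  - apply/(measurable_restrictT _ _).1; first exact: measurable_itv.
    by apply: measurable_funTS; exact: measurable_funeM.
  - move=> s _; rewrite !patchE; case: ifPn; rewrite ?inE ?notin_setE/= in_itv/= andbT.
      move=> xs; case: ifPn; rewrite ?inE ?notin_setE/= in_itv/= xs/=.
        move=> sy; rewrite lee_fin normrM (ger0_norm (kern_ge0 _ a0)) mulrC.
        by rewrite ler_wpM2r ?kern_ge0// hN.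
      move=> /negP; rewrite -ltNge => ys.
      by rewrite /k kern_le0 ?mul0r ?normr0// subr_le0 ltW.
    by move=> _; case: ifPn => // _; rewrite mule_ge0// lee_fin kern_ge0.
pose H y := k y - lam * A y.
have pH y : p y = H y - lam * B y by rewrite pE AB /H; ring.
have kx0 y : x <= y -> 0 < k y by move=> xy; rewrite kern_gt0// (lt_le_trans x0).
(* The kernel vanishes at nonpositive arguments, so [H] and [p] agree at [x]. *)
have Bx : B x = 0.
  rewrite /B (@eq_Rintegral _ _ _ _ _ (cst 0)) ?Rintegral_cst ?mul0r//.
  move=> s; rewrite inE/= in_itv/= andbT => xs.
  by rewrite /k kern_le0 ?mul0r// subr_le0.
have Amono y z : x <= y -> y <= z -> A z * k y <= A y * k z.
  move=> xy yz.
  have E u v : A u * k v = \int[mu]_(s in `]-oo, x[) ((k (u - s) * p s) * k v).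
    by rewrite /A (@RintegralZr _ _ _ mu _ (fun s => k (u - s) * p s))//; exact: iA.
  have iAk u v : mu.-integrable `]-oo, x[ (EFin \o (fun s => (k (u - s) * p s) * k v)).
    by apply: integrableMr_cst => //; exact: iA.
  rewrite !E; apply: le_Rintegral; [exact: measurable_itv|exact: iAk|exact: iAk|].
  - move=> s /=; rewrite in_itv/= => sx.
    have [s0|s0] := leP s 0; first by rewrite /p ml_fun_le0// !(mulr0, mul0r).
    rewrite mulrAC [leRHS]mulrAC ler_wpM2r ?px ?(ltW sx)//.
    by apply: kern_log_convex => //; exact: lt_le_trans xy.
clearbody A B.
have Hx : 0 <= H x by have := px x (lexx x); rewrite pH Bx mulr0 subr0.
have Hmono y z : x <= y -> y <= z -> H y * k z <= H z * k y.
  move=> xy yz; rewrite /H !mulrBl [k z * k y]mulrC lerB//.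
  by rewrite -!mulrA ler_wpM2l ?(ltW lam0)// Amono.
have H0 y : x <= y -> 0 <= H y.
  move=> xy; rewrite -(pmulr_lge0 _ (kx0 _ (lexx x))).
  by apply: le_trans (Hmono _ _ (lexx x) xy); rewrite mulr_ge0// ltW// kx0.
(* Indeed [t <= x + h <= 2 * x <= 2 * y], and since [1 - a] is at most 1,
   [(t / y)^(1 - a) <= t / y <= 2]. *)
have k2 y : x <= y -> y <= t -> k y <= 2 * k t.
  move=> xy yt; have y0 : 0 < y by exact: lt_le_trans xy.
  have -> : t = t / y * y by rewrite divfK// gt_eqF.
  rewrite /k kern_scale ?divr_gt0// mulrA ler_peMl ?kern_ge0//.
  have hty : t / y <= 2 by rewrite ler_pdivrMr//; lra.
  have tge1 : 1 <= t / y by rewrite ler_pdivlMr// mul1r.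
  have tg0 : 0 < t / y by exact: lt_le_trans tge1.
  rewrite -(opprB 1) powRN -ler_pdivrMr ?invr_gt0 ?powR_gt0// invrK mul1r.
  apply: (le_trans (ler1_powR tge1 _)) => //.
  by rewrite gerBl ltW.
have H2 y : x <= y -> y <= t -> H y <= 2 * H t.
  move=> xy yt; rewrite -(ler_pM2r (kx0 _ xt)).
  apply: (le_trans (Hmono _ _ xy yt)).
  by rewrite [leRHS]mulrAC [leRHS]mulrC mulrC [leRHS]mulrC ler_wpM2l ?H0// k2.
(* The supremum is finite because [ml_fun_bound] controls [p] away from 0. *)
pose S := [set `|p s| | s in `[x, t]].
pose M := sup S.
have hS : has_sup S.
  split; first by exists `|p x|; exists x => //=; rewrite in_itv/= lexx.
  pose c := mittag_leffler a a (lam * t `^ a).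
  exists (x `^ (a - 1) * `|c|) => _ [s /= /[!in_itv]/= /andP[xs st] <-].
  have s0 : 0 < s by exact: lt_le_trans xs.
  apply: (le_trans (ml_fun_bound a0 lam0 a0 s0 st)).
  rewrite -/c (le_trans (ler_norm _))// normrM (ger0_norm (powR_ge0 _ _)) ler_wpM2r//.
  by apply: le0_ler_powR; rewrite ?subr_le0 ?(ltW a1).
have pM s : x <= s -> s <= t -> `|p s| <= M.
  by move=> xs st; apply: ub_le_sup; [exact: hS.2|exists s => //=; rewrite in_itv/= xs].
have M0 : 0 <= M by exact: le_trans (normr_ge0 _) (pM x (lexx _) xt).
have BM y : x <= y -> y <= t -> lam * `|B y| <= M / 4.
  move=> xy yt.
  have By := Bbound y M xy M0 (fun s xs sy => pM s xs (le_trans sy yt)).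
  apply: (le_trans (ler_wpM2l (ltW lam0) By)).
  rewrite mulrCA ler_wpM2l//; apply: le_trans hh; rewrite ler_wpM2l ?(ltW lam0)//.
  have [->|yx] := eqVneq y x; first by rewrite subrr kern_le0// kern_ge0// addr_gt0.
  have yx0 : 0 < y - x by rewrite subr_gt0 lt_neqAle eq_sym yx.
  have yxh : y - x <= h by lra.
  rewrite !kernE ?(lt_le_trans yx0)// ler_wpM2r ?invr_ge0 ?(ltW (Gamma_gt0 _)) ?addr_gt0//.
  by apply: ge0_ler_powR; rewrite ?addrK ?nnegrE ?(ltW a0) ?(ltW yx0) ?(le_trans (ltW yx0)).
have ML : M <= 2 * H t + M / 4.
  apply: sup_le_ub; first exact: hS.1.
  move=> _ [s /= /[!in_itv]/= /andP[xs st] <-].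
  rewrite pH (le_trans (ler_normB _ _))// lerD//.
    by rewrite ger0_norm ?H0// H2.
  by rewrite normrM (ger0_norm (ltW lam0)) BM.
have := BM t xt (lexx t); rewrite pH => Bt.
have : lam * B t <= lam * `|B t| by rewrite ler_wpM2l ?(ltW lam0)// ler_norm.
have := H0 t xt; lra.
Qed.

(** By the recursion, [p] is [k] minus [lam] times a function of size [t^(2 * a - 1)], which is
    smaller than [k] by a factor [t^a] near 0. *)
Let base : exists2 h, 0 < h & forall t, t <= h -> 0 <= p t.
Proof.
pose c := `|mittag_leffler a (a + a) (lam * 1 `^ a)|.
have G0 := Gamma_gt0 a0.
have D0 : 0 < (lam * c + 1) * Gamma a.
  by rewrite mulr_gt0// ltr_wpDl// mulr_ge0 ?normr_ge0// ltW.
(* Chosen so that [t^a * (lam * c + 1) * Gamma a <= 1] for [t <= h1]; the summand 1 keeps the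
   denominator positive when [c = 0]. *)
pose h1 := ((lam * c + 1) * Gamma a)^-1 `^ a^-1.
have h10 : 0 < h1 by rewrite powR_gt0// invr_gt0.
exists (Num.min 1 h1); first by rewrite lt_min ltr01.
move=> t; rewrite le_min => /andP[t1 th].
have [t0|t0] := leP t 0; first by rewrite /p ml_fun_le0.
rewrite /p ml_fun_rec// kernE//.
have aa0 : 0 < a + a by exact: addr_gt0.
have b := ml_fun_bound a0 lam0 aa0 t0 t1.
have {b} : lam * ml_fun a lam (a + a) t <= lam * (t `^ (a - 1) * t `^ a * c).
  rewrite ler_wpM2l ?(ltW lam0)// (le_trans (ler_norm _))// (le_trans b)//.
  by rewrite -gt0_powRD// addrAC ler_wpM2l ?powR_ge0// ler_norm.
have ta : t `^ a <= ((lam * c + 1) * Gamma a)^-1.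
  have -> : ((lam * c + 1) * Gamma a)^-1 = h1 `^ a.
    by rewrite /h1 -powRrM mulVf ?gt_eqF// powRr1// invr_ge0 ltW.
  by apply: ge0_ler_powR; rewrite ?nnegrE ?(ltW a0) ?(ltW t0) ?(ltW h10).
suff : lam * (t `^ (a - 1) * t `^ a * c) <= t `^ (a - 1) / Gamma a by lra.
rewrite -!mulrA mulrCA ler_wpM2l ?powR_ge0//.
rewrite [t `^ a * c]mulrC mulrA.
apply: (le_trans (ler_wpM2l _ ta)); first by rewrite mulr_ge0 ?normr_ge0// ltW.
rewrite invfM mulrA -[leRHS]mul1r ler_wpM2r ?invr_ge0 ?(ltW G0)//.
rewrite ler_pdivrMr ?mul1r ?lerDl//.
by rewrite ltr_wpDl// mulr_ge0 ?normr_ge0// ltW.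
Qed.

(** Induction in steps of a fixed length [h]: the smallness condition of [step] involves this length
    alone, and the starting interval is at least as long as [h], so finitely many steps reach any
    [t]. *)
Lemma ml_fun_ge0 t : 0 <= p t.
Proof.
have [h0 h00 ph0] := base.
have G0 : 0 < Gamma (a + 1) by rewrite Gamma_gt0// addr_gt0.
(* With this value, [lam * kern (a + 1) h1 = lam * h1^a / Gamma (a + 1) = 1/4]. *)
pose h1 := (Gamma (a + 1) / (4 * lam)) `^ a^-1.
have q0 : 0 < Gamma (a + 1) / (4 * lam) by rewrite divr_gt0// mulr_gt0.
have h10 : 0 < h1 by rewrite powR_gt0.
pose h := Num.min h0 h1.
have h_gt0 : 0 < h by rewrite lt_min h00.
have hh0 : h <= h0 by rewrite ge_min lexx.
have hk : lam * kern (a + 1) h <= 4^-1.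
  rewrite kernE// addrK mulrA ler_pdivrMr//.
  have : h `^ a <= h1 `^ a.
    by apply: ge0_ler_powR; rewrite ?nnegrE ?(ltW a0) ?(ltW h_gt0) ?(ltW h10)// ge_min lexx orbT.
  rewrite /h1 -powRrM mulVf ?gt_eqF// powRr1 ?(ltW q0)// ler_pdivlMr ?mulr_gt0//.
  lra.
have ind n : forall s, s <= h0 + h *+ n -> 0 <= p s.
  elim: n => [|n IH] s; first by rewrite mulr0n addr0; exact: ph0.
  have [sx|xs] := leP s (h0 + h *+ n); first by move=> _; exact: IH.
  rewrite mulrS [h + _]addrC addrA => sxh.
  have x0 : 0 < h0 + h *+ n by rewrite ltr_pwDl// mulrn_wge0// ltW.
  have hx : h <= h0 + h *+ n by rewrite (le_trans hh0)// lerDl mulrn_wge0// ltW.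
  by apply: (step x0 hx hk IH); rewrite (ltW xs) sxh.
have [t0|t0] := leP t 0; first by rewrite /p ml_fun_le0.
apply: (ind (Num.truncn (t / h)).+1).
have : t < h *+ (Num.truncn (t / h)).+1.
  by rewrite -mulr_natl -ltr_pdivrMr//; exact: truncnS_gt.
by move=> /ltW/le_trans; apply; rewrite lerDr ltW.
Qed.

Lemma ml_fun_le_kern t : p t <= k t.
Proof.
rewrite pE gerBl mulr_ge0 ?(ltW lam0)//; apply: Rintegral_ge0 => s _.
by rewrite mulr_ge0 ?kern_ge0 ?ml_fun_ge0.
Qed.

Let E (t : R) := mittag_leffler a 1 (- lam * t `^ a).

Lemma mittag_leffler0 : E 0 = 1.
Proof.
rewrite /E powR0 ?gt_eqF// mulr0 /mittag_leffler; apply/cvg_lim => //.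
rewrite -(cvg_shiftS (series (fun k0 : nat => 0 ^+ k0 / Gamma (a * k0%:R + 1)))).
rewrite (_ : (fun n => _) = cst 1); first exact: cvg_cst.
apply/funext => n; rewrite /series /= big_nat_recl//= expr0 mulr0 add0r Gamma1 divr1.
by rewrite big1 ?addr0// => i _; rewrite expr0n mul0r.
Qed.

Let EE t : 0 < t -> ml_fun a lam 1 t = E t.
Proof. by move=> t0; rewrite ml_funE// subrr powRr0 mul1r. Qed.

Let Erec t : 0 < t -> ml_fun a lam (1 + a) t = (1 - E t) / lam.
Proof.
move=> t0; have H := @ml_fun_rec R a lam a0 1 t ltr01.
move: H; rewrite (kern1 t0) (EE t0); move: (ml_fun _ _ _ _) (E t) => X Y ->.
by rewrite opprB addrC subrK mulrC mulKf// gt_eqF.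
Qed.

(** Integration from 0 is convolution with [kern 1], which turns [p] into [ml_fun] with second
    parameter [1 + a]; the recursion at [b = 1] expresses that by [E]. *)
Lemma integral_ml_fun t : 0 <= t ->
  (\int[mu]_(s in `]0%R, t[) (p s)%:E = ((1 - E t) / lam)%:E)%E.
Proof.
rewrite le_eqVlt => /predU1P[<-|t0].
  by rewrite set_itvoo0 ?integral_set0 ?mittag_leffler0 ?subrr ?mul0r//.
have [i1 i2] := ml_fun_conv a0 lam0 t a0 (@ltr01 R).
have -> : ((1 - E t) / lam)%:E = (\int[mu]_s (kern 1 (t - s) * p s)%:E)%E.
  rewrite -Erec// [1 + a]addrC -i2 /Rintegral fineK//; exact: integrable_fin_num.
rewrite integral_mkcond; apply: eq_integral => s _; rewrite patchE.
case: ifPn; rewrite ?inE ?notin_setE /= in_itv/=.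
  by move=> /andP[s0 st]; rewrite kern1 ?subr_gt0// mul1r.
move=> /negP; rewrite negb_and -!leNgt => /orP[s0|ts].
  by rewrite /p ml_fun_le0// mulr0.
by rewrite kern_le0 ?mul0r// subr_le0.
Qed.

(** From [p t >= 0] the Volterra equation bounds [lam] times the convolution of [k] and [p] by
    [k t]. As [k (t - s) >= k t], that convolution times [lam] is at least [(1 - E t) * k t];
    dividing by [k t] leaves [E t >= 0]. *)
Lemma mittag_leffler_ge0 t : 0 <= t -> 0 <= E t.
Proof.
rewrite le_eqVlt => /predU1P[<-|t0]; first by rewrite mittag_leffler0.
have kt := kern_gt0 a0 t0.
have : lam * \int[mu]_s (k (t - s) * p s) <= k t.
  by rewrite -subr_ge0 -pE ml_fun_ge0.
have -> : \int[mu]_s (k (t - s) * p s) = fine (\int[mu]_s (k (t - s) * p s)%:E)%E by [].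
have : (((1 - E t) / lam * k t)%:E <= \int[mu]_s (k (t - s) * p s)%:E)%E.
  rewrite EFinM -integral_ml_fun ?(ltW t0)// -ge0_integralZr; last 4 first.
  - exact: measurable_itv.
  - by apply/measurable_EFinP; exact: measurable_funTS.
  - by move=> s _; rewrite lee_fin ml_fun_ge0.
  - by rewrite lee_fin ltW.
  rewrite integral_mkcond; apply: ge0_le_integral.
  - exact: measurableT.
  - by move=> s _; apply: erestrict_ge0 => {}s _; rewrite mule_ge0// lee_fin ?ml_fun_ge0// ltW.
  - apply/(measurable_restrictT _ _).1; first exact: measurable_itv.
    by apply: emeasurable_funM => //; apply/measurable_EFinP; exact: measurable_funTS.
  - by have /integrableP[] := int_p t.
  - move=> s _; rewrite patchE; case: ifPn; rewrite ?inE ?notin_setE /= in_itv/=.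
      move=> /andP[s0 st]; rewrite -EFinM lee_fin mulrC ler_wpM2r ?ml_fun_ge0//.
      by apply: kern_nonincreasing; rewrite ?subr_gt0// gerBl ltW.
    by move=> _; rewrite lee_fin mulr_ge0 ?kern_ge0 ?ml_fun_ge0.
have fn := integrable_fin_num measurableT (int_p t).
rewrite -[X in (_ <= X)%E -> _]fineK//= lee_fin => h1 h2.
have : lam * ((1 - E t) / lam * k t) <= k t.
  by apply: le_trans h2; rewrite ler_wpM2l// ltW.
rewrite mulrA [lam * _]mulrC divfK ?gt_eqF// ger_pMl// lerBlDr lerDl//.
Qed.

Lemma integral_ml_fun_itv s t : 0 <= s -> s <= t ->
  (\int[mu]_(x in `[s, t[) (p x)%:E = ((E s - E t) / lam)%:E)%E.
Proof.
move=> s0 st; have t0 : 0 <= t by exact: le_trans st.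
have mpE (D : set (measurableTypeR R)) : measurable_fun D (fun x => (p x)%:E).
  by apply/measurable_EFinP; exact: measurable_funTS.
move: s0; rewrite le_eqVlt => /predU1P[<-|s0].
  rewrite -integral_itv_obnd_cbnd; last exact: mpE.
  by rewrite integral_ml_fun// mittag_leffler0.
have := integral_ml_fun t0; rewrite (@itv_bndbnd_setU _ _ _ (BLeft s)) ?bnd_simp ?(ltW s0)//.
rewrite ge0_integral_setU//=; last 2 first.
- by move=> x _; rewrite lee_fin ml_fun_ge0.
- apply/disj_setPS => x [] /=; rewrite !in_itv/= => /andP[_ xs] /andP[sx _].
  by move: (lt_le_trans xs sx); rewrite ltxx.
rewrite (integral_ml_fun (ltW s0)) => H.
have : (\int[mu]_(x in `[s, t[) (p x)%:E = ((1 - E t) / lam)%:E - ((1 - E s) / lam)%:E)%E.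
  by rewrite -H addeAC subee// add0e.
by move=> ->; rewrite -EFinB; congr (_%:E); ring.
Qed.

Lemma mittag_leffler_mono s t : 0 <= s -> s <= t -> E t <= E s.
Proof.
move=> s0 st; have : (0 <= ((E s - E t) / lam)%:E)%E.
  by rewrite -integral_ml_fun_itv//; apply: integral_ge0 => x _; rewrite lee_fin ml_fun_ge0.
by rewrite lee_fin pmulr_lge0 ?invr_gt0// subr_ge0.
Qed.

Lemma mittag_leffler_le1 t : 0 <= t -> E t <= 1.
Proof. by move=> t0; rewrite -mittag_leffler0; exact: mittag_leffler_mono. Qed.

Lemma measurable_mittag_leffler : measurable_fun (`]0%R, +oo[ : set R) E.
Proof.
apply: (eq_measurable_fun (ml_fun a lam 1)).
  by move=> x; rewrite inE/= in_itv/= andbT => x0; rewrite EE.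
by apply: measurable_funTS; exact: measurable_ml_fun.
Qed.

Lemma integral_mittag_leffler_conv t : 0 < t ->
  (\int[mu]_(s in `]0%R, t[) ((t - s) `^ (a - 1) / Gamma a * E s)%:E = ((1 - E t) / lam)%:E)%E.
Proof.
move=> t0; have [i1 i2] := ml_fun_conv a0 lam0 t (@ltr01 R) a0.
rewrite -Erec// -i2 /Rintegral fineK; last exact: integrable_fin_num.
rewrite [LHS]integral_mkcond; apply: eq_integral => s _; rewrite patchE.
case: ifPn; rewrite ?inE ?notin_setE /= in_itv/=.
  by move=> /andP[s0 st]; rewrite kernE ?subr_gt0// EE.
move=> /negP; rewrite negb_and -!leNgt => /orP[s0|ts].
  by rewrite ml_fun_le0// mulr0.
by rewrite kern_le0 ?mul0r// subr_le0.
Qed.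

(** Since [E] decreases, its value at [t] can be taken out of the fractional integral:
    [E t * kern (a + 1) t] is at most [(1 - E t) / lam], hence at most [1 / lam]. *)
Lemma mittag_leffler_decay t : 0 < t -> E t * (lam * t `^ a) <= Gamma (a + 1).
Proof.
move=> t0; have G0 : 0 < Gamma (a + 1) by rewrite Gamma_gt0// addr_gt0.
have : ((E t * kern (a + 1) t)%:E <= ((1 - E t) / lam)%:E)%E.
  rewrite -integral_mittag_leffler_conv// -[X in kern _ X]subr0.
  rewrite EFinM -(integral_kern_itv a0 (ltW t0)).
  have mkt : measurable_fun [set: R] (fun s => (kern a (t - s))%:E).
    apply/measurable_EFinP; apply: (measurableT_comp (measurable_kern a)).
    exact: measurable_funB.
  rewrite (integral_itv_bndoo (y := t)); last exact: measurable_funTS.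
  rewrite -ge0_integralZl; last 4 first.
  - exact: measurable_itv.
  - exact: measurable_funTS.
  - by move=> s _; rewrite lee_fin kern_ge0.
  - by rewrite lee_fin mittag_leffler_ge0// ltW.
  have mE : measurable_fun (`]0%R, t[ : set (measurableTypeR R)) E.
    apply: (measurable_funS _ _ measurable_mittag_leffler); first exact: measurable_itv.
    by move=> x /=; rewrite !in_itv/= andbT => /andP[].
  apply: ge0_le_integral.
  - exact: measurable_itv.
  - by move=> s _; rewrite mule_ge0// lee_fin ?kern_ge0// mittag_leffler_ge0// ltW.
  - by apply: measurable_funeM; exact: measurable_funTS.
  - apply/measurable_EFinP; apply: measurable_funM mE; apply: measurable_funM => //.
    by apply: measurable_funTS; apply: (measurableT_comp (measurable_powR _)); exact: measurable_funB.
  - move=> s /=; rewrite in_itv/= => /andP[s0 st]; rewrite lee_fin kernE ?subr_gt0// mulrC.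
    rewrite ler_wpM2l ?divr_ge0 ?powR_ge0 ?(ltW (Gamma_gt0 a0))//.
    by apply: mittag_leffler_mono => //; exact: ltW.
rewrite lee_fin kernE// addrK ler_pdivlMr// mulrA mulrAC ler_pdivrMr//.
rewrite -mulrA [_ `^ _ * lam]mulrC => /le_trans; apply.
by rewrite ler_piMl ?(ltW G0)// gerBl mittag_leffler_ge0// ltW.
Qed.

End Mittag_Leffler_sign.

(** * Double integrals and the fractional Hardy inequality *)

Section double_integrals.
Context {R : realType}.
Local Notation mu := (@lebesgue_measure R).

Definition meas2 (f : R -> R -> R) :=
  measurable_fun [set: measurableTypeR R * measurableTypeR R] (fun z => f z.1 z.2).

Lemma meas2_fst (f : R -> R) : measurable_fun [set: R] f -> meas2 (fun x _ => f x).
Proof. exact: measurable_comp_fst. Qed.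

Lemma meas2_snd (f : R -> R) : measurable_fun [set: R] f -> meas2 (fun _ y => f y).
Proof. exact: measurable_comp_snd. Qed.

Lemma meas2_sub (f : R -> R) : measurable_fun [set: R] f -> meas2 (fun x y => f (x - y)).
Proof. exact: measurable_comp_sub. Qed.

Lemma meas2_swap (f : R -> R -> R) : meas2 f -> meas2 (fun x y => f y x).
Proof.
move=> mf; have := measurableT_comp mf (measurable_fun_pair (@measurable_snd _ _ (measurableTypeR R) (measurableTypeR R)) (@measurable_fst _ _ (measurableTypeR R) (measurableTypeR R))).
exact.
Qed.

Lemma meas2_if (b : R -> R -> bool) (f : R -> R -> R) :
  measurable_fun [set: measurableTypeR R * measurableTypeR R] (fun z => b z.1 z.2) ->
  meas2 f -> meas2 (fun x y => if b x y then f x y else 0).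
Proof. by move=> mb mf; exact: measurable_fun_ifT. Qed.

Lemma meas2M (f g : R -> R -> R) : meas2 f -> meas2 g -> meas2 (fun x y => f x y * g x y).
Proof. by move=> mf mg; exact: measurable_funM. Qed.

Lemma meas2_right (f : R -> R -> R) x : meas2 f -> measurable_fun [set: R] (f x).
Proof.
by move=> mf; have := measurableT_comp mf (measurable_pair1 x).
Qed.

Lemma meas2_left (f : R -> R -> R) y : meas2 f -> measurable_fun [set: R] (f ^~ y).
Proof.
by move=> mf; have := measurableT_comp mf (measurable_pair2 y).
Qed.

Lemma meas2_integral (f : R -> R -> R) : meas2 f -> (forall x y, 0 <= f x y) ->
  measurable_fun [set: R] (fun x => \int[mu]_y (f x y)%:E)%E.
Proof.
move=> mf f0.
have := @measurable_fun_fubini_tonelli_F _ _ _ _ R mu (fun z => (f z.1 z.2)%:E).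
by apply => [|z]; [exact/measurable_EFinP|rewrite lee_fin].
Qed.

Lemma double_integral_swap (f : R -> R -> R) : meas2 f -> (forall x y, 0 <= f x y) ->
  (\int[mu]_x \int[mu]_y (f x y)%:E = \int[mu]_y \int[mu]_x (f x y)%:E)%E.
Proof.
move=> mf f0; have := @lebesgue_tonelli R (fun z => (f z.1 z.2)%:E).
by apply => [|z]; [exact/measurable_EFinP|rewrite lee_fin].
Qed.

Lemma double_integral_le (f g : R -> R -> R) : meas2 f -> meas2 g ->
  (forall x y, 0 <= f x y) -> (forall x y, f x y <= g x y) ->
  (\int[mu]_x \int[mu]_y (f x y)%:E <= \int[mu]_x \int[mu]_y (g x y)%:E)%E.
Proof.
move=> mf mg f0 fg; have g0 x y : 0 <= g x y by exact: le_trans (fg _ _).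
apply: ge0_le_integral; first exact: measurableT.
- by move=> x _; apply: integral_ge0 => y _; rewrite lee_fin.
- exact: meas2_integral.
- exact: meas2_integral.
- move=> x _; apply: ge0_le_integral; first exact: measurableT.
  + by move=> y _; rewrite lee_fin.
  + by apply/measurable_EFinP; exact: meas2_right.
  + by apply/measurable_EFinP; exact: meas2_right.
  + by move=> y _; rewrite lee_fin.
Qed.

Lemma double_integralD (f g : R -> R -> R) : meas2 f -> meas2 g ->
  (forall x y, 0 <= f x y) -> (forall x y, 0 <= g x y) ->
  (\int[mu]_x \int[mu]_y (f x y + g x y)%:E =
   \int[mu]_x \int[mu]_y (f x y)%:E + \int[mu]_x \int[mu]_y (g x y)%:E)%E.
Proof.
move=> mf mg f0 g0; rewrite -ge0_integralD; last 5 first.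
- exact: measurableT.
- by move=> x _; apply: integral_ge0 => y _; rewrite lee_fin.
- exact: meas2_integral.
- by move=> x _; apply: integral_ge0 => y _; rewrite lee_fin.
- exact: meas2_integral.
apply: eq_integral => x _; rewrite -ge0_integralD; last 5 first.
- exact: measurableT.
- by move=> y _; rewrite lee_fin.
- by apply/measurable_EFinP; exact: meas2_right.
- by move=> y _; rewrite lee_fin.
- by apply/measurable_EFinP; exact: meas2_right.
by apply: eq_integral => y _; rewrite EFinD.
Qed.

Lemma double_integralZl (c : R) (f : R -> R -> R) : 0 <= c -> meas2 f ->
  (forall x y, 0 <= f x y) ->
  (\int[mu]_x \int[mu]_y (c * f x y)%:E = c%:E * \int[mu]_x \int[mu]_y (f x y)%:E)%E.
Proof.
move=> c0 mf f0; rewrite -ge0_integralZl; last 4 first.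
- exact: measurableT.
- exact: meas2_integral.
- by move=> x _; apply: integral_ge0 => y _; rewrite lee_fin.
- by rewrite lee_fin.
apply: eq_integral => x _; rewrite -ge0_integralZl; last 4 first.
- exact: measurableT.
- by apply/measurable_EFinP; exact: meas2_right.
- by move=> y _; rewrite lee_fin.
- by rewrite lee_fin.
by apply: eq_integral => y _; rewrite EFinM.
Qed.

Lemma integral_itv_if (i : interval R) (f : R -> R) :
  (\int[mu]_x (if x \in i then f x else 0)%:E = \int[mu]_(x in [set` i]) (f x)%:E)%E.
Proof.
rewrite [RHS]integral_mkcond; apply: eq_integral => x _; rewrite patchE.
by rewrite mem_setE; case: ifP.
Qed.

End double_integrals.

Section sobolev_seminorm.
Context {R : realType}.
Local Notation mu := (@lebesgue_measure R).

(* Extended by [0] outside the square, so that Tonelli applies on the whole plane. *)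
Definition sobolev_kernel (T r x y : R) : R :=
  if (x \in `]0, T[) && (y \in `]0, T[) then (`|x - y| `^ (1 + 2 * r))^-1 else 0.

Lemma measurable_in_itv (i : interval R) : measurable_fun [set: R] (fun x : R => x \in i).
Proof.
apply: (@measurable_fun_bool _ _ _ _ true).
rewrite setTI (_ : _ @^-1` _ = [set` i]); first exact: measurable_itv.
by apply/seteqP; split => x /=.
Qed.

Lemma meas2_sobolev_kernel (T r : R) : meas2 (sobolev_kernel T r).
Proof.
apply: meas2_if.
  apply: measurable_and.
    exact: (measurableT_comp (measurable_in_itv _) measurable_fst).
  exact: (measurableT_comp (measurable_in_itv _) measurable_snd).
apply: (@meas2_sub _ (fun u => (`|u| `^ (1 + 2 * r))^-1)).
under eq_fun do rewrite -powRN.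
by apply: (measurableT_comp (measurable_powR _)).
Qed.

Lemma sobolev_kernel_ge0 (T r x y : R) : 0 <= sobolev_kernel T r x y.
Proof. by rewrite /sobolev_kernel; case: ifP => // _; rewrite invr_ge0 powR_ge0. Qed.

Lemma sobolev_kernelC (T r x y : R) : sobolev_kernel T r x y = sobolev_kernel T r y x.
Proof. by rewrite /sobolev_kernel andbC distrC. Qed.

Lemma sobolev_normsqE (T r : R) (f : R -> R) :
  sobolev_time_normsq T r f =
  (\int[mu]_(t in `]0%R, T[) (f t ^+ 2)%:E +
   \int[mu]_x \int[mu]_y (sobolev_kernel T r x y * (f x - f y) ^+ 2)%:E)%E.
Proof.
rewrite /sobolev_time_normsq; congr (_ + _)%E.
rewrite [LHS]integral_mkcond; apply: eq_integral => x _; rewrite patchE mem_setE.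
case: ifPn => [xT|xT].
  rewrite [LHS]integral_mkcond; apply: eq_integral => y _; rewrite patchE mem_setE /sobolev_kernel xT /=.
  by case: ifP => _; rewrite ?mul0r// mulrC.
by rewrite integral0_eq// => y _; rewrite /sobolev_kernel (negbTE xT) mul0r.
Qed.

Lemma eq_sobolev_normsq (T r : R) (f g : R -> R) : {in `]0, T[, f =1 g} ->
  sobolev_time_normsq T r f = sobolev_time_normsq T r g.
Proof.
move=> fg; rewrite !sobolev_normsqE; congr (_ + _)%E.
  by apply: eq_integral => x /set_mem xT; rewrite fg.
apply: eq_integral => x _; apply: eq_integral => y _; rewrite /sobolev_kernel.
by case: ifPn => [/andP[xT yT]|_]; rewrite ?mul0r// !fg.
Qed.

Lemma sobolev_normsq_ge0 (T r : R) (f : R -> R) : (0 <= sobolev_time_normsq T r f)%E.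
Proof.
rewrite sobolev_normsqE adde_ge0//; first by apply: integral_ge0 => x _; rewrite lee_fin sqr_ge0.
apply: integral_ge0 => x _; apply: integral_ge0 => y _.
by rewrite lee_fin mulr_ge0 ?sobolev_kernel_ge0 ?sqr_ge0.
Qed.

Lemma meas2_sobolev (T r : R) (f : R -> R) : measurable_fun [set: R] f ->
  meas2 (fun x y => sobolev_kernel T r x y * (f x - f y) ^+ 2).
Proof.
move=> mf; apply: meas2M; first exact: meas2_sobolev_kernel.
by apply: measurable_funX; apply: measurable_funB; [exact: meas2_fst|exact: meas2_snd].
Qed.

End sobolev_seminorm.

Section Hardy_inequality.
Context {R : realType}.
Local Notation mu := (@lebesgue_measure R).
Variables (a T : R).
Hypotheses (a0 : 0 < a) (a1 : a < 1) (T0 : 0 < T).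

(** Dilation factor between a point and its comparison points: [L^a = 8] brings the coefficient of
    the absorbed term in [Hardy_step] down to 1/2. *)
Let L : R := 8 `^ a^-1.
Let LaE : L `^ a = 8. Proof. by rewrite /L -powRrM mulVf ?gt_eqF// powRr1. Qed.
Let L1 : 1 < L.
Proof.
rewrite ltNge; apply/negP => L1.
have : L `^ a <= 1 `^ a by apply: ge0_ler_powR; rewrite ?nnegrE ?powR_ge0 ?(ltW a0).
by rewrite LaE powR1 => h; lra.
Qed.
Let L0 : 0 < L. Proof. exact: lt_trans L1. Qed.
(** For [t < dl] the comparison points [s < 2 * L * t] stay below [T]. *)
Let dl := T / (2 * L).
Let dl0 : 0 < dl. Proof. by rewrite divr_gt0// mulr_gt0. Qed.
Let dlT : dl < T.
Proof. by rewrite ltr_pdivrMr ?mulr_gt0// ltr_pMr//; have := L1; lra. Qed.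
Let r := (1 - a) / 2.

Let am2 : a - 2 <= 0. Proof. by move: a1; lra. Qed.

Let rE : 1 + 2 * r = 2 - a. Proof. by rewrite /r; field. Qed.

(** The value [h t] is compared with [h s] for [s] in []L t, 2 L t[], with weight [t^(a - 2)].
    Integration over [s] restores [t^(a - 1)]; the terms in [h s], integrated first over [t],
    reproduce the same integral with a small factor because [s] is far from [t]; the differences are
    controlled by the Sobolev seminorm because [s - t < 2 L t]. *)
Let Hardy_step (h : R -> R) (e : R) : measurable_fun [set: R] h ->
  0 < e -> e < dl ->
  (\int[mu]_(t in `]e, dl[) (t `^ (a - 1) * h t ^+ 2)%:E <=
   2^-1%:E * \int[mu]_(t in `]e, T[) (t `^ (a - 1) * h t ^+ 2)%:E +
   (2 / L * (2 * L) `^ (2 - a))%:E *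
     \int[mu]_x \int[mu]_y (sobolev_kernel T r x y * (h x - h y) ^+ 2)%:E)%E.
Proof.
move=> mh e0 ed.
pose b (t s : R) := (t \in `]e, dl[) && (s \in `](L * t), (2 * L * t)[).
have mb : measurable_fun [set: measurableTypeR R * measurableTypeR R] (fun z => b z.1 z.2).
  apply: measurable_and.
    exact: (measurableT_comp (measurable_in_itv _) measurable_fst).
  rewrite (_ : (fun z => _) = (fun z : measurableTypeR R * measurableTypeR R => (L * z.1 < z.2) && (z.2 < 2 * L * z.1))); last first.
    by apply/funext => z; rewrite in_itv.
  apply: measurable_and; apply: measurable_fun_ltr.
  - by apply: measurable_funM; [exact: measurable_cst|exact: measurable_fst].
  - exact: measurable_snd.
  - exact: measurable_snd.
  - by apply: measurable_funM; [exact: measurable_cst|exact: measurable_fst].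
have bT t s : b t s -> [/\ e < t, t < dl, L * t < s, s < 2 * L * t & 0 < t /\ t < s < T].
  rewrite /b !in_itv/= => /andP[/andP[et td] /andP[Ls sL]].
  have t0 : 0 < t by exact: lt_trans et.
  have ts : t < s by apply: lt_trans Ls; rewrite ltr_pMl.
  split => //; split => //; rewrite ts (lt_trans sL)//.
  by move: td; rewrite /dl ltr_pdivlMr ?mulr_gt0// mulrC.
pose w (t : R) := t `^ (a - 2).
have mw : measurable_fun [set: R] w by exact: measurable_powR.
have mh2 : measurable_fun [set: R] (fun t => h t ^+ 2) by exact: measurable_funX.
pose A0 t s := if b t s then w t * h t ^+ 2 else 0.
pose A1 t s := if b t s then w t * h s ^+ 2 else 0.
pose A2 t s := if b t s then w t * (h t - h s) ^+ 2 else 0.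
have m0 : meas2 A0 by apply: meas2_if mb _; exact: (@meas2_fst _ (fun t => w t * h t ^+ 2) (measurable_funM mw mh2)).
have m1 : meas2 A1.
  by apply: meas2_if mb _; apply: meas2M; [exact: (@meas2_fst _ w mw)|exact: (@meas2_snd _ _ mh2)].
have m2 : meas2 A2.
  apply: meas2_if mb _; apply: meas2M; first exact: (@meas2_fst _ w mw).
  by apply: measurable_funX; apply: measurable_funB; [exact: meas2_fst|exact: meas2_snd].
have w0 t : 0 <= w t by exact: powR_ge0.
have A00 t s : 0 <= A0 t s by rewrite /A0; case: ifP => // _; rewrite mulr_ge0 ?sqr_ge0.
have A10 t s : 0 <= A1 t s by rewrite /A1; case: ifP => // _; rewrite mulr_ge0 ?sqr_ge0.
have A20 t s : 0 <= A2 t s by rewrite /A2; case: ifP => // _; rewrite mulr_ge0 ?sqr_ge0.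
have A012 t s : A0 t s <= 2 * (A1 t s + A2 t s).
  rewrite /A0 /A1 /A2; case: ifP => _; last by rewrite addr0 mulr0.
  rewrite -mulrDr [leRHS]mulrCA; apply: (ler_wpM2l (w0 t)).
  rewrite -subr_ge0 (_ : _ - _ = (h t - 2 * h s) ^+ 2); last by ring.
  exact: sqr_ge0.
have I0 : (\int[mu]_t \int[mu]_s (A0 t s)%:E =
   L%:E * \int[mu]_(t in `]e, dl[) (t `^ (a - 1) * h t ^+ 2)%:E)%E.
  rewrite -integral_itv_if -ge0_integralZl; last 4 first.
  - exact: measurableT.
  - apply/measurable_EFinP; apply: measurable_fun_ifT; [exact: measurable_in_itv| |exact: measurable_cst].
    by apply: measurable_funM mh2; exact: measurable_powR.
  - by move=> t _; rewrite lee_fin; case: ifP => // _; rewrite mulr_ge0 ?sqr_ge0 ?powR_ge0.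
  - by rewrite lee_fin ltW.
  apply: eq_integral => t _; rewrite /A0 /b; case: ifPn => /=; last first.
    by rewrite mule0 integral0_eq.
  rewrite in_itv/= => /andP[et td]; have t0 : 0 < t by exact: lt_trans et.
  rewrite integral_itv_if integral_cst//= lebesgue_measure_itv/= lte_fin.
  rewrite ltr_pM2r// ltr_pMl// ltr1n -EFinD -!EFinM; congr (_%:E).
  rewrite /w (_ : a - 1 = a - 2 + 1); last by ring.
  rewrite (@gt0_powRD _ t (a - 2) 1 t0) powRr1 ?(ltW t0)//; ring.
(* For fixed [s], [t] runs over an interval of length [q = s / (2 L)] on which the weight is at most
   [q^(a - 2)]; the resulting [q^(a - 1)] is at most [s^(a - 1) * L / 4] by the choice of [L]. *)
have I1 : (\int[mu]_t \int[mu]_s (A1 t s)%:E <=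
   (4^-1 * L)%:E * \int[mu]_(t in `]e, T[) (t `^ (a - 1) * h t ^+ 2)%:E)%E.
  rewrite double_integral_swap// -integral_itv_if -ge0_integralZl; last 4 first.
  - exact: measurableT.
  - apply/measurable_EFinP; apply: measurable_fun_ifT; [exact: measurable_in_itv| |exact: measurable_cst].
    by apply: measurable_funM mh2; exact: measurable_powR.
  - by move=> t _; rewrite lee_fin; case: ifP => // _; rewrite mulr_ge0 ?sqr_ge0 ?powR_ge0.
  - by rewrite lee_fin mulr_ge0// ltW.
  apply: ge0_le_integral; first exact: measurableT.
  - by move=> s _; apply: integral_ge0 => t _; rewrite lee_fin.
  - by apply: (meas2_integral (meas2_swap m1)).
  - apply: measurable_funeM; apply/measurable_EFinP; apply: measurable_fun_ifT; [exact: measurable_in_itv| |exact: measurable_cst].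
    by apply: measurable_funM mh2; exact: measurable_powR.
  - move=> s _; case: ifPn => sT; last first.
      rewrite mule0 integral0_eq// => t _; rewrite /A1; case: ifPn => // /bT[et _ _ _ [_ /andP[ts st]]].
      by move: sT; rewrite in_itv/= st andbT (lt_trans et ts).
    move: sT; rewrite in_itv/= => /andP[es sT]; have s0 : 0 < s by exact: lt_trans es.
    pose i := `](s / (2 * L)), (s / L)[ : interval R.
    apply: (@le_trans _ _ (\int[mu]_(t in [set` i]) ((s / (2 * L)) `^ (a - 2) * h s ^+ 2)%:E)%E).
      rewrite -integral_itv_if; apply: ge0_le_integral; first exact: measurableT.
      - by move=> t _; rewrite lee_fin.
      - by apply/measurable_EFinP; exact: meas2_left.
      - by apply/measurable_EFinP; apply: measurable_fun_ifT => //; exact: measurable_in_itv.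
      - move=> t _; rewrite lee_fin /A1; case: ifPn => [/bT[et td Lt tL [t0 _]]|_].
          have -> : t \in i.
            rewrite /i in_itv/= ltr_pdivrMr ?mulr_gt0// ltr_pdivlMr// [t * L]mulrC Lt andbT.
            by rewrite mulrC.
          rewrite ler_wpM2r ?sqr_ge0//; apply: le0_ler_powR.
          - exact: am2.
          - by rewrite divr_gt0 ?mulr_gt0.
          - by rewrite ler_pdivrMr ?mulr_gt0// mulrC ltW.
        by case: ifP => // _; rewrite mulr_ge0 ?powR_ge0 ?sqr_ge0.
    rewrite integral_cst//= lebesgue_measure_itv/= lte_fin.
    rewrite ltr_pM2l// ltf_pV2 ?posrE ?mulr_gt0// ltr_pMl// ltr1n.
    rewrite -EFinD -!EFinM lee_fin.
    have -> : s / L - s / (2 * L) = s / (2 * L) by field; rewrite gt_eqF.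
    set q := s / (2 * L); have q0 : 0 < q by rewrite divr_gt0 ?mulr_gt0.
    have -> : q `^ (a - 2) * h s ^+ 2 * q = q `^ (a - 1) * h s ^+ 2.
      rewrite (_ : a - 1 = a - 2 + 1); last by ring.
      rewrite (@gt0_powRD _ q (a - 2) 1 q0) powRr1 ?(ltW q0)//; ring.
    rewrite [leRHS]mulrA; apply: ler_wpM2r; first exact: sqr_ge0.
    have -> : s = q * (2 * L) by rewrite /q divfK// gt_eqF// mulr_gt0.
    rewrite powRM ?(ltW q0) ?mulr_ge0 ?(ltW L0)// mulrCA ler_peMr ?powR_ge0//.
    have L20 : 0 < 2 * L by rewrite mulr_gt0.
    have -> : (2 * L) `^ (a - 1) = 2 `^ a * 8 / (2 * L).
      by rewrite (@gt0_powRD _ _ a (-1) L20) powR_inv1 ?(ltW L20)// powRM ?(ltW L0)// LaE.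
    have -> : 4^-1 * L * (2 `^ a * 8 / (2 * L)) = 2 `^ a by field; rewrite gt_eqF.
    have := @ler_powR R 2 (ler1n _ 2) 0 a (ltW a0); rewrite powRr0.
    exact.
(* As [s - t < 2 L t], the weight satisfies [t^(a - 2) <= (2 L)^(2 - a) * (s - t)^(a - 2)], and
   [2 - a = 1 + 2 * r] is the exponent of the Sobolev kernel. *)
have I2 : (\int[mu]_t \int[mu]_s (A2 t s)%:E <= ((2 * L) `^ (2 - a))%:E *
     \int[mu]_x \int[mu]_y (sobolev_kernel T r x y * (h x - h y) ^+ 2)%:E)%E.
  rewrite -double_integralZl ?powR_ge0//; last 2 first.
  - exact: meas2_sobolev.
  - by move=> x y; rewrite mulr_ge0 ?sobolev_kernel_ge0 ?sqr_ge0.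
  apply: double_integral_le => //.
    by apply: measurable_funM => //; exact: meas2_sobolev.
  move=> t s; rewrite /A2; case: ifPn; last first.
    by move=> _; apply: mulr_ge0 (powR_ge0 _ _) (mulr_ge0 (sobolev_kernel_ge0 _ _ _ _) (sqr_ge0 _)).
  move=> /bT[et td Lt tL [t0 /andP[ts sT]]].
  rewrite mulrA ler_wpM2r ?sqr_ge0// /sobolev_kernel !in_itv/= t0 (lt_trans ts sT) (lt_trans t0 ts) sT /=.
  rewrite rE distrC gtr0_norm ?subr_gt0// -powRN opprB.
  have st0 : 0 < s - t by rewrite subr_gt0.
  apply: (@le_trans _ _ ((2 * L) `^ (2 - a) * (2 * L * t) `^ (a - 2))).
    rewrite (@powRM _ (2 * L) t) ?(ltW t0) ?mulr_ge0 ?(ltW L0)// mulrA -gt0_powRD ?mulr_gt0//.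
    by rewrite (_ : 2 - a + (a - 2) = 0) ?powRr0 ?mul1r//; ring.
  rewrite ler_wpM2l ?powR_ge0//; apply: le0_ler_powR; [exact: am2|exact: st0|].
  by lra.
have := double_integral_le m0 (g := fun t s => 2 * (A1 t s + A2 t s)) _ A00 A012.
have m12 : meas2 (fun t s => A1 t s + A2 t s) by exact: measurable_funD.
move=> /(_ (measurable_funM (measurable_cst _) m12)).
rewrite double_integralZl//; last by move=> t s; rewrite addr_ge0.
rewrite double_integralD// I0 => I.
have two0 : (0 <= 2%:E :> \bar R)%E by rewrite lee_fin.
have := le_trans I (lee_wpmul2l two0 (leeD I1 I2)).
set X := (\int[mu]_(t in `]e, dl[) _)%E; set Y := (\int[mu]_(t in `]e, T[) _)%E.
set Z := (\int[mu]_x _)%E => J.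
have Y0 : (0 <= Y)%E by apply: integral_ge0 => t _; rewrite lee_fin mulr_ge0 ?powR_ge0 ?sqr_ge0.
have Z0 : (0 <= Z)%E.
  by apply: integral_ge0 => t _; apply: integral_ge0 => s _; rewrite lee_fin; apply: mulr_ge0 (sobolev_kernel_ge0 _ _ _ _) (sqr_ge0 _).
have : ((L^-1)%:E * (L%:E * X) <= (L^-1)%:E * (2%:E * ((4^-1 * L)%:E * Y + ((2 * L) `^ (2 - a))%:E * Z)))%E.
  by rewrite lee_wpmul2l// lee_fin invr_ge0 ltW.
rewrite muleA -EFinM mulVf ?gt_eqF// mul1e => /le_trans; apply.
rewrite muleA -EFinM ge0_muleDr ?mule_ge0 ?lee_fin ?powR_ge0 ?mulr_ge0 ?(ltW L0)//.
rewrite !muleA -!EFinM; apply: leeD; apply: lee_wpmul2r => //; rewrite lee_fin.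
  by rewrite le_eqVlt; apply/orP; left; apply/eqP; field; rewrite gt_eqF.
by rewrite [L^-1 * 2]mulrC.
Qed.

(** On [[dl, T[] the weight is bounded. On []e, dl[], [Hardy_step] leaves half of the whole integral
    on the right, where it is absorbed: the cutoff [e > 0] keeps it finite. The resulting bound is
    free of [e], which then tends to 0. *)
Lemma fractional_Hardy : exists2 C : R, 0 < C &
  forall h : R -> R, measurable_fun [set: R] h ->
  (\int[mu]_(t in `]0%R, T[) (t `^ (a - 1) * h t ^+ 2)%:E <=
   C%:E * sobolev_time_normsq T ((1 - a) / 2) h)%E.
Proof.
pose c := 2 / L * (2 * L) `^ (2 - a).
have c0 : 0 < c by rewrite mulr_gt0 ?divr_gt0 ?powR_gt0 ?mulr_gt0.
(* If [X <= (X + J) / 2 + c * Z] and [J <= dl^(a - 1) * N], then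
   [X + J <= 2 * dl^(a - 1) * N + 2 * c * Z]. *)
pose C := 2 * dl `^ (a - 1) + 2 * c.
have C0 : 0 < C by rewrite addr_gt0// mulr_gt0// powR_gt0.
exists C => // h mh; rewrite sobolev_normsqE -/r.
have mf : measurable_fun [set: R] (fun t => (t `^ (a - 1) * h t ^+ 2)%:E).
  apply/measurable_EFinP; apply: measurable_funM; first exact: measurable_powR.
  exact: measurable_funX.
have mfD (D : set (measurableTypeR R)) : measurable_fun D (fun t => (t `^ (a - 1) * h t ^+ 2)%:E).
  exact: measurable_funTS.
have f0 t : (0 <= (t `^ (a - 1) * h t ^+ 2)%:E)%E by rewrite lee_fin mulr_ge0 ?powR_ge0 ?sqr_ge0.
set N := (\int[mu]_(t in `]0%R, T[) (h t ^+ 2)%:E)%E.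
set Z := (\int[mu]_x _)%E.
have N0 : (0 <= N)%E by apply: integral_ge0 => t _; rewrite lee_fin sqr_ge0.
have Z0 : (0 <= Z)%E.
  by apply: integral_ge0 => t _; apply: integral_ge0 => s _; rewrite lee_fin mulr_ge0 ?sobolev_kernel_ge0 ?sqr_ge0.
have [Noo|Noo] := eqVneq N +oo%E.
  by rewrite Noo addye ?gt0_muley ?leey// -ltNye (lt_le_trans _ Z0)// ltNy0.
have [Zoo|Zoo] := eqVneq Z +oo%E.
  by rewrite Zoo addey ?gt0_muley ?leey// -ltNye (lt_le_trans _ N0)// ltNy0.
have Nf : N \is a fin_num by rewrite ge0_fin_numE// ltey.
have Zf : Z \is a fin_num by rewrite ge0_fin_numE// ltey.
have bnd (i : interval R) (m : R) : 0 < m ->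
    (forall t, t \in i -> m <= t /\ t \in `]0, T[) ->
    (\int[mu]_(t in [set` i]) (t `^ (a - 1) * h t ^+ 2)%:E <= (m `^ (a - 1))%:E * N)%E.
  move=> m0 hi; rewrite /N -ge0_integralZl; last 4 first.
  - exact: measurable_itv.
  - by apply/measurable_EFinP; apply: measurable_funTS; exact: measurable_funX.
  - by move=> t _; rewrite lee_fin sqr_ge0.
  - by rewrite lee_fin powR_ge0.
  have mg : measurable_fun (`]0%R, T[ : set (measurableTypeR R)) (fun t => ((m `^ (a - 1))%:E * (h t ^+ 2)%:E)%E).
    by apply: measurable_funeM; apply/measurable_EFinP; apply: measurable_funTS; exact: measurable_funX.
  apply: (@le_trans _ _ (\int[mu]_(t in [set` i]) ((m `^ (a - 1))%:E * (h t ^+ 2)%:E))%E).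
    apply: ge0_le_integral; first exact: measurable_itv.
    - by move=> t _; exact: f0.
    - exact: mfD.
    - apply: (measurable_funS _ _ mg); first exact: measurable_itv.
      by move=> t ti; exact: (hi t ti).2.
    move=> t ti; rewrite -EFinM lee_fin ler_wpM2r ?sqr_ge0//.
    by apply: le0_ler_powR; [rewrite subr_le0 ltW|exact: m0|exact: (hi t ti).1].
  apply: ge0_subset_integral.
  - exact: measurable_itv.
  - exact: measurable_itv.
  - exact: mg.
  - by move=> t _; rewrite mule_ge0// lee_fin ?powR_ge0 ?sqr_ge0.
  by move=> t ti; exact: (hi t ti).2.
have key e : 0 < e -> e < dl ->
    (\int[mu]_(t in `]e, T[) (t `^ (a - 1) * h t ^+ 2)%:E <= C%:E * (N + Z))%E.
  move=> e0 ed; have eT : e < T by exact: lt_trans dlT.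
  have split_eT : (\int[mu]_(t in `]e, T[) (t `^ (a - 1) * h t ^+ 2)%:E =
     \int[mu]_(t in `]e, dl[) (t `^ (a - 1) * h t ^+ 2)%:E +
     \int[mu]_(t in `[dl, T[) (t `^ (a - 1) * h t ^+ 2)%:E)%E.
    rewrite (@itv_bndbnd_setU _ _ _ (BLeft dl)) ?bnd_simp ?(ltW dlT)//.
    rewrite ge0_integral_setU//=.
    apply/disj_setPS => t [] /=; rewrite !in_itv/= => /andP[_ td] /andP[dt _].
    by move: (lt_le_trans td dt); rewrite ltxx.
  have := Hardy_step mh e0 ed; rewrite split_eT -/Z -/c.
  have := @bnd `]e, dl[ e e0.
  have := @bnd `[dl, T[ dl dl0.
  set X := (\int[mu]_(t in `]e, dl[) _)%E; set J := (\int[mu]_(t in `[dl, T[) _)%E.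
  have X0 : (0 <= X)%E by apply: integral_ge0 => t _; exact: f0.
  have J0 : (0 <= J)%E by apply: integral_ge0 => t _; exact: f0.
  move=> hJ hX.
  have {}hJ : (J <= (dl `^ (a - 1))%:E * N)%E.
    by apply: hJ => t; rewrite !in_itv/= => /andP[dt ->]; rewrite dt (lt_le_trans dl0 dt).
  have {}hX : (X <= (e `^ (a - 1))%:E * N)%E.
    apply: hX => t; rewrite !in_itv/= => /andP[dt td].
    by rewrite (ltW dt) (lt_trans e0 dt) (lt_trans td dlT).
  have Xf : X \is a fin_num.
    by rewrite ge0_fin_numE// (le_lt_trans hX)// -(fineK Nf) -EFinM ltry.
  have Jf : J \is a fin_num.
    by rewrite ge0_fin_numE// (le_lt_trans hJ)// -(fineK Nf) -EFinM ltry.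
  move: hJ; rewrite -(fineK Nf) -(fineK Zf) -(fineK Xf) -(fineK Jf).
  rewrite -!(EFinD, EFinM) !lee_fin => hJ h1.
  have n0 : 0 <= fine N by exact: fine_ge0.
  have z0 : 0 <= fine Z by exact: fine_ge0.
  rewrite /C; have := mulr_ge0 (ltW c0) n0; have := mulr_ge0 (powR_ge0 dl (a - 1)) z0.
  by move=> ? ?; rewrite mulrDl !mulrDr; lra.
pose e (n : nat) := dl / n.+2%:R.
have e0 n : 0 < e n by rewrite divr_gt0.
have ed n : e n < dl by rewrite ltr_pdivrMr// ltr_pMr// ltr1n.
have UF : \bigcup_n [set` `](e n), T[] = [set` `]0, T[].
  apply/seteqP; split => [x [i _]|x]; rewrite /= !in_itv /=.
    by move=> /andP[ix ->]; rewrite andbT (lt_trans _ ix).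
  move=> /andP[x0 xt].
  exists (Num.truncn (dl / x)) => //=; rewrite in_itv/= xt andbT.
  rewrite ltr_pdivrMr// mulrC -ltr_pdivrMr//.
  by apply: (lt_trans (truncnS_gt _)); rewrite ltr_nat.
rewrite -UF.
have cvF : (\int[mu]_(x in [set` `](e i), T[]) (x `^ (a - 1) * h x ^+ 2)%:E)%E @[i --> \oo] -->
       (\int[mu]_(x in \bigcup_i [set` `](e i), T[]) (x `^ (a - 1) * h x ^+ 2)%:E)%E.
  apply: ge0_nondecreasing_set_cvg_integral => //.
  - move=> n m nm; rewrite subsetEset => x; rewrite /= !in_itv/=.
    move=> /andP[nx ->]; rewrite andbT; apply: le_lt_trans nx.
    by rewrite ler_pM2l// lef_pV2 ?posrE// ler_nat.
rewrite -(cvg_lim _ cvF)//; apply: lime_le; first by apply/cvg_ex; eexists; exact: cvF.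
by apply: nearW => i; exact: key.
Qed.

End Hardy_inequality.

(** * Estimates for the relaxation function *)

Section Mittag_Leffler_estimates.
Context {R : realType}.
Local Notation mu := (@lebesgue_measure R).
Variables (a T : R).
Hypotheses (a0 : 0 < a) (a1 : a < 1) (T0 : 0 < T).

Local Opaque Gamma kern ml_fun mittag_leffler.

Let G0 : 0 < Gamma a. Proof. exact: Gamma_gt0. Qed.
Let G1 : 0 < Gamma (a + 1). Proof. by rewrite Gamma_gt0// addr_gt0. Qed.
Let b0 : 0 < 1 - a. Proof. by rewrite subr_gt0. Qed.

Lemma ml_fun1E (lam t : R) : 0 < t ->
  ml_fun a lam 1 t = mittag_leffler a 1 (- lam * t `^ a).
Proof. by move=> t0; rewrite ml_funE// subrr powRr0 mul1r. Qed.

(* [e] solves [e + lam * I^a e = 1], and [p = - e' / lam]. *)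
Record relaxation (lam : R) (e p : R -> R) : Prop := Relaxation {
  relax_me : measurable_fun [set: R] e;
  relax_mp : measurable_fun [set: R] p;
  relax_p0 : forall t, 0 <= p t;
  relax_pk : forall t, p t <= kern a t;
  relax_e0 : forall t, 0 <= e t;
  relax_e1 : forall t, e t <= 1;
  relax_mono : forall s t, 0 < s -> s <= t -> e t <= e s;
  relax_decay : forall t, 0 < t -> lam * e t <= Gamma (a + 1) * t `^ (- a);
  relax_int0 : forall t, 0 < t ->
    (\int[mu]_(s in `]0%R, t[) (p s)%:E = ((1 - e t) / lam)%:E)%E;
  relax_int : forall s t, 0 < s -> s <= t ->
    (\int[mu]_(x in `[s, t[) (p x)%:E = ((e s - e t) / lam)%:E)%E;
  relax_conv : forall t, 0 < t ->
    (\int[mu]_(s in `]0%R, t[) ((t - s) `^ (a - 1) / Gamma a * e s)%:E =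
     ((1 - e t) / lam)%:E)%E }.

Lemma ml_fun_relaxation (lam : R) : 0 < lam ->
  relaxation lam (ml_fun a lam 1) (ml_fun a lam a).
Proof.
move=> lam0; split.
- exact: measurable_ml_fun.
- exact: measurable_ml_fun.
- by move=> t; exact: ml_fun_ge0.
- by move=> t; exact: ml_fun_le_kern.
- move=> t; have [t0|t0] := leP t 0; first by rewrite ml_fun_le0.
  by rewrite ml_fun1E// mittag_leffler_ge0// ltW.
- move=> t; have [t0|t0] := leP t 0; first by rewrite ml_fun_le0.
  by rewrite ml_fun1E// mittag_leffler_le1// ltW.
- move=> s t s0 st; rewrite !ml_fun1E ?(lt_le_trans s0)//.
  by apply: mittag_leffler_mono => //; exact: ltW.
- move=> t t0; rewrite ml_fun1E// powRN ler_pdivlMr ?powR_gt0//.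
  by have := mittag_leffler_decay a0 a1 lam0 t0; rewrite mulrCA mulrA.
- by move=> t t0; rewrite ml_fun1E//; apply: integral_ml_fun => //; exact: ltW.
- move=> s t s0 st; rewrite !ml_fun1E ?(lt_le_trans s0)//.
  by apply: integral_ml_fun_itv => //; exact: ltW.
- move=> t t0; rewrite ml_fun1E// -(integral_mittag_leffler_conv a0 lam0 t0).
  by apply: eq_integral => s /set_mem /=; rewrite in_itv/= => /andP[s0 _]; rewrite ml_fun1E.
Qed.

Section fixed_parameter.
Variables (lam : R) (e p : R -> R).
Hypotheses (lam0 : 0 < lam) (ep : relaxation lam e p).

Let me := relax_me ep.
Let mp := relax_mp ep.
Let p0 := relax_p0 ep.
Let e_ge0 := relax_e0 ep.
Let e_le1 := relax_e1 ep.
Let e_mono := relax_mono ep.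

(** [e^2 <= e] and [lam * e <= Gamma (a + 1) * t^(- a)], which is integrable at 0 as [a < 1]. *)
Lemma L2_mittag_leffler :
  (lam%:E * \int[mu]_(t in `]0%R, T[) (e t ^+ 2)%:E <=
   (Gamma (a + 1) * (T `^ (1 - a) / (1 - a)))%:E)%E.
Proof.
have mf : measurable_fun (`]0%R, T[ : set (measurableTypeR R)) (fun t => (t `^ (1 - a - 1))%:E).
  by apply/measurable_EFinP; apply: measurable_funTS; exact: measurable_powR.
rewrite -ge0_integralZl; last 4 first.
- exact: measurable_itv.
- by apply/measurable_EFinP; apply: measurable_funTS; exact: measurable_funX.
- by move=> t _; rewrite lee_fin sqr_ge0.
- by rewrite lee_fin ltW.
apply: (@le_trans _ _ (\int[mu]_(t in `]0%R, T[) ((Gamma (a + 1))%:E * (t `^ (1 - a - 1))%:E))%E).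
  apply: ge0_le_integral.
  - exact: measurable_itv.
  - by move=> t _; rewrite -EFinM lee_fin mulr_ge0 ?sqr_ge0 ?(ltW lam0).
  - by apply: measurable_funeM; apply/measurable_EFinP; apply: measurable_funTS; exact: measurable_funX.
  - exact: measurable_funeM.
  - move=> t /=; rewrite in_itv/= => /andP[t0 _]; rewrite -!EFinM lee_fin addrAC subrr sub0r.
    apply: le_trans (relax_decay ep t0); rewrite ler_wpM2l ?(ltW lam0)//.
    rewrite -[leRHS]mulr1 expr2; exact: ler_wpM2l.
rewrite ge0_integralZl; last 4 first.
- exact: measurable_itv.
- exact: mf.
- by move=> t _; rewrite lee_fin powR_ge0.
- by rewrite lee_fin ltW.
rewrite EFinM lee_wpmul2l ?lee_fin ?(ltW G1)//.
apply: le_trans (integral_powR_le b0 T0).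
apply: ge0_subset_integral => //.
- by apply/measurable_EFinP; apply: measurable_funTS; exact: measurable_powR.
- by move=> t _; rewrite lee_fin powR_ge0.
- by move=> t /=; rewrite !in_itv/= => /andP[-> /ltW].
Qed.

(** Majorant of the Sobolev integrand on the triangle [s < t]: one factor of [(e s - e t)^2] is
    replaced by [e s], so that the other can be written as [lam] times an integral of [p]. *)
Let G t s := if (s \in `]0, T[) && (t \in `]s, T[) then
  e s * (e s - e t) * (t - s) `^ (a - 2) else 0.

Let G_ge0 t s : 0 <= G t s.
Proof.
rewrite /G; case: ifP => //; rewrite !in_itv/= => /andP[/andP[s0 _] /andP[st _]].
by rewrite !mulr_ge0 ?powR_ge0// subr_ge0 e_mono// ltW.
Qed.

Let measurable_triangle (l : bool) : measurable_fun [set: measurableTypeR R * measurableTypeR R]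
  (fun z => (z.2 \in `]0, T[) && (z.1 \in `]z.2, T[)).
Proof.
apply: measurable_and.
  exact: (measurableT_comp (measurable_in_itv _) measurable_snd).
rewrite (_ : (fun z => _) = (fun z : measurableTypeR R * measurableTypeR R => (z.2 < z.1) && (z.1 < T))); last first.
  by apply/funext => z; rewrite in_itv.
by apply: measurable_and; apply: measurable_fun_ltr;
  [exact: measurable_snd|exact: measurable_fst|exact: measurable_fst|exact: measurable_cst].
Qed.

Let mG : meas2 G.
Proof.
apply: (meas2_if (measurable_triangle true)); apply: meas2M.
  apply: meas2M; first exact: (meas2_snd me).
  by apply: measurable_funB; [exact: (meas2_snd me)|exact: (meas2_fst me)].
exact: (@meas2_sub _ (fun u => u `^ (a - 2)) (measurable_powR _)).
Qed.

(** An upper bound for what is left of [G] once [e s - e t] is written as an integral of [p] over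
    [x] and the variable [t] is integrated over []x, T[]. *)
Let K s x := if (s \in `]0, T[) && (x \in `]s, T[) then
  lam * e s * p x * (x - s) `^ (a - 1) / (1 - a) else 0.

Let K_ge0 s x : 0 <= K s x.
Proof.
rewrite /K; case: ifP => // _.
by rewrite !mulr_ge0 ?powR_ge0 ?invr_ge0 ?(ltW lam0) ?(ltW b0).
Qed.

Let mK : meas2 K.
Proof.
apply: (@meas2_swap _ (fun x s => K s x)).
apply: (meas2_if (measurable_triangle true)).
apply: meas2M; last exact: measurable_cst.
apply: meas2M; last exact: (@meas2_sub _ (fun u => u `^ (a - 1)) (measurable_powR _)).
apply: meas2M; last exact: (meas2_fst mp).
by apply: meas2M; [exact: measurable_cst|exact: (meas2_snd me)].
Qed.

(** The right-hand side is the integral up to infinity; the part beyond [T] is dropped. *)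
Let tail_integral (s x : R) : s < x ->
  (\int[mu]_(t in `]x, T[) ((t - s) `^ (a - 2))%:E <= ((x - s) `^ (a - 1) / (1 - a))%:E)%E.
Proof.
move=> sx; have xs0 : 0 < x - s by rewrite subr_gt0.
have [xT|Tx] := ltP x T; last first.
  rewrite set_itv_ge ?integral_set0 ?lee_fin ?divr_ge0 ?powR_ge0 ?(ltW b0)//.
  by rewrite bnd_simp -leNgt.
have mP : measurable_fun [set: R] (fun u : R => (u `^ (a - 2))%:E).
  by apply/measurable_EFinP; exact: measurable_powR.
have -> : (\int[mu]_(t in `]x, T[) ((t - s) `^ (a - 2))%:E =
   \int[mu]_(u in `](x - s)%R, (T - s)%R[) (u `^ (a - 2))%:E)%E.
  rewrite -!integral_itv_if -[RHS](@integral_shift R s); last 2 first.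
  - apply/measurable_EFinP; apply: measurable_fun_ifT; [exact: measurable_in_itv|exact: measurable_powR|exact: measurable_cst].
  - by move=> u; rewrite lee_fin; case: ifP => // _; exact: powR_ge0.
  by apply: eq_integral => t _; rewrite !in_itv/= !ltrD2r.
rewrite (_ : a - 2 = a - 1 - 1); last by ring.
apply: (@le_trans _ _ (\int[mu]_(u in `[(x - s)%R, (T - s)%R]) (u `^ (a - 1 - 1))%:E)%E).
  apply: ge0_subset_integral => //.
  - by apply/measurable_EFinP; apply: measurable_funTS; exact: measurable_powR.
  - by move=> t _; rewrite lee_fin powR_ge0.
  - exact: subset_itv_oo_cc.
rewrite integral_powR_itv ?ltrD2r//; last by rewrite lt_eqF// subr_lt0.
rewrite lee_fin -(opprB 1 a) invrN !mulrN opprK addrC lerBlDr lerDl.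
by rewrite divr_ge0 ?powR_ge0 ?(ltW b0).
Qed.

(** Tonelli on the triangle [s < x < t < T]: integrating over [x] gives back [G], integrating over
    [t] gives at most [K] by [tail_integral]. *)
Let inner s : (\int[mu]_t (G t s)%:E <= \int[mu]_x (K s x)%:E)%E.
Proof.
have [sT|sT] := boolP (s \in `]0, T[); last first.
  rewrite integral0_eq => [|t _]; last by rewrite /G (negbTE sT).
  by apply: integral_ge0 => x _; rewrite lee_fin.
have s0 : 0 < s by move: sT; rewrite in_itv/= => /andP[].
pose F t x := if (t \in `]s, T[) && (x \in `]s, t[) then
  lam * e s * (t - s) `^ (a - 2) * p x else 0.
have F0 t x : 0 <= F t x.
  by rewrite /F; case: ifP => // _; rewrite !mulr_ge0 ?powR_ge0 ?(ltW lam0).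
have mF : meas2 F.
  apply: meas2_if.
    apply: measurable_and; first exact: (measurableT_comp (measurable_in_itv _) measurable_fst).
    rewrite (_ : (fun z => _) = (fun z : measurableTypeR R * measurableTypeR R => (s < z.2) && (z.2 < z.1))); last first.
      by apply/funext => z; rewrite in_itv.
    by apply: measurable_and; apply: measurable_fun_ltr;
      [exact: measurable_cst|exact: measurable_snd|exact: measurable_snd|exact: measurable_fst].
  apply: meas2M; last exact: (meas2_snd mp).
  apply: meas2M; first exact: measurable_cst.
  apply: (@meas2_fst _ (fun t => (t - s) `^ (a - 2))).
  by apply: (measurableT_comp (measurable_powR _)); exact: measurable_funB.
have GE t : (G t s)%:E = (\int[mu]_x (F t x)%:E)%E.
  rewrite /G sT/= /F; case: ifPn => tT /=; last by rewrite integral0_eq.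
  have st : s < t by move: tT; rewrite in_itv/= => /andP[].
  rewrite integral_itv_if.
  under eq_integral do rewrite EFinM.
  rewrite ge0_integralZl; last 4 first.
  - exact: measurable_itv.
  - by apply/measurable_EFinP; exact: measurable_funTS.
  - by move=> x _; rewrite lee_fin.
  - by rewrite lee_fin !mulr_ge0 ?powR_ge0 ?(ltW lam0).
  rewrite integral_itv_obnd_cbnd; last by apply/measurable_EFinP; exact: measurable_funTS.
  rewrite (relax_int ep s0 (ltW st)) -EFinM; congr (_%:E).
  by field; rewrite gt_eqF.
under eq_integral do rewrite GE.
rewrite double_integral_swap//.
apply: ge0_le_integral; first exact: measurableT.
- by move=> x _; apply: integral_ge0 => t _; rewrite lee_fin.
- exact: (meas2_integral (meas2_swap mF)).
- by apply/measurable_EFinP; exact: meas2_right.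
move=> x _; rewrite /K sT /=; case: ifPn => xT; last first.
  rewrite integral0_eq// => t _; rewrite /F; case: ifPn => //.
  rewrite !in_itv/= => /andP[/andP[_ tT] /andP[sx xt]].
  by move: xT; rewrite in_itv/= sx (lt_trans xt tT).
have sx : s < x by move: xT; rewrite in_itv/= => /andP[].
apply: (@le_trans _ _ (\int[mu]_(t in `]x, T[) ((lam * e s * p x)%:E * ((t - s) `^ (a - 2))%:E))%E).
  rewrite le_eqVlt; apply/orP; left; apply/eqP.
  transitivity (\int[mu]_(t in `]x, T[) (lam * e s * p x * (t - s) `^ (a - 2))%:E)%E; last first.
    by apply: eq_integral => t _; rewrite -EFinM.
  rewrite -integral_itv_if; apply: eq_integral => t _; congr (_%:E).
  rewrite /F !in_itv/= sx /= [LHS](_ : _ = if (x < t) && (t < T) then lam * e s * (t - s) `^ (a - 2) * p x else 0).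
    by case: ifP => // _; ring.
  have [xt|tx] := ltP x t; last by rewrite andbF.
  by rewrite (lt_trans sx xt) /= andbT.
rewrite ge0_integralZl; last 4 first.
- exact: measurable_itv.
- apply/measurable_EFinP; apply: measurable_funTS.
  by apply: (measurableT_comp (measurable_powR _)); exact: measurable_funB.
- by move=> t _; rewrite lee_fin powR_ge0.
- by rewrite lee_fin !mulr_ge0 ?(ltW lam0).
rewrite -[X in (_ <= X%:E)%E]mulrA [X in (_ <= X)%E]EFinM.
apply: lee_wpmul2l; last exact: tail_integral.
by rewrite lee_fin !mulr_ge0 ?(ltW lam0).
Qed.

(** Integrating [K] first over [s] produces the fractional integral of [e] at [x], namely
    [(1 - e x) / lam]; this cancels the factor [lam], and [lam] times the integral of [p] is at most
    1. *)
Let total : (\int[mu]_s \int[mu]_x (K s x)%:E <= (Gamma a / (1 - a) / lam)%:E)%E.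
Proof.
rewrite double_integral_swap//.
have q0 : 0 <= Gamma a / (1 - a) by rewrite divr_ge0// ltW.
have mpi : measurable_fun (`]0%R, T[ : set (measurableTypeR R)) (fun x => (p x)%:E).
  by apply/measurable_EFinP; exact: measurable_funTS.
apply: (@le_trans _ _ (\int[mu]_(x in `]0%R, T[) ((Gamma a / (1 - a))%:E * (p x)%:E))%E); last first.
  rewrite ge0_integralZl//; last by move=> x _; rewrite lee_fin.
  rewrite (relax_int0 ep T0) -EFinM lee_fin; apply: ler_wpM2l => //.
  by rewrite ler_pdivrMr// mulVf ?gt_eqF// gerBl.
rewrite [leRHS]integral_mkcond; apply: ge0_le_integral; first exact: measurableT.
- by move=> x _; apply: integral_ge0 => t _; rewrite lee_fin.
- exact: (meas2_integral (meas2_swap mK)).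
- by apply/(measurable_restrictT _ _).1; [exact: measurable_itv|exact: measurable_funeM].
move=> x _; rewrite patchE mem_setE; case: ifPn => xT; last first.
  rewrite integral0_eq// => s _; rewrite /K; case: ifPn => //.
  rewrite !in_itv/= => /andP[/andP[s0 _] /andP[sx xT']].
  by move: xT; rewrite in_itv/= xT' (lt_trans s0 sx).
have /andP[x0 xT'] : 0 < x < T by move: xT; rewrite in_itv.
apply: (@le_trans _ _ (\int[mu]_(s in `]0%R, x[) ((lam * p x / (1 - a) * Gamma a)%:E * ((x - s) `^ (a - 1) / Gamma a * e s)%:E))%E).
  rewrite le_eqVlt; apply/orP; left; apply/eqP.
  transitivity (\int[mu]_(s in `]0%R, x[) (K s x)%:E)%E.
    rewrite [RHS]integral_mkcond; apply: eq_integral => s _; rewrite patchE mem_setE.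
    case: ifPn => //; rewrite /K !in_itv/= => sx; rewrite ifF//; apply/negbTE.
    apply: contra sx => /andP[/andP[s0 _] /andP[sx _]]; by rewrite s0 sx.
  apply: eq_integral => s /set_mem /=; rewrite in_itv/= => /andP[s0 sx].
  rewrite /K !in_itv/= s0 (lt_trans sx xT') sx xT' /= -EFinM.
  by congr (_%:E); field; rewrite !gt_eqF.
rewrite ge0_integralZl; last 4 first.
- exact: measurable_itv.
- apply/measurable_EFinP; apply: measurable_funM.
    apply: measurable_funM => //; apply: measurable_funTS.
    by apply: (measurableT_comp (measurable_powR _)); exact: measurable_funB.
  exact: measurable_funTS.
- move=> s /=; rewrite in_itv/= => /andP[s0 sx]; by rewrite lee_fin !mulr_ge0 ?powR_ge0 ?invr_ge0 ?(ltW G0).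
- by rewrite lee_fin !mulr_ge0 ?invr_ge0 ?(ltW lam0) ?(ltW b0) ?(ltW G0).
rewrite (relax_conv ep x0) -!EFinM lee_fin.
have -> : lam * p x / (1 - a) * Gamma a * ((1 - e x) / lam) = Gamma a / (1 - a) * p x * (1 - e x).
  by field; rewrite !gt_eqF.
by apply: ler_piMr; [exact: mulr_ge0|rewrite gerBl].
Qed.

(** The integrand is symmetric, so the square splits into two triangles, each bounded by
    [Gamma a / (1 - a)] after multiplication by [lam]: hence the factor 2. *)
Lemma seminorm_mittag_leffler :
  (lam%:E * \int[mu]_x \int[mu]_y (sobolev_kernel T ((1 - a) / 2) x y * (e x - e y) ^+ 2)%:E <=
   (2 * (Gamma a / (1 - a)))%:E)%E.
Proof.
have mG' := meas2_swap mG.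
have GG : (\int[mu]_x \int[mu]_y (sobolev_kernel T ((1 - a) / 2) x y * (e x - e y) ^+ 2)%:E <=
    \int[mu]_x \int[mu]_y (G x y + G y x)%:E)%E.
  apply: double_integral_le.
  - exact: meas2_sobolev.
  - exact: measurable_funD.
  - by move=> x y; apply: mulr_ge0 (sobolev_kernel_ge0 _ _ _ _) (sqr_ge0 _).
  have half x y : y < x -> sobolev_kernel T ((1 - a) / 2) x y * (e x - e y) ^+ 2 <= G x y.
    move=> yx; rewrite /sobolev_kernel; case: ifPn => [|_]; last by rewrite mul0r; exact: G_ge0.
    move=> /andP[xT yT]; rewrite /G yT /= in_itv/= yx.
    move: xT yT; rewrite !in_itv/= => /andP[x0 ->] /andP[y0 yT] /=.
    have -> : 1 + 2 * ((1 - a) / 2) = - (a - 2) by field.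
    rewrite powRN invrK gtr0_norm ?subr_gt0// mulrC ler_wpM2r ?powR_ge0//.
    have ee : e x <= e y by apply: e_mono => //; exact: ltW.
    rewrite -sqrrN opprB expr2 ler_wpM2r ?subr_ge0//.
    by rewrite gerBl.
  move=> x y; have [xy|yx|->] := ltgtP x y.
  - apply: (@le_trans _ _ (G y x)); last by rewrite lerDr.
    by rewrite sobolev_kernelC -sqrrN opprB half.
  - by apply: (@le_trans _ _ (G x y)); [exact: half|rewrite lerDl].
  - by rewrite subrr expr0n mulr0 addr_ge0.
have I1 : (\int[mu]_x \int[mu]_y (G y x)%:E <= (Gamma a / (1 - a) / lam)%:E)%E.
  apply: le_trans total; apply: ge0_le_integral; first exact: measurableT.
  - by move=> x _; apply: integral_ge0 => t _; rewrite lee_fin.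
  - exact: meas2_integral.
  - exact: meas2_integral.
  - by move=> x _; exact: inner.
rewrite double_integralD// in GG.
have I2 : (\int[mu]_x \int[mu]_y (G x y)%:E <= (Gamma a / (1 - a) / lam)%:E)%E.
  by rewrite double_integral_swap.
have lamE : (0 <= lam%:E)%E by rewrite lee_fin ltW.
apply: le_trans (lee_wpmul2l lamE (le_trans GG (leeD I2 I1))) _.
rewrite -EFinD -EFinM lee_fin le_eqVlt; apply/orP; left; apply/eqP.
by field; rewrite !gt_eqF.
Qed.

Lemma sobolev_relaxation :
  (lam%:E * sobolev_time_normsq T ((1 - a) / 2) e <=
   (Gamma (a + 1) * (T `^ (1 - a) / (1 - a)) + 2 * (Gamma a / (1 - a)))%:E)%E.
Proof.
rewrite sobolev_normsqE ge0_muleDr; last 2 first.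
- by apply: integral_ge0 => t _; rewrite lee_fin sqr_ge0.
- apply: integral_ge0 => x _; apply: integral_ge0 => y _; rewrite lee_fin.
  exact: mulr_ge0 (sobolev_kernel_ge0 _ _ _ _) (sqr_ge0 _).
by rewrite EFinD; apply: leeD; [exact: L2_mittag_leffler|exact: seminorm_mittag_leffler].
Qed.

(** One of the two factors [p] is bounded by the kernel; the other one stays, so that [lam * p] can
    be integrated with a bound uniform in [lam]. *)
Lemma relax_sqr_le t : 0 < t -> p t ^+ 2 * t `^ (1 - a) <= p t / Gamma a.
Proof.
move=> t0; rewrite expr2 -mulrA; apply: ler_wpM2l => //.
rewrite -ler_pdivlMr ?powR_gt0//.
apply: le_trans (relax_pk ep t) _; rewrite kernE//.
by rewrite -powRN opprB mulrC.
Qed.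

(** Young's inequality with parameter [theta], after distributing
    [1 = t^((1 - a)/2) * t^((a - 1)/2)] between [p] and [h]. The parameter stays free so that it can
    be balanced once for the whole series of modes. *)
Lemma pairing_relaxation (CH theta c : R) (h : R -> R) : 0 < theta ->
  measurable_fun [set: R] h ->
  (\int[mu]_(t in `]0%R, T[) (t `^ (a - 1) * h t ^+ 2)%:E <=
    CH%:E * sobolev_time_normsq T ((1 - a) / 2) h)%E ->
  (\int[mu]_(t in `]0%R, T[) `|c * (Num.sqrt lam * p t * h t)|%:E <=
    (theta * c ^+ 2 / (2 * Gamma a))%:E +
    (CH / (2 * theta))%:E * sobolev_time_normsq T ((1 - a) / 2) h)%E.
Proof.
move=> th0 mh hardy.
pose A t := theta * c ^+ 2 / (2 * Gamma a) * lam * p t.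
pose B t := (2 * theta)^-1 * (t `^ (a - 1) * h t ^+ 2).
have A0 t : 0 <= A t.
  apply: mulr_ge0 => //; apply: mulr_ge0; last exact: ltW.
  apply: divr_ge0; last by rewrite mulr_ge0// ltW.
  by apply: mulr_ge0 (sqr_ge0 _); exact: ltW.
have B0 t : 0 <= B t.
  apply: mulr_ge0; first by rewrite invr_ge0 mulr_ge0// ltW.
  exact: mulr_ge0 (powR_ge0 _ _) (sqr_ge0 _).
have mA : measurable_fun (`]0%R, T[ : set (measurableTypeR R)) (fun t => (A t)%:E).
  by apply/measurable_EFinP; apply: measurable_funTS; apply: measurable_funM.
have mH : measurable_fun (`]0%R, T[ : set (measurableTypeR R)) (fun t => (t `^ (a - 1) * h t ^+ 2)%:E).
  apply/measurable_EFinP; apply: measurable_funTS; apply: measurable_funM.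
    exact: measurable_powR.
  exact: measurable_funX.
have mB : measurable_fun (`]0%R, T[ : set (measurableTypeR R)) (fun t => (B t)%:E).
  exact: (measurable_funeM (2 * theta)^-1%:E mH).
apply: (@le_trans _ _ (\int[mu]_(t in `]0%R, T[) ((A t)%:E + (B t)%:E))%E).
  apply: ge0_le_integral.
  - exact: measurable_itv.
  - by move=> t _; rewrite lee_fin.
  - apply/measurable_EFinP; apply: measurable_funTS; apply: measurableT_comp => //.
    apply: measurable_funM; first exact: measurable_cst.
    by apply: measurable_funM mh; apply: measurable_funM mp; exact: measurable_cst.
  - exact: emeasurable_funD.
  move=> t /=; rewrite in_itv/= => /andP[t0 _]; rewrite -EFinD lee_fin.
  pose x := `|c| * Num.sqrt lam * p t * t `^ ((1 - a) / 2).
  pose y := t `^ ((a - 1) / 2) * `|h t|.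
  have xy : `|c * (Num.sqrt lam * p t * h t)| = x * y.
    rewrite !normrM (ger0_norm (sqrtr_ge0 _)) (ger0_norm (p0 t)) /x /y.
    have : t `^ ((1 - a) / 2) * t `^ ((a - 1) / 2) = 1.
      rewrite -gt0_powRD// (_ : _ + _ = 0) ?powRr0//; by field.
    move: (t `^ _) (t `^ _) => u v uv.
    rewrite [RHS](_ : _ = u * v * (`|c| * (Num.sqrt lam * p t * `|h t|))); last by ring.
    by rewrite [u * v]mulrC uv mul1r.
  have tt z : t `^ (z / 2) ^+ 2 = t `^ z.
    by rewrite -powR_mulrn ?powR_ge0// -powRrM divfK.
  have hx : theta / 2 * x ^+ 2 <= A t.
    rewrite /x !exprMn tt real_normK ?num_real// sqr_sqrtr ?(ltW lam0)//.
    have := relax_sqr_le t0 => /(ler_wpM2l (_ : 0 <= theta / 2 * (c ^+ 2 * lam))).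
    have q0 : 0 <= theta / 2 * (c ^+ 2 * lam).
      apply: mulr_ge0; first by rewrite divr_ge0// ltW.
      by apply: mulr_ge0 (sqr_ge0 _) _; exact: ltW.
    move=> /(_ q0) H.
    apply: (@le_trans _ _ (theta / 2 * (c ^+ 2 * lam) * (p t ^+ 2 * t `^ (1 - a)))).
      by rewrite le_eqVlt; apply/orP; left; apply/eqP; ring.
    apply: le_trans H _; rewrite le_eqVlt; apply/orP; left; apply/eqP.
    by rewrite /A; field; rewrite gt_eqF.
  have hy : (2 * theta)^-1 * y ^+ 2 = B t.
    by rewrite /y /B exprMn tt real_normK ?num_real.
  rewrite xy -hy; apply: (@le_trans _ _ (theta / 2 * x ^+ 2 + (2 * theta)^-1 * y ^+ 2)); last by rewrite lerD2r.
  rewrite -subr_ge0.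
  have -> : theta / 2 * x ^+ 2 + (2 * theta)^-1 * y ^+ 2 - x * y = (2 * theta)^-1 * (theta * x - y) ^+ 2.
    by field; rewrite gt_eqF.
  by apply: mulr_ge0 (sqr_ge0 _); rewrite invr_ge0 mulr_ge0// ltW.
rewrite ge0_integralD; last 5 first.
- exact: measurable_itv.
- by move=> t _; rewrite lee_fin.
- exact: mA.
- by move=> t _; rewrite lee_fin.
- exact: mB.
apply: leeD.
  have q0 : 0 <= theta * c ^+ 2 / (2 * Gamma a).
    apply: divr_ge0; first by apply: mulr_ge0 (sqr_ge0 _); exact: ltW.
    by apply: mulr_ge0 => //; exact: ltW.
  rewrite /A; under eq_integral do rewrite EFinM.
  rewrite ge0_integralZl; last 4 first.
  - exact: measurable_itv.
  - by apply/measurable_EFinP; exact: measurable_funTS.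
  - by move=> x _; rewrite lee_fin.
  - by rewrite lee_fin mulr_ge0 ?(ltW lam0).
  rewrite (relax_int0 ep T0) -EFinM lee_fin -(mulrA _ lam) ler_piMr//.
  by rewrite mulrC divfK ?gt_eqF// gerBl.
rewrite /B; under eq_integral do rewrite EFinM.
rewrite ge0_integralZl; last 4 first.
- exact: measurable_itv.
- exact: mH.
- by move=> t _; rewrite lee_fin; exact: mulr_ge0 (powR_ge0 _ _) (sqr_ge0 _).
- by rewrite lee_fin invr_ge0 mulr_ge0// ltW.
rewrite [CH / _]mulrC EFinM -muleA; apply: lee_wpmul2l => //.
by rewrite lee_fin invr_ge0 mulr_ge0// ltW.
Qed.

Let powR_itv_le (b x : R) : 0 < b -> 0 <= x ->
  (\int[mu]_(t in `]0%R, T[) (x * t `^ (b - 1))%:E <= (x * (T `^ b / b))%:E)%E.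
Proof.
move=> b1 x0; under eq_integral do rewrite EFinM.
rewrite ge0_integralZl; last 4 first.
- exact: measurable_itv.
- by apply/measurable_EFinP; apply: measurable_funTS; exact: measurable_powR.
- by move=> t _; rewrite lee_fin powR_ge0.
- by rewrite lee_fin.
rewrite EFinM lee_wpmul2l ?lee_fin//.
apply: le_trans (integral_powR_le b1 T0).
apply: ge0_subset_integral => //.
- by apply/measurable_EFinP; apply: measurable_funTS; exact: measurable_powR.
- by move=> t _; rewrite lee_fin powR_ge0.
- by move=> t /=; rewrite !in_itv/= => /andP[-> /ltW].
Qed.

(** [e^2 <= e^g] because [e <= 1] and [g <= 2]; then the decay estimate is raised to the power [g].
    The maximum with 1 allows [M^g <= M^2], a constant free of [g]. *)
Lemma relax_e_bound (g t : R) : 0 <= g -> g <= 2 -> 0 < t ->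
  lam `^ g * e t ^+ 2 <= Num.max 1 (Gamma (a + 1)) ^+ 2 * t `^ (- (a * g)).
Proof.
move=> g0 g2 t0; set M := Num.max _ _.
have M1 : 1 <= M by rewrite le_max lexx.
have M0 : 0 <= M by exact: le_trans M1.
have [->|e0] := eqVneq (e t) 0; first by rewrite expr0n mulr0 mulr_ge0 ?sqr_ge0 ?powR_ge0.
have e_gt0 : 0 < e t by rewrite lt_neqAle eq_sym e0 e_ge0.
apply: (@le_trans _ _ ((lam * e t) `^ g)).
  rewrite powRM ?(ltW lam0)// ler_wpM2l ?powR_ge0// -powR_mulrn//.
  by apply: ger_powR => //; rewrite e_gt0 e_le1.
apply: (@le_trans _ _ ((M * t `^ (- a)) `^ g)).
  apply: ge0_ler_powR; rewrite ?nnegrE ?mulr_ge0 ?powR_ge0 ?(ltW lam0)//.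
  apply: le_trans (relax_decay ep t0) _; rewrite ler_wpM2r ?powR_ge0//.
  by rewrite le_max lexx orbT.
rewrite powRM ?powR_ge0// -powRrM mulNr ler_wpM2r ?powR_ge0//.
by rewrite -powR_mulrn//; exact: ler_powR.
Qed.

Lemma L2_relaxation_subcritical (g : R) : 0 <= g -> g <= 2 -> a * g < 1 ->
  ((lam `^ g)%:E * \int[mu]_(t in `]0%R, T[) (e t ^+ 2)%:E <=
   (Num.max 1 (Gamma (a + 1)) ^+ 2 * (T `^ (1 - a * g) / (1 - a * g)))%:E)%E.
Proof.
move=> g0 g2 ag.
have ag0 : 0 < 1 - a * g by rewrite subr_gt0.
apply: le_trans (powR_itv_le ag0 (sqr_ge0 _)).
rewrite -ge0_integralZl; last 4 first.
- exact: measurable_itv.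
- by apply/measurable_EFinP; apply: measurable_funTS; exact: measurable_funX.
- by move=> t _; rewrite lee_fin sqr_ge0.
- by rewrite lee_fin powR_ge0.
apply: ge0_le_integral.
- exact: measurable_itv.
- by move=> t _; rewrite -EFinM lee_fin mulr_ge0 ?sqr_ge0 ?powR_ge0.
- by apply: measurable_funeM; apply/measurable_EFinP; apply: measurable_funTS; exact: measurable_funX.
- apply/measurable_EFinP; apply: measurable_funM => //.
  by apply: measurable_funTS; exact: measurable_powR.
- move=> t /=; rewrite in_itv/= => /andP[t0 _]; rewrite -!EFinM lee_fin.
  by rewrite addrAC subrr add0r relax_e_bound.
Qed.

(** At [g = 1/a] the bound [t^(- a * g)] is [1/t], not integrable at 0. Time is split at the
    relaxation scale [s = lam^(- 1/a)]: before it [e <= 1] costs [lam^g * s = 1], after it the decay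
    with exponent 2 is integrable up to infinity because [2 * a > 1]. *)
Lemma L2_relaxation_supercritical : 2^-1 < a ->
  ((lam `^ a^-1)%:E * \int[mu]_(t in `]0%R, T[) (e t ^+ 2)%:E <=
   (1 + Num.max 1 (Gamma (a + 1)) ^+ 2 / (2 * a - 1))%:E)%E.
Proof.
move=> ha; set M := Num.max _ _.
have b1 : 0 < 2 * a - 1 by lra.
pose g := a^-1; pose s := lam `^ (- g).
have s0 : 0 < s by exact: powR_gt0.
have me2 : measurable_fun [set: R] (fun t => ((lam `^ g)%:E * (e t ^+ 2)%:E)%E).
  by apply: measurable_funeM; apply/measurable_EFinP; exact: measurable_funX.
have f0 t : (0 <= (lam `^ g)%:E * (e t ^+ 2)%:E)%E.
  by rewrite -EFinM lee_fin mulr_ge0 ?sqr_ge0 ?powR_ge0.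
rewrite -ge0_integralZl; last 4 first.
- exact: measurable_itv.
- by apply/measurable_EFinP; apply: measurable_funTS; exact: measurable_funX.
- by move=> t _; rewrite lee_fin sqr_ge0.
- by rewrite lee_fin powR_ge0.
have first_part : (\int[mu]_(t in `]0%R, s[) ((lam `^ g)%:E * (e t ^+ 2)%:E) <= 1)%E.
  apply: (@le_trans _ _ (\int[mu]_(t in `]0%R, s[) (cst (lam `^ g)%:E) t)%E).
    apply: ge0_le_integral; first exact: measurable_itv.
    - by move=> t _; exact: f0.
    - exact: measurable_funTS.
    - exact: measurable_cst.
    - by move=> t _; rewrite -EFinM lee_fin ler_piMr ?powR_ge0// expr_le1.
  rewrite integral_cst//= lebesgue_measure_itv/= lte_fin s0 -EFinB subr0 -EFinM lee_fin /s.
  by rewrite -gt0_powRD// subrr powRr0.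
have dec t : 0 < t -> lam `^ g * e t ^+ 2 <= lam `^ (g - 2) * M ^+ 2 * t `^ (1 - 2 * a - 1).
  move=> t0; have := relax_e_bound (ler0n _ 2) (lexx _) t0; rewrite -/M.
  rewrite (_ : - (a * 2%:R) = 1 - 2 * a - 1); last by ring.
  move=> /(ler_wpM2l (powR_ge0 lam (g - 2))); rewrite mulrA -gt0_powRD// subrK => /le_trans; apply.
  by rewrite mulrA.
have second_part : (\int[mu]_(t in `[s, +oo[) ((lam `^ g)%:E * (e t ^+ 2)%:E) <= (M ^+ 2 / (2 * a - 1))%:E)%E.
  have mP : measurable_fun [set: R] (fun t : R => (lam `^ (g - 2) * M ^+ 2 * t `^ (1 - 2 * a - 1))%:E).
    by apply/measurable_EFinP; apply: measurable_funM => //; exact: measurable_powR.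
  pose F n := [set` `[s, (s + n.+1%:R)%R]].
  have UF : \bigcup_n F n = [set` `[s, +oo[].
    apply/seteqP; split => [x [i _]|x]; rewrite /F /= !in_itv /= ?andbT.
      by case/andP.
    move=> sx; exists (Num.truncn (x - s)) => //=; rewrite in_itv/= sx/= -lerBlDl.
    exact: ltW (truncnS_gt _).
  rewrite -UF.
  have cvF : (\int[mu]_(t in F i) ((lam `^ g)%:E * (e t ^+ 2)%:E))%E @[i --> \oo] -->
         (\int[mu]_(t in \bigcup_i F i) ((lam `^ g)%:E * (e t ^+ 2)%:E))%E.
    apply: ge0_nondecreasing_set_cvg_integral.
    - move=> n m nm; rewrite subsetEset => x; rewrite /F /= !in_itv/= => /andP[-> /=].
      by move=> /le_trans; apply; rewrite lerD2l ler_nat.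
    - by move=> i; exact: measurable_itv.
    - by move=> i; exact: measurable_funTS.
    - by move=> i x _; exact: f0.
  rewrite -(cvg_lim _ cvF)//; apply: lime_le; first by apply/cvg_ex; eexists; exact: cvF.
  apply: nearW => n; rewrite /F.
  apply: (@le_trans _ _ (\int[mu]_(t in `[s, (s + n.+1%:R)%R]) ((lam `^ (g - 2) * M ^+ 2)%:E * (t `^ (1 - 2 * a - 1))%:E))%E).
    apply: ge0_le_integral; first exact: measurable_itv.
    - by move=> t _; exact: f0.
    - exact: measurable_funTS.
    - exact: measurable_funTS.
    - move=> t /=; rewrite in_itv/= => /andP[st _]; rewrite -!EFinM lee_fin.
      by apply: dec; exact: lt_le_trans st.
  rewrite ge0_integralZl; last 4 first.
  - exact: measurable_itv.
  - by apply/measurable_EFinP; apply: measurable_funTS; exact: measurable_powR.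
  - by move=> t _; rewrite lee_fin powR_ge0.
  - by rewrite lee_fin mulr_ge0 ?powR_ge0 ?sqr_ge0.
  rewrite integral_powR_itv ?ltrDl//; last by rewrite lt_eqF//; lra.
  rewrite -EFinM lee_fin.
  apply: (@le_trans _ _ (lam `^ (g - 2) * M ^+ 2 * (s `^ (1 - 2 * a) / (2 * a - 1)))).
    apply: ler_wpM2l; first exact: mulr_ge0 (powR_ge0 _ _) (sqr_ge0 _).
    rewrite -(opprB (2 * a) 1) invrN !mulrN opprK addrC lerBlDr lerDl.
    by rewrite divr_ge0 ?powR_ge0// ltW.
  rewrite /s -powRrM le_eqVlt; apply/orP; left; apply/eqP.
  rewrite [LHS](_ : _ = lam `^ (g - 2) * lam `^ (- g * (1 - 2 * a)) * (M ^+ 2 / (2 * a - 1))); last by ring.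
  rewrite -gt0_powRD// (_ : g - 2 + - g * (1 - 2 * a) = 0) ?powRr0 ?mul1r//.
  by rewrite /g; field; rewrite gt_eqF.
have sub : (`]0, T[ : set (measurableTypeR R)) `<=` `]0, s[ `|` `[s, +oo[.
  move=> t /=; rewrite !in_itv/= andbT => /andP[-> _] /=.
  by have [ts|st] := ltP t s; [left|right].
apply: (@le_trans _ _
    (\int[mu]_(t in `]0%R, s[ `|` `[s, +oo[) ((lam `^ g)%:E * (e t ^+ 2)%:E))%E).
  apply: ge0_subset_integral sub.
  - exact: measurable_itv.
  - by apply: measurableU; exact: measurable_itv.
  - exact: measurable_funTS.
  - by move=> t _; exact: f0.
rewrite ge0_integral_setU; last 5 first.
- exact: measurable_itv.
- exact: measurable_itv.
- exact: measurable_funTS.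
- by move=> t _; exact: f0.
- apply/disj_setPS => t [] /=; rewrite !in_itv/= andbT => /andP[_ ts] st.
  by move: (lt_le_trans ts st); rewrite ltxx.
by rewrite EFinD; apply: leeD.
Qed.

End fixed_parameter.

End Mittag_Leffler_estimates.

(** * Pre-Hilbert spaces *)

Lemma nneseries_lty_cvg (R : realType) (u : nat -> R) : (forall n, 0 <= u n) ->
  (\sum_(0 <= k <oo) (u k)%:E < +oo)%E -> cvgn (series u).
Proof.
move=> u0 uoo; apply: nondecreasing_is_cvgn.
  by apply: nondecreasing_series => n _ _.
have u1 k : xpredT k -> (0 <= (u k)%:E)%E by move=> _; rewrite lee_fin.
exists (fine (\sum_(0 <= k <oo) (u k)%:E)) => _ [n _ <-].
rewrite -lee_fin fineK; last first.
  by rewrite ge0_fin_numE//; apply: nneseries_ge0 => k _; exact: u1.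
rewrite /series/= -sumEFin; apply: nneseries_lim_ge => k _ _; exact: u1.
Qed.

Section prehilbert_theory.
Context {R : realType} {V : lmodType R}.
Variable X : hilbert V.

(** The axioms that [hilbert] leaves out, relative to [hdom]. Definiteness is absent because vectors
    represent classes of functions; equalities of vectors give way to equalities of inner
    products. *)
Record prehilbert : Prop := Prehilbert {
  ph_dom0 : hdom X 0;
  ph_domP : forall (a : R) v w, hdom X v -> hdom X w -> hdom X (a *: v + w);
  ph_sym : forall v w, hdom X v -> hdom X w -> hip X v w = hip X w v;
  ph_lin : forall (a : R) u v w, hdom X u -> hdom X v -> hdom X w ->
    hip X (a *: u + v) w = a * hip X u w + hip X v w;
  ph_ge0 : forall v, hdom X v -> 0 <= hip X v v }.

Hypothesis hX : prehilbert.

Lemma ph_domZ (a : R) v : hdom X v -> hdom X (a *: v).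
Proof. by move=> hv; rewrite -[_ *: _]addr0; apply: ph_domP => //; exact: ph_dom0. Qed.

Lemma ph_domD v w : hdom X v -> hdom X w -> hdom X (v + w).
Proof. by move=> hv hw; rewrite -[v]scale1r; exact: ph_domP. Qed.

Lemma ph_domB v w : hdom X v -> hdom X w -> hdom X (v - w).
Proof. by move=> hv hw; rewrite -scaleN1r addrC; exact: ph_domP. Qed.

Lemma ph_dom_sum (I : Type) (r : seq I) (f : I -> V) :
  (forall i, hdom X (f i)) -> hdom X (\sum_(i <- r) f i).
Proof.
move=> hf; elim: r => [|i r IH]; first by rewrite big_nil; exact: ph_dom0.
by rewrite big_cons; exact: ph_domD.
Qed.

Lemma hipDl u v w : hdom X u -> hdom X v -> hdom X w ->
  hip X (u + v) w = hip X u w + hip X v w.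
Proof. by move=> hu hv hw; rewrite -[u]scale1r ph_lin// mul1r scale1r. Qed.

Lemma hip0l w : hdom X w -> hip X 0 w = 0.
Proof.
move=> hw; have h0 := ph_dom0 hX; have := hipDl h0 h0 hw.
by rewrite addr0 => /eqP; rewrite -subr_eq0 opprD addrA subrr sub0r oppr_eq0 => /eqP.
Qed.

Lemma hipZl a u w : hdom X u -> hdom X w -> hip X (a *: u) w = a * hip X u w.
Proof.
move=> hu hw; rewrite -[a *: u]addr0 ph_lin//; last exact: ph_dom0.
by rewrite hip0l// addr0.
Qed.

Lemma hipBl u v w : hdom X u -> hdom X v -> hdom X w ->
  hip X (u - v) w = hip X u w - hip X v w.
Proof.
by move=> hu hv hw; rewrite -scaleN1r addrC ph_lin// mulN1r addrC.
Qed.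

Lemma hip_suml (I : Type) (r : seq I) (f : I -> V) w : (forall i, hdom X (f i)) ->
  hdom X w -> hip X (\sum_(i <- r) f i) w = \sum_(i <- r) hip X (f i) w.
Proof.
move=> hf hw; elim: r => [|i r IH]; first by rewrite !big_nil hip0l.
by rewrite !big_cons hipDl ?IH//; exact: ph_dom_sum.
Qed.

Lemma hipDr u v w : hdom X u -> hdom X v -> hdom X w ->
  hip X w (u + v) = hip X w u + hip X w v.
Proof.
move=> hu hv hw; rewrite ph_sym ?hipDl//; last exact: ph_domD.
by rewrite (ph_sym hX hu hw) (ph_sym hX hv hw).
Qed.

Lemma hipZr a u w : hdom X u -> hdom X w -> hip X w (a *: u) = a * hip X w u.
Proof.
move=> hu hw; rewrite ph_sym ?hipZl//; last exact: ph_domZ.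
by rewrite (ph_sym hX hu hw).
Qed.

Lemma hipBr u v w : hdom X u -> hdom X v -> hdom X w ->
  hip X w (u - v) = hip X w u - hip X w v.
Proof.
move=> hu hv hw; rewrite ph_sym ?hipBl//; last exact: ph_domB.
by rewrite (ph_sym hX hu hw) (ph_sym hX hv hw).
Qed.

Lemma hip_sumr (I : Type) (r : seq I) (f : I -> V) w : (forall i, hdom X (f i)) ->
  hdom X w -> hip X w (\sum_(i <- r) f i) = \sum_(i <- r) hip X w (f i).
Proof.
move=> hf hw; rewrite ph_sym ?hip_suml//; last exact: ph_dom_sum.
by apply: eq_bigr => i _; rewrite ph_sym.
Qed.

Lemma hnorm_sqr v : hdom X v -> hnorm X v ^+ 2 = hip X v v.
Proof. by move=> hv; rewrite /hnorm sqr_sqrtr ?ph_ge0. Qed.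

Lemma hnorm_ge0 v : 0 <= hnorm X v.
Proof. exact: sqrtr_ge0. Qed.

Lemma hnorm0 : hnorm X 0 = 0.
Proof. by rewrite /hnorm hip0l ?sqrtr0//; exact: ph_dom0. Qed.

Lemma hip_expand (a : R) u v : hdom X u -> hdom X v ->
  hip X (a *: u - v) (a *: u - v) = a ^+ 2 * hip X u u - 2 * a * hip X u v + hip X v v.
Proof.
move=> hu hv; have hau := ph_domZ a hu; have hw := ph_domB hau hv.
rewrite hipBl// !hipBr// !hipZl// !hipZr// (ph_sym hX hv hu); ring.
Qed.

Lemma Cauchy_Schwarz_sqr u v : hdom X u -> hdom X v ->
  hip X u v ^+ 2 <= hip X u u * hip X v v.
Proof.
move=> hu hv; have H a : 0 <= a ^+ 2 * hip X u u - 2 * a * hip X u v + hip X v v.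
  by rewrite -hip_expand// ph_ge0//; apply: ph_domB => //; exact: ph_domZ.
have uu := ph_ge0 hX hu; have vv := ph_ge0 hX hv.
move: H uu vv; move: (hip X u u) (hip X u v) (hip X v v) => A B C H A0 C0.
have [A00|Ap] := eqVneq A 0.
  have [->|B0] := eqVneq B 0; first by rewrite A00 mul0r expr0n.
  (* In a semidefinite space [A = 0] is possible; at this argument the polynomial, then affine,
     takes the value [-1]. *)
  have := H ((C + 1) / (2 * B)); rewrite A00 mulr0 sub0r.
  rewrite (_ : 2 * ((C + 1) / (2 * B)) * B = C + 1); last by field.
  by move=> ?; exfalso; lra.
have A_gt0 : 0 < A by rewrite lt_neqAle eq_sym Ap.
have := H (B / A); rewrite -(pmulr_rge0 _ A_gt0).
rewrite (_ : A * ((B / A) ^+ 2 * A - 2 * (B / A) * B + C) = A * C - B ^+ 2);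
  last by field.
by rewrite subr_ge0.
Qed.

Lemma Cauchy_Schwarz u v : hdom X u -> hdom X v ->
  `|hip X u v| <= hnorm X u * hnorm X v.
Proof.
move=> hu hv; rewrite -(@ler_pXn2r _ 2)// ?nnegrE ?mulr_ge0 ?hnorm_ge0//.
by rewrite real_normK ?num_real// exprMn !hnorm_sqr// Cauchy_Schwarz_sqr.
Qed.

Lemma hnorm_triangle u v : hdom X u -> hdom X v -> hnorm X (u + v) <= hnorm X u + hnorm X v.
Proof.
move=> hu hv; rewrite -(@ler_pXn2r _ 2)// ?nnegrE ?addr_ge0 ?hnorm_ge0//.
have huv := ph_domD hu hv.
rewrite hnorm_sqr// hipDl// !hipDr// (ph_sym hX hv hu).
have := Cauchy_Schwarz hu hv; have := ler_norm (hip X u v).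
rewrite sqrrD !hnorm_sqr// => h1 h2; rewrite mulr2n; lra.
Qed.

Lemma hnormZ a u : hdom X u -> hnorm X (a *: u) = `|a| * hnorm X u.
Proof.
move=> hu; rewrite /hnorm hipZl ?hipZr//; last exact: ph_domZ.
by rewrite mulrA -expr2 sqrtrM ?sqr_ge0// sqrtr_sqr.
Qed.

Lemma hnormB_le u v : hdom X u -> hdom X v -> hnorm X (u - v) <= hnorm X u + hnorm X v.
Proof.
move=> hu hv; rewrite -scaleN1r; apply: le_trans (hnorm_triangle hu (ph_domZ _ hv)) _.
by rewrite hnormZ// normrN1 mul1r.
Qed.

(** Polarisation, with the sum written as [u - (-1) *: v]: measurability in [L2time] is given for
    norms of differences [v t - x]. *)
Lemma hip_polar u v : hdom X u -> hdom X v ->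
  hip X u v = 4^-1 * (hnorm X (u - (-1) *: v) ^+ 2 - hnorm X (u - v) ^+ 2).
Proof.
move=> hu hv; have hNv := ph_domZ (-1) hv.
rewrite !hnorm_sqr; try exact: ph_domB.
have h1 : hdom X (u - v) by exact: ph_domB.
have h2 : hdom X (u - (-1) *: v) by exact: ph_domB.
by rewrite !(hipBl, hipBr)// !(hipZl, hipZr)// (ph_sym hX hv hu); field.
Qed.

Lemma hip_cvg (f : nat -> V) s w : (forall n, hdom X (f n)) -> hdom X s -> hdom X w ->
  (fun n => hnorm X (s - f n)) @ \oo --> (0 : R) ->
  (fun n => hip X (f n) w) @ \oo --> hip X s w.
Proof.
move=> hf hs hw cs.
rewrite (_ : (fun n => _) = fun n => hip X s w - hip X (s - f n) w); last first.
  by apply/funext => n; rewrite hipBl// opprB addrC subrK.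
rewrite -[X in _ --> X]subr0; apply: cvgB; first exact: cvg_cst.
apply/norm_cvg0P.
apply: (@squeeze_cvgr _ _ _ _ (cst 0) (fun n => hnorm X (s - f n) * hnorm X w)).
- apply: nearW => n; rewrite normr_ge0/=; apply: Cauchy_Schwarz => //.
  exact: (ph_domB hs (hf n)).
- exact: cvg_cst.
- rewrite -[X in _ --> X](mul0r (hnorm X w)); apply: cvgM => //; exact: cvg_cst.
Qed.

Lemma hsum_hip (a : nat -> V) s w : (forall n, hdom X (a n)) -> hdom X w ->
  hsum X a s -> series (fun n => hip X (a n) w) @ \oo --> hip X s w.
Proof.
move=> ha hw [hs cs].
have hS N : hdom X (\sum_(n < N) a n) by exact: ph_dom_sum.
rewrite (_ : series _ = fun N => hip X (\sum_(n < N) a n) w); first exact: hip_cvg.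
by apply/funext => N; rewrite hip_suml// /series/= big_mkord.
Qed.

End prehilbert_theory.

Section L2_space.
Context {R : realType} {d : nat}.
Variable Omega : set 'rV[R]_d.
Hypothesis mO : measurable Omega.
Local Notation mu := (@lebesgue_rV R d).
Local Notation L2 := (L2 Omega).
Local Notation ip := (ip Omega).

Lemma L2_integrableM f g : L2 f -> L2 g -> mu.-integrable Omega (EFin \o (fun x => f x * g x)).
Proof.
move=> [mf f2] [mg g2].
have s2 := integrableD mO f2 g2.
apply: (le_integrable mO _ _ s2).
  by apply/measurable_EFinP; exact: measurable_funM.
move=> x _ /=; rewrite lee_fin [leRHS]ger0_norm ?addr_ge0 ?sqr_ge0//.
rewrite -subr_ge0 normrM; have := sqr_ge0 (`|f x| - `|g x|).
have := real_normK (num_real (f x)); have := real_normK (num_real (g x)) => <- <-.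
have := mulr_ge0 (normr_ge0 (f x)) (normr_ge0 (g x)).
by rewrite sqrrB mulr2n; lra.
Qed.

Lemma L2P (a : R) f g : L2 f -> L2 g -> L2 (a *: f + g).
Proof.
move=> hf hg; have [mf f2] := hf; have [mg g2] := hg.
have m : measurable_fun Omega (a *: f + g).
  by apply: measurable_funD mg; exact: measurable_funM (measurable_cst a) mf.
split => //.
have i1 := integrableMl_cst (2 * a ^+ 2) mO f2.
have i2 := integrableMl_cst 2 mO g2.
apply: (le_integrable mO _ _ (integrableD mO i1 i2)).
  by apply/measurable_EFinP; exact: measurable_funX.
have a2 : 0 <= 2 * a ^+ 2 by exact: mulr_ge0 (sqr_ge0 _).
move=> x _ /=; rewrite lee_fin !ger0_norm ?sqr_ge0//; last first.
  by apply: addr_ge0; apply: mulr_ge0 => //; exact: sqr_ge0.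
rewrite -subr_ge0 [X in 0 <= X](_ : _ = (a * f x - g x) ^+ 2) ?sqr_ge0//.
rewrite -[(a *: f + g) x]/(a * f x + g x); ring.
Qed.

Lemma L20 : L2 0.
Proof.
split; first exact: measurable_cst.
apply: (@eq_integrable _ _ _ mu Omega mO (cst 0%E)); last exact: integrable0.
by move=> x _ /=; rewrite expr0n.
Qed.

Lemma ip_lin (a : R) f g h : L2 f -> L2 g -> L2 h ->
  ip (a *: f + g) h = a * ip f h + ip g h.
Proof.
move=> hf hg hh; have i1 := L2_integrableM hf hh; have i2 := L2_integrableM hg hh.
rewrite /ip -RintegralZl// -RintegralD//; last exact: integrableMl_cst.
by apply: eq_Rintegral => x _; rewrite -[(a *: f + g) x]/(a * f x + g x); ring.
Qed.

Lemma ipC f g : ip f g = ip g f.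
Proof. by rewrite /ip; apply: eq_Rintegral => x _; rewrite mulrC. Qed.

Lemma ip_ge0 f : 0 <= ip f f.
Proof. by apply: Rintegral_ge0 => x _; rewrite -expr2 sqr_ge0. Qed.

Lemma L2_prehilbert phi : prehilbert (L2_hilbert Omega phi).
Proof.
split.
- exact: L20.
- exact: L2P.
- by move=> f g _ _; exact: ipC.
- by move=> a f g h; exact: ip_lin.
- by move=> f _; exact: ip_ge0.
Qed.

Lemma L2_eintegral f : L2 f ->
  (\int[mu]_(x in Omega) (f x ^+ 2)%:E = (L2norm Omega f ^+ 2)%:E)%E.
Proof.
move=> hf; rewrite /L2norm sqr_sqrtr ?ip_ge0// /ip /Rintegral fineK//.
exact: integrable_fin_num (L2_integrableM hf hf).
Qed.

Lemma L2_of_lty (f : 'rV[R]_d -> R) : measurable_fun Omega f ->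
  (\int[mu]_(x in Omega) (f x ^+ 2)%:E < +oo)%E -> L2 f.
Proof.
move=> mf foo; split => //; apply: ge0_integrable => //.
  exact: measurable_funX.
by move=> x _; exact: sqr_ge0.
Qed.

End L2_space.

Section orthonormal_series.
Context {R : realType} {V : lmodType R}.
Variable X : hilbert V.
Hypothesis hX : prehilbert X.

Definition complete_hilbert : Prop := forall f : nat -> V,
  (forall n, hdom X (f n)) ->
  (forall e : R, 0 < e -> exists N, forall m n, (N <= n)%N -> (n <= m)%N ->
     hnorm X (f m - f n) <= e) ->
  exists2 s, hdom X s & (fun n => hnorm X (s - f n)) @ \oo --> (0 : R).

Variable g : nat -> V.
Hypothesis g_dom : forall n, hdom X (g n).
Hypothesis g_orth : forall m n, hip X (g m) (g n) = (m == n)%:R.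

Let Sdom (a : nat -> R) m n : hdom X (\sum_(m <= i < n) a i *: g i).
Proof. by apply: (ph_dom_sum hX) => i; exact: (ph_domZ hX). Qed.

Let Sdom_ord (a : nat -> R) n : hdom X (\sum_(i < n) a i *: g i).
Proof. by apply: (ph_dom_sum hX) => i; exact: (ph_domZ hX). Qed.

Lemma hip_orthonormal_sum (a : nat -> R) m n j :
  hip X (\sum_(m <= i < n) a i *: g i) (g j) = if (m <= j < n)%N then a j else 0.
Proof.
rewrite (hip_suml hX) => [|i|//]; last exact: (ph_domZ hX).
under eq_bigr do rewrite (hipZl hX)// g_orth.
case: ifP => [jmn|/negbT jmn].
  rewrite (bigD1_seq j) ?mem_index_iota ?iota_uniq//= eqxx mulr1.
  by rewrite big1 ?addr0// => i /negbTE ->; rewrite mulr0.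
rewrite big_nat_cond big1// => i /andP[imn _]; have [ij|] := eqVneq i j.
  by move: imn; rewrite ij (negbTE jmn).
by rewrite mulr0.
Qed.

Lemma hnorm_orthonormal_sum (a : nat -> R) m n :
  hnorm X (\sum_(m <= i < n) a i *: g i) ^+ 2 = \sum_(m <= i < n) a i ^+ 2.
Proof.
rewrite (hnorm_sqr hX)// (hip_sumr hX)//; last by move=> i; exact: (ph_domZ hX).
apply: eq_big_nat => i imn.
by rewrite (hipZr hX)// hip_orthonormal_sum imn expr2.
Qed.

Lemma Bessel_sum v n : hdom X v -> \sum_(i < n) hip X v (g i) ^+ 2 <= hip X v v.
Proof.
move=> hv; pose a i := hip X v (g i); pose s := \sum_(0 <= i < n) a i *: g i.
have hs : hdom X s by exact: Sdom.
have vs : hip X v s = \sum_(0 <= i < n) a i ^+ 2.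
  rewrite /s (hip_sumr hX)//; last by move=> i; exact: (ph_domZ hX).
  by apply: eq_bigr => i _; rewrite (hipZr hX)// expr2.
have ss := hnorm_orthonormal_sum a 0 n; rewrite -/s (hnorm_sqr hX)// in ss.
have := ph_ge0 hX (ph_domB hX hv hs).
rewrite (hipBl hX)//; last exact: (ph_domB hX).
rewrite !(hipBr hX)// (ph_sym hX hs hv) vs ss subrr subr0 subr_ge0.
by rewrite big_mkord.
Qed.

Lemma Bessel_cvg v : hdom X v -> cvgn (series (fun n => hip X v (g n) ^+ 2)).
Proof.
move=> hv; apply: nondecreasing_is_cvgn.
  apply: nondecreasing_series => n _ _; exact: sqr_ge0.
exists (hip X v v) => _ [n _ <-]; rewrite /series/= big_mkord; exact: Bessel_sum.
Qed.

Lemma Bessel v : hdom X v ->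
  (\sum_(n <oo) (hip X v (g n) ^+ 2)%:E <= (hip X v v)%:E)%E.
Proof.
move=> hv; apply: lime_le.
  by apply: is_cvg_nneseries => n _ _; rewrite lee_fin sqr_ge0.
by apply: nearW => n; rewrite sumEFin lee_fin big_mkord Bessel_sum.
Qed.

Lemma hsum_coef (a : nat -> R) s n : hsum X (fun n => a n *: g n) s ->
  hip X s (g n) = a n.
Proof.
move=> hs; have h i : hdom X (a i *: g i) by exact: (ph_domZ hX).
have /cvg_lim <- // := hsum_hip hX h (g_dom n) hs.
apply: lim_near_cst => //; exists n.+1 => // k /= nk; apply/eqP.
rewrite /series/= -(hip_suml hX)// hip_orthonormal_sum/= nk //.
Qed.

Lemma hsum_series (a : nat -> R) s w : hdom X w -> hsum X (fun n => a n *: g n) s ->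
  series (fun n => a n * hip X (g n) w) @ \oo --> hip X s w.
Proof.
move=> hw hs; have h i : hdom X (a i *: g i) by exact: (ph_domZ hX).
have := hsum_hip hX h hw hs.
by under eq_fun do rewrite (hipZl hX)//.
Qed.

Lemma Parseval (a : nat -> R) s : hsum X (fun n => a n *: g n) s ->
  series (fun n => a n ^+ 2) @ \oo --> hnorm X s ^+ 2.
Proof.
move=> hs; have := hsum_series (proj1 hs) hs.
have [hs1 _] := hs; rewrite (hnorm_sqr hX)//.
rewrite (_ : (fun n => a n * hip X (g n) s) = fun n => a n ^+ 2)//.
by apply/funext => n; rewrite (ph_sym hX)// (hsum_coef n hs).
Qed.

(** Riesz-Fischer: by orthonormality the squared norm of a block of the vector series is the same
    block of the series of squares, so the partial sums are Cauchy. *)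
Lemma hsum_exists (a : nat -> R) : complete_hilbert ->
  cvgn (series (fun n => a n ^+ 2)) -> exists s, hsum X (fun n => a n *: g n) s.
Proof.
move=> cX ca.
have [||s hs cs] := cX (fun N => \sum_(n < N) a n *: g n).
- exact: Sdom_ord.
- move=> e e0; move/cauchy_cvgP : ca => /cauchy_seriesP /(_ (e ^+ 2)).
  rewrite exprn_gt0// => /(_ isT) [[A B] [[N1 _ HA] [N2 _ HB]] AB].
  exists (maxn N1 N2) => m n Nn nm.
  have -> : \sum_(i < m) a i *: g i - \sum_(i < n) a i *: g i = \sum_(n <= i < m) a i *: g i.
    by rewrite -!(big_mkord xpredT (fun i => a i *: g i)) (big_cat_nat (leq0n n) nm)/= addrAC subrr add0r.
  rewrite -(@ler_pXn2r _ 2)// ?nnegrE ?hnorm_ge0 ?(ltW e0)//.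
  rewrite hnorm_orthonormal_sum; apply: le_trans (ler_norm _) _; apply: ltW.
  apply: (AB (n, m)); split => /=.
    by apply: HA => /=; apply: leq_trans Nn; rewrite leq_maxl.
  by apply: HB => /=; apply: leq_trans nm; apply: leq_trans Nn; rewrite leq_maxr.
by exists s.
Qed.

End orthonormal_series.

(** * Completeness of L^2 *)

Section L2_complete.
Context {R : realType} {d : nat}.
Variable Omega : set 'rV[R]_d.
Hypothesis mO : measurable Omega.
Variable phi : nat -> 'rV[R]_d -> R.
Local Notation mu := (@lebesgue_rV R d).
Local Notation L2 := (L2 Omega).
Local Notation X := (L2_hilbert Omega phi).

Let hX := L2_prehilbert mO phi.

Let geo (k : nat) : R := 2^-1 ^+ k.

Let geo_gt0 k : 0 < geo k.
Proof. by rewrite exprn_gt0// invr_gt0. Qed.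

Let geo_cvg : series geo @ \oo --> (2 : R).
Proof.
have := @cvg_geometric_series R 1 2^-1.
rewrite (_ : 1 / (1 - 2^-1) = 2); last by field.
rewrite (_ : geometric 1 2^-1 = geo); last by apply/funext => k; rewrite /geometric/= mul1r.
by apply; rewrite ger0_norm; lra.
Qed.

(* The weights [2^k] make the squares of the increments summable a.e., and
   [|x| <= (2^-k + 2^k x^2) / 2] turns this into absolute convergence. *)
Let fast_Cauchy_limit (f : nat -> 'rV[R]_d -> R) :
  (forall n, L2 (f n)) ->
  (forall k, hnorm X (f k.+1 - f k) <= geo k) ->
  exists2 s, L2 s & forall k (e : R),
    (forall m, (k <= m)%N -> hnorm X (f m - f k) <= e) -> hnorm X (s - f k) <= e.
Proof.
move=> hf df; have mf n : measurable_fun Omega (f n) by case: (hf n).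
pose D k x : R := (geo k)^-1 * (f k.+1 x - f k x) ^+ 2.
have hB m n : L2 (f m - f n) by exact: (ph_domB hX (hf m) (hf n)).
have hD k : L2 (f k.+1 - f k) by exact: hB.
have D0 k x : 0 <= D k x by rewrite mulr_ge0 ?sqr_ge0// invr_ge0 ltW.
have mD k : measurable_fun Omega (EFin \o D k).
  apply/measurable_EFinP; apply: measurable_funM => //.
  by apply: measurable_funX; exact: measurable_funB.
pose G x := (\sum_(k <oo) (D k x)%:E)%E.
have G0 x : (0 <= G x)%E by apply: nneseries_ge0 => k _ _; rewrite lee_fin.
have mG : measurable_fun Omega G.
  by apply: ge0_emeasurable_sum => [k x _ _|k _]; [rewrite lee_fin|exact: mD].
have Goo : (\int[mu]_(x in Omega) G x <= 2%:E)%E.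
  rewrite integral_nneseries//; last by move=> k x _; rewrite lee_fin.
  apply: (@le_trans _ _ (\sum_(k <oo) (geo k)%:E)%E); last first.
    have -> : (2%:E = limn (EFin \o series geo))%E.
      by apply/esym/cvg_lim => //; apply: cvg_EFin geo_cvg; exact: nearW.
    apply: lee_lim.
    - by apply: is_cvg_nneseries => k _ _; rewrite lee_fin ltW.
    - by apply/cvg_ex; exists 2%:E; apply: cvg_EFin geo_cvg; exact: nearW.
    by apply: nearW => n; rewrite sumEFin.
  apply: lee_nneseries => [k _ _|k _]; first by apply: integral_ge0 => x _; rewrite lee_fin.
  under eq_integral do rewrite EFinM.
  rewrite ge0_integralZl//; last 3 first.
  - apply/measurable_EFinP; apply: measurable_funX; exact: measurable_funB.
  - by move=> x _; rewrite lee_fin sqr_ge0.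
  - by rewrite lee_fin invr_ge0 ltW.
  rewrite (L2_eintegral mO (hD k)) -EFinM lee_fin ler_pdivrMl// -expr2.
  by apply: lerXn2r; rewrite ?nnegrE; [exact: (hnorm_ge0 X _)|exact: ltW|exact: df].
have iG : mu.-integrable Omega G.
  apply/integrableP; split => //; under eq_integral do rewrite gee0_abs//.
  by apply: le_lt_trans Goo _; rewrite ltry.
have [N [mN N0 HN]] := integrable_ae mO iG.
(* Off the null set [N] the sum [G] is finite, which makes [f n x] convergent; the limit is extended
   by 0. *)
pose A := Omega `\` N; have mA : measurable A by exact: measurableD.
have AO : A `<=` Omega by move=> x [].
have fA n : measurable_fun A (f n) by exact: measurable_funS (mf n).
have cf x : A x -> cvgn (f ^~ x).
  move=> [Ox nNx]; have Gx : G x \is a fin_num.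
    by apply: contrapT => Gx; apply: nNx; apply: HN => /= /(_ Ox).
  have cD : cvgn (series (fun k => D k x)).
    by apply: nneseries_lty_cvg => //; move: Gx; rewrite ge0_fin_numE//; exact: G0.
  suff : cvgn (series (fun k => f k.+1 x - f k x)).
    rewrite (_ : series _ = fun n => f n x - f 0%N x); last first.
      by apply/funext => n; rewrite /series/= telescope_sumr.
    move=> c; rewrite (_ : f ^~ x = fun n => (f n x - f 0%N x) + f 0%N x); last first.
      by apply/funext => n; rewrite subrK.
    by apply: is_cvgD => //; exact: is_cvg_cst.
  apply: normed_cvg.
  apply: (@series_le_cvg _ _ (fun k => 2^-1 * (geo k + D k x))).
  - by move=> k; exact: normr_ge0.
  - by move=> k; rewrite mulr_ge0 ?addr_ge0 ?(ltW (geo_gt0 k))// invr_ge0.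
  - move=> k; rewrite /D -[leLHS]/(`|f k.+1 x - f k x|); have := geo_gt0 k; move: (geo k) (f k.+1 x - f k x) => q y q0.
    rewrite -subr_ge0 (_ : _ - _ = (2 * q)^-1 * (q - `|y|) ^+ 2); last first.
      by rewrite sqrrB real_normK ?num_real//; field; rewrite gt_eqF.
    by rewrite mulr_ge0 ?sqr_ge0// invr_ge0 mulr_ge0// ltW.
  - apply: is_cvg_seriesM; rewrite (_ : series _ = series geo + series (fun k => D k x)).
      by apply: is_cvgD => //; apply/cvg_ex; exists 2.
    by apply/funext => n; rewrite /series/= big_split.
pose s := (fun x => limn (f ^~ x)) \_ A.
have mlimA : measurable_fun A (fun x => limn (f ^~ x)).
  by apply: (measurable_fun_cvg fA) => x Ax; exact: cf.
have ms : measurable_fun Omega s.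
  by apply/(measurable_restrict _ mA mO); rewrite setIidr.
have OA (h : 'rV[R]_d -> \bar R) : measurable_fun Omega h -> (forall x, (0 <= h x)%E) ->
    (\int[mu]_(x in Omega) h x = \int[mu]_(x in A) h x)%E.
  by move=> mh h0; exact: ge0_negligible_integral.
(* Fatou's lemma passes a bound on [f m - f k] to the limit in [m]. *)
have key k (e : R) : (forall m, (k <= m)%N -> hnorm X (f m - f k) <= e) ->
    (\int[mu]_(x in Omega) ((s x - f k x) ^+ 2)%:E <= (e ^+ 2)%:E)%E.
  move=> He; have e0 : 0 <= e by apply: le_trans (hnorm_ge0 _ _) (He k (leqnn k)).
  rewrite OA; last 2 first.
  - by apply/measurable_EFinP; apply: measurable_funX; exact: measurable_funB.
  - by move=> x; rewrite lee_fin sqr_ge0.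
  pose h m x := ((f m x - f k x) ^+ 2)%:E.
  have mh m : measurable_fun Omega (h m).
    by apply/measurable_EFinP; apply: measurable_funX; exact: measurable_funB.
  have h0 m x : (0 <= h m x)%E by rewrite lee_fin sqr_ge0.
  rewrite (@eq_integral _ _ _ mu A (fun x => limn_einf (h ^~ x))); last first.
    move=> x; rewrite inE => Ax; rewrite /s patchE mem_set//.
    have ch : h ^~ x @ \oo --> ((limn (f ^~ x) - f k x) ^+ 2)%:E.
      apply: cvg_EFin; first exact: nearW.
      by apply: (@cvg_comp _ _ _ (fun n => f n x - f k x) (fun y => y ^+ 2)); last exact: exprn_continuous; apply: cvgB; [exact: cf|exact: cvg_cst].
    rewrite is_cvg_limn_einfE; first by apply/esym/cvg_lim.
    by apply/cvg_ex; eexists; exact: ch.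
  have hA m : measurable_fun A (h m) by exact: measurable_funS (mh m).
  apply: le_trans (fatou mu mA hA (fun n x _ => h0 n x)) _.
  rewrite limn_einf_lim; apply: lime_le; first exact: is_cvg_einfs.
  apply: nearW => n; apply: le_trans (ereal_inf_lbound _) _.
    by exists (maxn n k) => //=; exact: leq_maxl.
  rewrite /= -OA// (L2_eintegral mO (hB _ _)).
  rewrite lee_fin; apply: lerXn2r; rewrite ?nnegrE//; first exact: (hnorm_ge0 X _).
  by apply: He; exact: leq_maxr.
have hsB k (e : R) : (forall m, (k <= m)%N -> hnorm X (f m - f k) <= e) -> L2 (s - f k).
  move=> He; apply: L2_of_lty => //; first exact: measurable_funB.
  by apply: le_lt_trans (key k e He) _; rewrite ltry.
(* A rough bound by the sum 2 of the geometric series, which places [s] in L^2. *)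
have b0 m : (0 <= m)%N -> hnorm X (f m - f 0%N) <= 2.
  move=> _; apply: (@le_trans _ _ (series geo m)); last first.
    rewrite -(cvg_lim _ geo_cvg)//; apply: nondecreasing_cvgn_le.
      by apply: nondecreasing_series => k _ _; exact: ltW.
    by apply/cvg_ex; exists 2.
  elim: m => [|m IH]; first by rewrite subrr (hnorm0 hX) /series/= big_geq.
  rewrite (_ : f m.+1 - f 0%N = (f m.+1 - f m) + (f m - f 0%N)); last by rewrite addrA subrK.
  apply: le_trans (hnorm_triangle hX (hB _ _) (hB _ _)) _.
  by rewrite /series/= big_nat_recr//= addrC; exact: lerD.
have hs : L2 s.
  by rewrite -[s](subrK (f 0%N)); exact: (ph_domD hX (hsB _ _ b0) (hf _)).
exists s => // k e He; have e0 : 0 <= e by apply: le_trans (hnorm_ge0 _ _) (He k (leqnn k)).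
rewrite -(@ler_pXn2r _ 2) ?nnegrE ?hnorm_ge0// -lee_fin.
by have := key k e He; rewrite -[X in (X <= _)%E -> _]/(\int[mu]_(x in Omega) (((s - f k) x) ^+ 2)%:E)%E (L2_eintegral mO (hsB _ _ He)).
Qed.

Lemma L2_complete : complete_hilbert X.
Proof.
move=> f hf cf; have hB m n : L2 (f m - f n) by exact: (ph_domB hX (hf m) (hf n)).
have /choice[N HN] : forall k, exists N, forall m n, (N <= n)%N -> (n <= m)%N ->
    hnorm X (f m - f n) <= geo k by move=> k; exact: cf.
(* A strictly increasing subsequence with [p k >= N k], whose increments are therefore bounded by
   [geo k]. *)
pose p k := (\sum_(i < k.+1) (N i).+1)%N.
have p_ge k : (N k <= p k)%N.
  by rewrite /p big_ord_recr/=; apply: leq_trans (leq_addl _ _); exact: leqnSn.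
have p_lt k : (p k < p k.+1)%N by rewrite {2}/p big_ord_recr/= -addn1 leq_add.
have p_mono k m : (k <= m)%N -> (p k <= p m)%N.
  by move=> km; apply: (homo_leq (r := leq) leqnn leq_trans) km => i; exact: ltnW.
have p_idge k : (k <= p k)%N.
  by elim: k => // k IH; exact: leq_ltn_trans IH (p_lt k).
have [||s hs Hs] := @fast_Cauchy_limit (f \o p).
- by move=> n; exact: hf.
- by move=> k; apply: HN => //; exact: ltnW.
exists s => //; apply/cvgr0Pnorm_le => e e0.
have e2 : 0 < e / 2 by rewrite divr_gt0.
have [M HM] := cf _ e2.
exists (p M) => // n /= pMn.
rewrite ger0_norm ?hnorm_ge0//.
have -> : s - f n = (s - f (p M)) - (f n - f (p M)) by rewrite opprB addrA subrK.
have hsM : L2 (s - f (p M)) by exact: (ph_domB hX hs (hf _)).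
apply: le_trans (hnormB_le hX hsM (hB _ _)) _.
rewrite [leRHS]splitr lerD//.
  by apply: Hs => m Mm; apply: HM; [exact: p_idge|exact: p_mono].
by apply: HM => //; exact: p_idge.
Qed.

End L2_complete.

(** * Test functions and weak gradients *)

Section measurable_continuous_rV.
Context {R : realType} {d : nat}.
Local Notation mu := (@lebesgue_rV R d).

(** The sigma-algebra on [R^d] is generated by the coordinates. A continuous function is measurable
    for it as the pointwise limit of its values at the grid point of mesh [1/(k + 1)] below [x], a
    point which takes countably many values. *)
Let grid_index (k : nat) (x : 'rV[R]_d) : 'rV[int]_d :=
  \row_i Num.floor (k.+1%:R * x ord0 i).

Let grid_point (k : nat) (z : 'rV[int]_d) : 'rV[R]_d :=
  \row_i ((z ord0 i)%:~R / k.+1%:R).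

Let grid_cvg (x : 'rV[R]_d) : (fun k => grid_point k (grid_index k x)) @ \oo --> x.
Proof.
apply/cvg_ballP => e e0; near=> k; split => // i j; rewrite ord1 !mxE.
have k0 : 0 < k.+1%:R :> R by [].
have /andP[h1 h2] := floor_itv (k.+1%:R * x ord0 j).
rewrite intrD in h2; set z := Num.floor _ in h1 h2 *.
rewrite /ball/= ger0_norm ?subr_ge0 ?ler_pdivrMr ?[_ * k.+1%:R]mulrC//.
rewrite ltrBlDr -(ltr_pM2l k0) mulrDr mulrCA mulfV ?gt_eqF// mulr1.
apply: lt_le_trans h2 _; rewrite addrC lerD2r -ler_pdivrMr// mul1r.
have ke : k.+1%:R^-1 < e by near: k; exact: near_infty_natSinv_lt (PosNum e0).
by rewrite -[leRHS]invrK lef_pV2 ?posrE ?invr_gt0// ltW.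
Unshelve. all: by end_near. Qed.

Let measurable_grid_index k z : measurable [set x : 'rV[R]_d | grid_index k x = z].
Proof.
rewrite (_ : [set x | _] = \bigcap_(i in [set: 'I_d])
    ((fun x : 'rV[R]_d => k.+1%:R * x ord0 i) @^-1` `[(z ord0 i)%:~R, (z ord0 i + 1)%:~R[)).
  apply: fin_bigcap_measurable => // i _; rewrite -[X in measurable X]setTI.
  have m : measurable_fun [set: 'rV[R]_d] (fun x : 'rV[R]_d => k.+1%:R * x ord0 i).
    by apply: measurable_funM; [exact: measurable_cst|exact: measurable_coord].
  by apply: m => //; exact: measurable_itv.
apply/seteqP; split => [x <- i _ /=|x /= H].
  by rewrite mxE in_itv/= floor_itv.
by apply/rowP => i; rewrite mxE; apply/eqP; rewrite floor_eq; have := H i I; rewrite /= in_itv.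
Qed.

Lemma continuous_measurable_rV (f : 'rV[R]_d -> R) : continuous f ->
  measurable_fun [set: 'rV[R]_d] f.
Proof.
move=> cf; apply: (@measurable_fun_cvg _ _ _ _ (fun k x => f (grid_point k (grid_index k x)))).
  move=> k _ Y mY; rewrite setTI.
  rewrite (_ : _ @^-1` Y = \bigcup_z
    ([set x | grid_index k x = z] `&` [set _ | Y (f (grid_point k z))])).
    apply: countable_bigcupT_measurable; first exact: countableP.
    move=> z; have [Yz|Yz] := pselect (Y (f (grid_point k z))).
      have -> : [set _ : 'rV[R]_d | Y (f (grid_point k z))] = setT by apply/seteqP; split.
      by rewrite setIT; exact: measurable_grid_index.
    have -> : [set _ : 'rV[R]_d | Y (f (grid_point k z))] = set0 by apply/seteqP; split.
    by rewrite setI0.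
  apply/seteqP; split => [x Yx|x [z _ [/= <-]]//]; by exists (grid_index k x).
move=> x _; apply: (@cvg_comp _ _ _ _ f); [exact: grid_cvg|exact: cf].
Qed.

Lemma ler_coord_norm (x : 'rV[R]_d) i : `|x ord0 i| <= `|x|.
Proof.
rewrite -[leRHS]/(mx_norm x) mx_normrE.
exact: (le_bigmax _ (fun ij : 'I_1 * 'I_d => `|x ij.1 ij.2|) (ord0, i)).
Qed.

End measurable_continuous_rV.

Section boxes.
Context {R : realType}.

Definition box_rV n (M : R) : set 'rV[R]_n := [set x | forall i, `|x ord0 i| <= M].

Lemma measurable_box n (M : R) : measurable (@box_rV n M).
Proof.
rewrite (_ : box_rV M = \bigcap_(i in [set: 'I_n]) ((fun x : 'rV[R]_n => x ord0 i) @^-1` `[- M, M])).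
  apply: fin_bigcap_measurable => // i _; rewrite -[X in measurable X]setTI.
  by apply: measurable_coord => //; exact: measurable_itv.
apply/seteqP; split => x /= H i; first by move=> _; rewrite /= in_itv/= -ler_norml.
by have := H i I; rewrite /= in_itv/= -ler_norml.
Qed.

Lemma lebesgue_box_lty n (M : R) : (@lebesgue_rV R n (box_rV M) < +oo)%E.
Proof.
elim: n => [|n IH]; first by rewrite /= diracE ltry.
rewrite [X in (X < _)%E](_ : _ = ((@lebesgue_measure R) \x (@lebesgue_rV R n))%E (`[- M, M] `*` box_rV M)).
  rewrite product_measure1E//; last exact: measurable_box.
  rewrite lte_mul_pinfty// ?measure_ge0//.
  have := @lebesgue_measure_itv R `[- M, M]; rewrite /= => ->.
  by case: ifP => //; rewrite -EFinB.
rewrite /= /lebesgue_rV_step /pushforward; congr (_ _).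
apply/seteqP; split => [[a x] /= H|[a x] /= [Ha Hx] i].
  split => /=.
    by have := H ord0; rewrite mxE unlift_none/= in_itv/= -ler_norml.
  by move=> i; have := H (lift ord0 i); rewrite mxE liftK.
rewrite mxE; case: unliftP => [j _|_] /=; first exact: Hx.
by move: Ha; rewrite in_itv/= -ler_norml.
Qed.

End boxes.

Section space.
Context {R : realType} {d : nat}.
Variable Omega : set 'rV[R]_d.
Local Notation mu := (@lebesgue_rV R d).
Local Notation L2 := (L2 Omega).
Local Notation ip := (ip Omega).

Lemma measurable_convex_polyhedral_domain :
  convex_polyhedral_domain Omega -> measurable Omega.
Proof.
move=> [_ _ [m [A [b ->]]]].
rewrite [X in measurable X](_ : _ = \bigcap_(i in [set: 'I_m])
    ((fun x : 'rV[R]_d => \sum_j A i j * x ord0 j) @^-1` `]-oo, b i[)).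
  apply: fin_bigcap_measurable => // i _; rewrite -[X in measurable X]setTI.
  have mf : measurable_fun [set: 'rV[R]_d] (fun x : 'rV[R]_d => \sum_j A i j * x ord0 j).
    apply: measurable_sum => j; apply: measurable_funM; first exact: measurable_cst.
    exact: measurable_coord.
  by apply: mf => //; exact: measurable_itv.
apply/seteqP; split => x /= H i; first by move=> _; rewrite /= in_itv/=.
by have := H i I; rewrite /= in_itv/=.
Qed.

Hypothesis mO : measurable Omega.

Lemma L2_continuous_compact (f : 'rV[R]_d -> R) (K : set 'rV[R]_d) :
  continuous f -> compact K -> (forall x, ~ K x -> f x = 0) -> L2 f.
Proof.
move=> cf cK fK.
have mf : measurable_fun Omega f.
  exact: measurable_funTS (continuous_measurable_rV cf).
have [M [_ HM]] := compact_bounded cK.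
have [B [_ HB]] : bounded_set (f @` K).
  by apply: compact_bounded; apply: continuous_compact cK; exact: continuous_subspaceT.
pose M' := `|M| + 1; pose B' := `|B| + 1.
have KM x : K x -> box_rV M' x.
  move=> Kx i; apply: le_trans (ler_coord_norm _ _) _; apply: HM => //.
  by rewrite /M' ltr_pwDr// ler_norm.
have fB x : `|f x| <= B'.
  have [Kx|/fK ->] := pselect (K x); last by rewrite normr0 addr_ge0.
  by apply: HB; [rewrite /B' ltr_pwDr// ler_norm|exists x].
have mb := @measurable_box R d M'.
apply: L2_of_lty => //.
apply: (@le_lt_trans _ _ (\int[mu]_(x in Omega `&` box_rV M') (B' ^+ 2)%:E)%E).
  rewrite [leRHS]integral_mkcondr; apply: ge0_le_integral => //.
  - by move=> x _; rewrite lee_fin sqr_ge0.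
  - by apply/measurable_EFinP; exact: measurable_funX.
  - by apply/(measurable_restrict _ mb mO); exact: measurable_cst.
  move=> x _; rewrite patchE; case: ifPn => [_|].
    by rewrite lee_fin -[f x ^+ 2]real_normK ?num_real// lerXn2r// nnegrE// addr_ge0.
  by rewrite notin_setE => Hx; rewrite fK ?expr0n// => /KM.
rewrite integral_cst//; last exact: measurableI.
rewrite lte_mul_pinfty// ?lee_fin ?sqr_ge0//.
apply: (le_lt_trans _ (lebesgue_box_lty d M')); apply: le_measure; rewrite ?inE//.
exact: measurableI.
Qed.

Lemma L2_test_space psi : test_space Omega psi -> L2 psi.
Proof.
move=> [sp [K [cK _ pK]]]; apply: L2_continuous_compact cK pK => x.
exact: differentiable_continuous (sp [::] x).
Qed.

Lemma partial_test_space i psi : test_space Omega psi -> test_space Omega (partial i psi).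
Proof.
move=> [sp [K [cK KO pK]]]; split.
  by move=> s x; have := sp (rcons s i) x; rewrite foldr_rcons.
exists K; split => // x nKx.
have oK : open (~` K) by apply: closed_openC; apply: compact_closed cK; exact: norm_hausdorff.
rewrite /partial (@near_eq_derive _ _ _ _ (cst 0)) ?derive_cst//.
near=> y; apply: pK; near: y.
by apply: open_nbhs_nbhs; split.
Unshelve. all: by end_near. Qed.

End space.

(** * Weak gradients and the gradients of the eigenfunctions *)

Section weak_gradient.
Context {R : realType} {d : nat}.
Variable Omega : set 'rV[R]_d.
Hypothesis mO : measurable Omega.
Variables (phi : nat -> 'rV[R]_d -> R) (lam : nat -> R).
Hypothesis eigen : dirichlet_eigenbasis Omega phi lam.
Local Notation mu := (@lebesgue_rV R d).
Local Notation L2 := (L2 Omega).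
Local Notation ip := (ip Omega).
Local Notation X := (L2_hilbert Omega phi).
Local Notation Y := (L2vec_hilbert Omega phi).
Local Notation wp := (weak_partial Omega).

Let hX := L2_prehilbert mO phi.

Lemma L2_eigen n : L2 (phi n).
Proof. by have [/(_ n)[_ []]] := eigen. Qed.

Lemma eigen_orth m n : ip (phi m) (phi n) = (m == n)%:R.
Proof. by have [_ ->] := eigen. Qed.

Lemma eigen_gt0 n : 0 < lam n.
Proof. by have [_ _ _ _ [-> _ _]] := eigen. Qed.

Lemma eigen_hsum f : L2 f -> hsum X (fun n => ip f (phi n) *: phi n) f.
Proof. by have [_ _ + _ _] := eigen; apply. Qed.

(** Each eigenfunction, being in [H^1_0], is an L^2-limit of test functions, so [g] is orthogonal to
    the whole eigenbasis and Parseval makes its norm 0. This plays the role of the density of test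
    functions in L^2. *)
Lemma orthogonal_test g : L2 g -> (forall psi, test_space Omega psi -> ip g psi = 0) ->
  forall h, L2 h -> ip g h = 0.
Proof.
move=> hg g0 h hh.
have gphi n : ip g (phi n) = 0.
  have [/(_ n)[[_ [psi [tpsi cpsi _]]] _] _ _ _ _] := eigen.
  have tL k : L2 (psi k) by exact: L2_test_space.
  have := hip_cvg hX tL (L2_eigen n) hg cpsi.
  rewrite (_ : (fun k => hip X (psi k) g) = cst 0); last first.
    by apply/funext => k; rewrite /= ipC g0.
  move=> c; rewrite ipC -[LHS]/(hip X (phi n) g); apply: cvg_unique c _ => //.
  exact: cvg_cst.
have gg : hnorm X g ^+ 2 = 0.
  have := Parseval hX L2_eigen eigen_orth (eigen_hsum hg).
  under eq_fun do rewrite gphi expr0n.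
  move=> c; apply: cvg_unique c _ => //.
  rewrite (_ : series _ = cst 0); first exact: cvg_cst.
  by apply/funext => n; rewrite /series/= big1.
apply/eqP; rewrite -normr_le0; apply: le_trans (Cauchy_Schwarz hX hg hh) _.
by move/eqP : gg; rewrite sqrf_eq0 => /eqP ->; rewrite mul0r.
Qed.

Lemma weak_partial_unique i f g g' : L2 g -> L2 g' ->
  is_weak_partial Omega i f g -> is_weak_partial Omega i f g' ->
  forall h, L2 h -> ip g h = ip g' h.
Proof.
move=> hg hg' fg fg' h hh; apply/eqP; rewrite -subr_eq0; apply/eqP.
rewrite -[LHS]/(hip X g h - hip X g' h) -(hipBl hX)//.
apply: orthogonal_test hh; first exact: (ph_domB hX hg hg').
move=> psi tpsi; have Lpsi := L2_test_space mO tpsi.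
rewrite -[LHS]/(hip X (g - g') psi) (hipBl hX)//=.
by have := fg _ tpsi; rewrite (fg' _ tpsi) => /oppr_inj ->; rewrite subrr.
Qed.

Lemma weak_partialP i f : (exists2 g, L2 g & is_weak_partial Omega i f g) ->
  L2 (wp i f) /\ is_weak_partial Omega i f (wp i f).
Proof.
by move=> [g Lg fg]; apply: (@xgetPex _ (fun=> 0) [set g | L2 g /\ is_weak_partial Omega i f g]); exists g.
Qed.

Lemma sobolev_weak_partial k f i : sobolev Omega k.+1 f ->
  L2 (wp i f) /\ is_weak_partial Omega i f (wp i f).
Proof.
move=> [_ /(_ i)[g sg fg]]; apply: weak_partialP; exists g => //.
by case: k sg => [|k] [].
Qed.

Lemma eigen_weak_partial n i : L2 (wp i (phi n)) /\ is_weak_partial Omega i (phi n) (wp i (phi n)).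
Proof. by have [/(_ n)[_ s2] _ _ _ _] := eigen; exact: sobolev_weak_partial s2. Qed.

(** Membership in [H^2] provides a weak derivative [g] that is differentiable again, whereas [wp]
    selects a representative of its own; uniqueness against L^2 functions transfers the second
    derivative from [g]. *)
Lemma eigen_weak_partial2 n i : L2 (wp i (wp i (phi n))) /\
  is_weak_partial Omega i (wp i (phi n)) (wp i (wp i (phi n))).
Proof.
have [/(_ n)[_ [_ /(_ i)[g sg fg]]] _ _ _ _] := eigen.
have [Lw fw] := eigen_weak_partial n i; have Lg : L2 g by case: sg.
have [L2g g2g] := @sobolev_weak_partial 0 _ i sg.
apply: weak_partialP; exists (wp i g); first exact: L2g.
move=> psi tpsi.
rewrite -g2g//; apply: weak_partial_unique fw fg _ _ => //.
exact: (L2_test_space mO (partial_test_space i tpsi)).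
Qed.

(** The definition of the weak derivative of [wp i (phi n)] is applied to test functions
    approximating [phi m] in [H^1], and both sides pass to the limit; summing over [i] gives the
    Laplacian of [phi n], which is [- lam n * phi n] almost everywhere. *)
Lemma eigen_Green m n : \sum_i ip (wp i (phi m)) (wp i (phi n)) = lam n * (m == n)%:R.
Proof.
have Lphi := L2_eigen.
have [/(_ m)[[_ [psi [tpsi c0 c1]]] _] _ _ ae_eq _] := eigen.
have tL k : L2 (psi k) by exact: L2_test_space.
have tdL i k : L2 (partial i (psi k)).
  exact: (L2_test_space mO (partial_test_space i (tpsi k))).
have parts i : ip (wp i (phi m)) (wp i (phi n)) = - ip (phi m) (wp i (wp i (phi n))).
  have [Lmi _] := eigen_weak_partial m i; have [Lni _] := eigen_weak_partial n i.
  have [Lnii fnii] := eigen_weak_partial2 n i.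
  have cl := hip_cvg hX (tdL i) Lmi Lni (c1 i).
  have cr := hip_cvg hX tL (Lphi m) Lnii c0.
  apply: (cvg_unique _ cl) => //.
  rewrite (_ : (fun k => _) = fun k => - hip X (psi k) (wp i (wp i (phi n)))); last first.
    by apply/funext => k; rewrite /= ipC fnii// ipC.
  exact: cvgN cr.
under eq_bigr do rewrite parts.
have Lnii i : L2 (wp i (wp i (phi n))) by have [] := eigen_weak_partial2 n i.
rewrite sumrN -(hip_sumr hX (index_enum 'I_d) Lnii (Lphi m)) -eigen_orth.
have LS : L2 (\sum_i wp i (wp i (phi n))) by exact: (ph_dom_sum hX).
rewrite -mulN1r -[LHS](hipZr hX (-1) LS (Lphi m)) -[RHS](hipZr hX (lam n) (Lphi n) (Lphi m)).
rewrite /= /Defs.ip /Rintegral; congr fine.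
have L1 : L2 (-1 *: \sum_i wp i (wp i (phi n))) by exact: (ph_domZ hX).
have L2' : L2 (lam n *: phi n) by exact: (ph_domZ hX _ (Lphi n)).
apply: ae_eq_integral => //.
- exact: measurable_int (L2_integrableM mO (Lphi m) L1).
- exact: measurable_int (L2_integrableM mO (Lphi m) L2').
apply: filterS (ae_eq n) => x Hx Ox; congr (_%:E); congr (_ * _).
rewrite -[RHS](Hx Ox) -[LHS]/(-1 * (\sum_i wp i (wp i (phi n))) x) mulN1r.
by rewrite /weak_laplacian fct_sumE.
Qed.

Lemma L2vec_prehilbert : prehilbert Y.
Proof.
have row_lin (a : R) (v w : 'rV[R]_d -> 'rV[R]_d) j : (fun x => (a *: v + w) x ord0 j) =
    a *: (fun x => v x ord0 j) + (fun x => w x ord0 j).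
  by apply/funext => x; rewrite -[(a *: v + w) x]/(a *: v x + w x) mxE mxE.
split.
- move=> j; rewrite (_ : (fun x => _) = 0); first exact: L20.
  by apply/funext => x; rewrite /= mxE.
- by move=> a v w hv hw j; rewrite row_lin; exact: (ph_domP hX a (hv j) (hw j)).
- by move=> v w _ _ /=; apply: eq_bigr => j _; exact: ipC.
- move=> a u v w hu hv hw /=; rewrite mulr_sumr -big_split/=; apply: eq_bigr => j _.
  by rewrite row_lin; exact: (ph_lin hX a (hu j) (hv j) (hw j)).
- by move=> v hv /=; apply: sumr_ge0 => j _; exact: ip_ge0.
Qed.

Let hY := L2vec_prehilbert.

Let comp (v : 'rV[R]_d -> 'rV[R]_d) j : 'rV[R]_d -> R := fun x => v x ord0 j.

Let compB v w j : comp (v - w) j = comp v j - comp w j.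
Proof. by apply/funext => x; rewrite /comp /= !mxE. Qed.

Let hnorm_comp v j : hdom Y v -> hnorm X (comp v j) <= hnorm Y v.
Proof.
move=> hv; rewrite /hnorm ler_sqrt; last exact: (ph_ge0 hY hv).
rewrite /= (bigD1 j)//= lerDl; apply: sumr_ge0 => i _; exact: ip_ge0.
Qed.

Lemma L2vec_complete : complete_hilbert Y.
Proof.
move=> f hf cf.
have /choice[s Hs] : forall j, exists s, L2 s /\
    (fun n => hnorm X (s - comp (f n) j)) @ \oo --> (0 : R).
  move=> j; have [||s] := @L2_complete _ _ _ mO phi (fun n => comp (f n) j).
  - by move=> n; exact: hf.
  - move=> e /cf[N HN]; exists N => m n Nn nm.
    rewrite -compB; apply: le_trans (hnorm_comp j _) (HN m n Nn nm).
    exact: (ph_domB hY (hf m) (hf n)).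
  by exists s.
pose S x : 'rV[R]_d := \row_j s j x.
have compS j : comp S j = s j by apply/funext => x; rewrite /comp mxE.
have hS : hdom Y S by move=> j; rewrite -/(comp S j) compS; have [] := Hs j.
exists S => //.
have c0 : (fun n => \sum_j hnorm X (s j - comp (f n) j) ^+ 2) @ \oo --> (0 : R).
  rewrite -[X in _ --> X](_ : \sum_(j < d) 0 = 0 :> R); last by rewrite big1.
  apply: cvg_big => [|j _]; first exact: add_continuous.
  rewrite -[X in _ --> X](expr0n R 2).
  apply: (@cvg_comp _ _ _ _ (fun y : R => y ^+ 2)); last exact: exprn_continuous.
  by have [] := Hs j.
rewrite (_ : (fun n => _) = fun n => Num.sqrt (\sum_j hnorm X (s j - comp (f n) j) ^+ 2)).
  rewrite -[X in _ --> X]sqrtr0.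
  exact: (cvg_comp _ _ c0 (@sqrt_continuous R 0)).
apply/funext => n; rewrite /hnorm; congr Num.sqrt; apply: eq_bigr => j _.
rewrite -compS -compB -[RHS]/(hnorm X _ ^+ 2) (hnorm_sqr hX)//.
exact: (ph_domB hY hS (hf n) j).
Qed.

Lemma L2vec_Parseval w : hdom Y w ->
  series (fun n => \sum_j hip Y w (hbasis ((n, j) : hidx Y)) ^+ 2) @ \oo --> hip Y w w.
Proof.
move=> hw.
have wE n j : hip Y w (hbasis ((n, j) : hidx Y)) = ip (comp w j) (phi n).
  rewrite /= (bigD1 j)//= big1 ?addr0 => [|i ij].
    rewrite /Defs.ip; apply: eq_Rintegral => x _.
    by rewrite !mxE eqxx eqxx mulr1.
  rewrite /Defs.ip; under eq_Rintegral do rewrite !mxE eqxx (negbTE ij) mulr0 mulr0.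
  by rewrite /Rintegral integral0.
under eq_fun do under eq_bigr do rewrite wE.
rewrite (_ : series _ = fun N => \sum_j series (fun n => ip (comp w j) (phi n) ^+ 2) N); last first.
  by apply/funext => N; rewrite /series/= exchange_big.
apply: cvg_big => [|j _]; first exact: add_continuous.
have hwj : L2 (comp w j) by exact: hw.
rewrite -[X in _ --> X]/(hip X (comp w j) (comp w j)) -(hnorm_sqr hX)//.
exact: (Parseval hX L2_eigen eigen_orth (eigen_hsum hwj)).
Qed.

Definition eigen_grad n := (Num.sqrt (lam n))^-1 *: weak_grad Omega (phi n).

Let gradE f j : comp (weak_grad Omega f) j = wp j f.
Proof. by apply/funext => x; rewrite /comp mxE. Qed.

Let grad_dom n : hdom Y (weak_grad Omega (phi n)).
Proof. by move=> j; rewrite -/(comp _ j) gradE; have [] := eigen_weak_partial n j. Qed.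

Lemma eigen_grad_dom n : hdom Y (eigen_grad n).
Proof. exact: (ph_domZ hY). Qed.

Lemma eigen_grad_orth m n : hip Y (eigen_grad m) (eigen_grad n) = (m == n)%:R.
Proof.
rewrite (hipZl hY _ (grad_dom m) (eigen_grad_dom n)) (hipZr hY _ (grad_dom n) (grad_dom m)) /=.
under eq_bigr => j _ do rewrite -/(comp _ _) -/(comp _ _) !gradE.
rewrite eigen_Green; have [->|_] := eqVneq m n; last by rewrite !mulr0.
by rewrite mulr1 mulrA -expr2 exprVn sqr_sqrtr ?mulVf ?gt_eqF ?eigen_gt0// ltW ?eigen_gt0.
Qed.

(** The sum [s] given by Riesz-Fischer is first shown to be a weak gradient of [f]. As [weak_grad]
    is some chosen weak gradient, it differs from [s] by a field of norm 0, and the series converges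
    to it as well. *)
Lemma weak_grad_hsum f : L2 f -> cvgn (series (fun n => lam n * ip f (phi n) ^+ 2)) ->
  hsum Y (fun n => (Num.sqrt (lam n) * ip f (phi n)) *: eigen_grad n) (weak_grad Omega f).
Proof.
move=> hf cf.
have [s Hs] : exists s, hsum Y (fun n => (Num.sqrt (lam n) * ip f (phi n)) *: eigen_grad n) s.
  apply: (hsum_exists hY eigen_grad_dom eigen_grad_orth L2vec_complete).
  by under eq_fun do rewrite exprMn sqr_sqrtr ?(ltW (eigen_gt0 _))//.
have [hs cs] := Hs.
have coef n v : hdom Y v -> Num.sqrt (lam n) * ip f (phi n) * hip Y (eigen_grad n) v =
    ip f (phi n) * hip Y (weak_grad Omega (phi n)) v.
  move=> hv; rewrite (hipZl hY)// mulrA; congr (_ * _).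
  by rewrite mulrAC mulfV ?mul1r// gt_eqF// sqrtr_gt0 eigen_gt0.
(* Tested with [psi] in the direction [j], the expansions of [f] and of [s] agree term by term up to
   sign, because each [phi n] has a weak derivative. *)
have ws j : is_weak_partial Omega j f (comp s j).
  move=> psi tpsi; have Lpsi := L2_test_space mO tpsi.
  have Ldpsi := L2_test_space mO (partial_test_space j tpsi).
  pose v : 'rV[R]_d -> 'rV[R]_d := fun x => psi x *: delta_mx ord0 j.
  have vE i : comp v i = if i == j then psi else 0.
    apply/funext => x; rewrite /comp /v !mxE eqxx/= eq_sym.
    by case: ifP => _; rewrite ?mulr1 ?mulr0.
  have hv : hdom Y v.
    by move=> i; rewrite -/(comp v i) vE; case: ifP => _ //; exact: L20.
  have hipv w : hip Y w v = ip (comp w j) psi.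
    rewrite /= (bigD1 j)//= big1 => [|i ij]; rewrite -/(comp v _) vE ?eqxx ?addr0//.
    by rewrite (negbTE ij) /Defs.ip; under eq_Rintegral do rewrite mulr0; rewrite /Rintegral integral0.
  have c1 := hsum_series hX L2_eigen Ldpsi (eigen_hsum hf).
  have c2 := hsum_series hY eigen_grad_dom hv Hs.
  rewrite -[LHS]/(hip X f (partial j psi)) -hipv; apply: (cvg_unique _ c1) => //.
  rewrite (_ : series _ = - series (fun n => Num.sqrt (lam n) * ip f (phi n) * hip Y (eigen_grad n) v)).
    exact: cvgN c2.
  apply/funext => N; rewrite /series/= -[RHS]/(- _) -sumrN; apply: eq_bigr => n _.
  rewrite coef// hipv gradE -mulrN; congr (_ * _).
  by have [_ ->] := eigen_weak_partial n j.
have wj j : L2 (wp j f) /\ is_weak_partial Omega j f (wp j f).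
  by apply: weak_partialP; exists (comp s j) => //; exact: hs.
have hg : hdom Y (weak_grad Omega f).
  by move=> j; rewrite -/(comp _ j) gradE; have [] := wj j.
split; first exact: hg.
have hgs : hdom Y (weak_grad Omega f - s) by exact: (ph_domB hY).
have g0 : hnorm Y (weak_grad Omega f - s) = 0.
  rewrite /hnorm [hip _ _ _]big1 ?sqrtr0// => j _.
  rewrite -/(comp _ j) compB gradE -[LHS]/(hip X (_ - _) (_ - _)).
  have [L1 w1] := wj j; have L2s : L2 (comp s j) by exact: hs.
  rewrite (hipBl hX)//; last exact: (ph_domB hX L1 L2s).
  apply/eqP; rewrite subr_eq0; apply/eqP.
  by apply: (weak_partial_unique L1 L2s w1 (ws j)); exact: (ph_domB hX L1 L2s).
apply: (squeeze_cvgr _ (cvg_cst 0) cs); apply: nearW => N; rewrite hnorm_ge0/=.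
set S := \sum_(n < N) _.
have hS : hdom Y S by apply: (ph_dom_sum hY) => i; exact: (ph_domZ hY _ (eigen_grad_dom i)).
rewrite (_ : weak_grad Omega f - S = (weak_grad Omega f - s) + (s - S)); last by rewrite addrA subrK.
by have := hnorm_triangle hY hgs (ph_domB hY hs hS); rewrite g0 add0r; apply.
Qed.

End weak_gradient.

(** * Function spaces in time *)

Section time_spaces.
Context {R : realType} {V : lmodType R}.
Local Notation mu := (@lebesgue_measure R).
Variables (X : hilbert V) (T : R).
Hypothesis hX : prehilbert X.

Let ITv := (`]0%R, T[ : set (measurableTypeR R)).

Let inT t : ITv t -> 0 < t < T.
Proof. by rewrite /ITv/= in_itv. Qed.

Lemma L2time_measurable_norm v x : L2time X T v -> hdom X x ->
  measurable_fun ITv (fun t => hnorm X (v t - x)).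
Proof.
move=> [_ mv _] hx.
apply: (measurability (@RGenInftyO.G R)) => [|/= _ [_] [e] -> <-].
  exact: RGenInftyO.measurableE.
rewrite (_ : _ @^-1` _ = [set t | hnorm X (v t - x) < e]); first exact: mv.
by apply/seteqP; split => t /=; rewrite in_itv/=.
Qed.

Lemma L2time_measurable_hip v y : L2time X T v -> hdom X y ->
  measurable_fun ITv (fun t => hip X (v t) y).
Proof.
move=> hv hy; have [dv _ _] := hv; have hNy := ph_domZ hX (-1) hy.
apply: (eq_measurable_fun (fun t => 4^-1 *
    (hnorm X (v t - (-1) *: y) ^+ 2 - hnorm X (v t - y) ^+ 2))).
  by move=> t; rewrite inE => /inT t0; rewrite -(hip_polar hX)//; exact: dv.
apply: measurable_funM; first exact: measurable_cst.
by apply: measurable_funB; apply: measurable_funX; exact: L2time_measurable_norm.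
Qed.

(** Expanding the square of the norm of [v t - x] reduces measurability on balls to that of inner
    products with fixed vectors and of the squared norm. *)
Lemma L2time_intro v : (forall t, 0 < t < T -> hdom X (v t)) ->
  (forall x, hdom X x -> measurable_fun ITv (fun t => hip X (v t) x)) ->
  measurable_fun ITv (fun t => hip X (v t) (v t)) ->
  (\int[mu]_(t in `]0%R, T[) (hip X (v t) (v t))%:E < +oo)%E ->
  L2time X T v.
Proof.
move=> dv mx mv voo; split => //; last first.
  move: voo; congr (_ < _)%E; apply: eq_integral => t.
  by rewrite inE => /inT t0; rewrite (hnorm_sqr hX)//; exact: dv.
move=> x e hx.
have m : measurable_fun ITv (fun t => hnorm X (v t - x)).
  apply: (eq_measurable_fun (fun t => Num.sqrt
      (hip X (v t) (v t) - 2 * hip X (v t) x + hip X x x))).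
    move=> t; rewrite inE => /inT t0; have hvt := dv t t0.
    have -> : v t - x = 1 *: v t - x by rewrite scale1r.
    by rewrite /hnorm (hip_expand hX)// expr1n mul1r mulr1.
  apply: (measurableT_comp (continuous_measurable_fun (@sqrt_continuous R))).
  apply: measurable_funD; last exact: measurable_cst.
  apply: measurable_funB => //; apply: measurable_funM; first exact: measurable_cst.
  exact: mx.
have := m (measurable_itv _) _ (measurable_itv `]-oo, e[).
by rewrite (_ : _ @^-1` _ = [set t | hnorm X (v t - x) < e])//; apply/seteqP; split => t /=; rewrite in_itv/=.
Qed.

End time_spaces.

Section sobolev_sums.
Context {R : realType}.
Local Notation mu := (@lebesgue_measure R).
Variables (T r : R).

Lemma sobolev_normsqZ (k : R) (f : R -> R) : measurable_fun [set: R] f ->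
  (sobolev_time_normsq T r (fun t => (k * f t)%R) = (k ^+ 2)%:E * sobolev_time_normsq T r f)%E.
Proof.
move=> mf; rewrite !sobolev_normsqE ge0_muleDr; last 2 first.
- by apply: integral_ge0 => t _; rewrite lee_fin sqr_ge0.
- apply: integral_ge0 => x _; apply: integral_ge0 => y _; rewrite lee_fin.
  exact: mulr_ge0 (sobolev_kernel_ge0 _ _ _ _) (sqr_ge0 _).
congr (_ + _)%E.
  rewrite -ge0_integralZl; last 4 first.
  - exact: measurable_itv.
  - by apply/measurable_EFinP; apply: measurable_funTS; exact: measurable_funX.
  - by move=> t _; rewrite lee_fin sqr_ge0.
  - by rewrite lee_fin sqr_ge0.
  by apply: eq_integral => t _; rewrite -EFinM exprMn.
rewrite -(double_integralZl (sqr_ge0 k) (meas2_sobolev T r mf)); last first.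
  by move=> x y; exact: mulr_ge0 (sobolev_kernel_ge0 _ _ _ _) (sqr_ge0 _).
apply: eq_integral => x _; apply: eq_integral => y _; congr (_%:E).
by rewrite -mulrBr exprMn mulrCA.
Qed.

(* [P] and [Q] stand for sums over a family of the squares of its values and of
   its differences. *)
Let form (P : R -> \bar R) (Q : R -> R -> \bar R) : \bar R :=
  (\int[mu]_(t in `]0%R, T[) P t +
   \int[mu]_x \int[mu]_y ((sobolev_kernel T r x y)%:E * Q x y))%E.

Let emeas2 (Q : R -> R -> \bar R) :=
  measurable_fun [set: measurableTypeR R * measurableTypeR R] (fun z => Q z.1 z.2).

Let kernelQ Q := (fun x y : R => (sobolev_kernel T r x y)%:E * Q x y)%E.

Let emeas2_kernel Q : emeas2 Q -> emeas2 (kernelQ Q).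
Proof.
by move=> mQ; apply: emeasurable_funM => //; apply/measurable_EFinP; exact: meas2_sobolev_kernel.
Qed.

Let emeas2_right Q x : emeas2 Q -> measurable_fun [set: R] (Q x).
Proof. by move=> mQ; have := measurableT_comp mQ (measurable_pair1 x). Qed.

Let emeas2_integral Q : emeas2 Q -> (forall x y, 0 <= Q x y)%E ->
  measurable_fun [set: R] (fun x => \int[mu]_y Q x y)%E.
Proof.
move=> mQ Q0.
have := @measurable_fun_fubini_tonelli_F _ _ _ _ R mu (fun z => Q z.1 z.2).
by apply => // z.
Qed.

Let kernelQ_ge0 Q : (forall x y, 0 <= Q x y)%E -> forall x y, (0 <= kernelQ Q x y)%E.
Proof. by move=> Q0 x y; rewrite mule_ge0// lee_fin sobolev_kernel_ge0. Qed.

Let form_series (P : nat -> R -> \bar R) (Q : nat -> R -> R -> \bar R) :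
  (forall n, measurable_fun [set: R] (P n)) -> (forall n, emeas2 (Q n)) ->
  (forall n t, 0 <= P n t)%E -> (forall n x y, 0 <= Q n x y)%E ->
  (form (fun t => \sum_(n <oo) P n t) (fun x y => \sum_(n <oo) Q n x y) =
   \sum_(n <oo) form (P n) (Q n))%E.
Proof.
move=> mP mQ P0 Q0; rewrite /form nneseriesD; last 2 first.
- by move=> n _ _; apply: integral_ge0 => t _; exact: P0.
- move=> n _ _; apply: integral_ge0 => x _; apply: integral_ge0 => y _.
  exact: (kernelQ_ge0 (Q0 n)).
congr (_ + _)%E.
  apply: integral_nneseries; first exact: measurable_itv.
    by move=> n; exact: measurable_funTS (mP n).
  by move=> n t _; exact: P0.
rewrite -integral_nneseries//; last 2 first.
- move=> n; exact: (emeas2_integral (emeas2_kernel (mQ n)) (kernelQ_ge0 (Q0 n))).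
- move=> n x _; apply: integral_ge0 => y _; exact: (kernelQ_ge0 (Q0 n)).
apply: eq_integral => x _; rewrite -integral_nneseries//; last 2 first.
- by move=> n; exact: (emeas2_right x (emeas2_kernel (mQ n))).
- by move=> n y _; exact: (kernelQ_ge0 (Q0 n)).
by apply: eq_integral => y _; rewrite nneseriesZl.
Qed.

Let form_le (P P' : R -> \bar R) (Q Q' : R -> R -> \bar R) :
  measurable_fun [set: R] P -> measurable_fun [set: R] P' -> emeas2 Q -> emeas2 Q' ->
  (forall t, 0 <= P t)%E -> (forall x y, 0 <= Q x y)%E ->
  (forall t, 0 <= P' t)%E -> (forall x y, 0 <= Q' x y)%E ->
  (forall t, t \in `]0, T[ -> (P t <= P' t)%E) ->
  (forall x y, x \in `]0, T[ -> y \in `]0, T[ -> (Q x y <= Q' x y)%E) ->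
  (form P Q <= form P' Q')%E.
Proof.
move=> mP mP' mQ mQ' P0 Q0 P'0 Q'0 PP QQ; apply: leeD.
  apply: ge0_le_integral; first exact: measurable_itv.
  - by move=> t _.
  - exact: measurable_funTS.
  - exact: measurable_funTS.
  - by move=> t; exact: PP.
apply: ge0_le_integral => //.
- by move=> x _; apply: integral_ge0 => y _; exact: (kernelQ_ge0 Q0).
- exact: (emeas2_integral (emeas2_kernel mQ) (kernelQ_ge0 Q0)).
- exact: (emeas2_integral (emeas2_kernel mQ') (kernelQ_ge0 Q'0)).
move=> x _; apply: ge0_le_integral => //.
- by move=> y _; exact: (kernelQ_ge0 Q0).
- exact: (emeas2_right x (emeas2_kernel mQ)).
- exact: (emeas2_right x (emeas2_kernel mQ')).
move=> y _; rewrite /sobolev_kernel; case: ifP => [/andP[xT yT]|_]; last by rewrite !mul0e.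
by rewrite lee_wpmul2l ?QQ// lee_fin invr_ge0 powR_ge0.
Qed.

Let sobolev_form f :
  (sobolev_time_normsq T r f = form (fun t => (f t ^+ 2)%:E) (fun x y => ((f x - f y) ^+ 2)%:E))%E.
Proof.
by rewrite sobolev_normsqE.
Qed.

(* The Sobolev norm commutes with sums of squares, hence a pointwise Bessel
   inequality for values and differences passes to it. *)
Lemma sobolev_Bessel (h : nat -> R -> R) d (k : nat -> 'I_d -> R -> R) :
  (forall n, measurable_fun [set: R] (h n)) ->
  (forall n j, measurable_fun [set: R] (k n j)) ->
  (forall t, t \in `]0, T[ ->
    (\sum_(n <oo) (h n t ^+ 2)%:E <= \sum_(n <oo) \sum_j (k n j t ^+ 2)%:E)%E) ->
  (forall x y, x \in `]0, T[ -> y \in `]0, T[ ->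
    (\sum_(n <oo) ((h n x - h n y) ^+ 2)%:E <=
    \sum_(n <oo) \sum_j ((k n j x - k n j y) ^+ 2)%:E)%E) ->
  (\sum_(n <oo) sobolev_time_normsq T r (h n) <=
   \sum_(n <oo) \sum_j sobolev_time_normsq T r (k n j))%E.
Proof.
move=> mh mk hk hkB.
have mP (f : R -> R) : measurable_fun [set: R] f -> measurable_fun [set: R] (fun t => (f t ^+ 2)%:E).
  by move=> mf; apply/measurable_EFinP; exact: measurable_funX.
have mQ (f : R -> R) : measurable_fun [set: R] f -> emeas2 (fun x y => ((f x - f y) ^+ 2)%:E).
  move=> mf; apply/measurable_EFinP; apply: measurable_funX.
  by apply: measurable_funB; [exact: meas2_fst|exact: meas2_snd].
have P0 (f : R -> R) t : (0 <= (f t ^+ 2)%:E)%E by rewrite lee_fin sqr_ge0.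
have Q0 (f : R -> R) x y : (0 <= ((f x - f y) ^+ 2)%:E)%E by rewrite lee_fin sqr_ge0.
have mPk n : measurable_fun [set: R] (fun t => \sum_j (k n j t ^+ 2)%:E)%E.
  by apply: emeasurable_sum => j; exact: mP.
have mQk n : emeas2 (fun x y => \sum_j ((k n j x - k n j y) ^+ 2)%:E)%E.
  by apply: emeasurable_sum => j; exact: (mQ (k n j)).
have P0k n t : (0 <= \sum_j (k n j t ^+ 2)%:E)%E by apply: sume_ge0 => j _.
have Q0k n x y : (0 <= \sum_j ((k n j x - k n j y) ^+ 2)%:E)%E by apply: sume_ge0 => j _.
have Eh : (\sum_(n <oo) sobolev_time_normsq T r (h n) =
    form (fun t => \sum_(n <oo) (h n t ^+ 2)%:E) (fun x y => \sum_(n <oo) ((h n x - h n y) ^+ 2)%:E))%E.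
  rewrite form_series.
  - by apply: eq_eseriesr => n _; rewrite sobolev_form.
  - by move=> n; exact: mP.
  - by move=> n; exact: mQ.
  - by move=> n t; exact: P0.
  - by move=> n x y; exact: Q0.
have Ek : (\sum_(n <oo) \sum_j sobolev_time_normsq T r (k n j) =
    form (fun t => \sum_(n <oo) \sum_j (k n j t ^+ 2)%:E)
         (fun x y => \sum_(n <oo) \sum_j ((k n j x - k n j y) ^+ 2)%:E))%E.
  rewrite form_series//.
  apply: eq_eseriesr => n _; under eq_bigr do rewrite sobolev_form.
  rewrite /form big_split/=; congr (_ + _)%E.
    rewrite ge0_integral_sum; first by [].
    - exact: measurable_itv.
    - by move=> j; apply: measurable_funTS; exact: mP.
    - by move=> j t _; exact: P0.
  rewrite -ge0_integral_sum//; last 2 first.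
  - move=> j; exact: (emeas2_integral (emeas2_kernel (mQ _ (mk n j))) (kernelQ_ge0 (Q0 _))).
  - by move=> j x _; apply: integral_ge0 => y _; exact: (kernelQ_ge0 (Q0 _)).
  apply: eq_integral => x _; rewrite -ge0_integral_sum//; last 2 first.
  - by move=> j; exact: (emeas2_right x (emeas2_kernel (mQ _ (mk n j)))).
  - by move=> j y _; exact: (kernelQ_ge0 (Q0 _)).
  by apply: eq_integral => y _; rewrite ge0_sume_distrr.
rewrite Eh Ek; apply: form_le.
- by apply: ge0_emeasurable_sum => [n t _ _|n _]; [exact: P0|exact: mP].
- by apply: ge0_emeasurable_sum => [n t _ _|n _]; [exact: P0k|exact: mPk].
- by apply: ge0_emeasurable_sum => [n t _ _|n _]; [exact: Q0|exact: mQ].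
- by apply: ge0_emeasurable_sum => [n t _ _|n _]; [exact: Q0k|exact: mQk].
- by move=> t; apply: nneseries_ge0 => n _ _; exact: P0.
- by move=> x y; apply: nneseries_ge0 => n _ _; exact: Q0.
- by move=> t; apply: nneseries_ge0 => n _ _; exact: P0k.
- by move=> x y; apply: nneseries_ge0 => n _ _; exact: Q0k.
- exact: hk.
- exact: hkB.
Qed.

End sobolev_sums.

Lemma cvg_series_add (R : realType) (u v : nat -> R) : cvgn (series u) -> cvgn (series v) ->
  cvgn (series (fun n => u n + v n)).
Proof. by move=> cu cv; exact: (is_cvg_seriesD cu cv). Qed.

Lemma lim_series_add (R : realType) (u v : nat -> R) : cvgn (series u) -> cvgn (series v) ->
  limn (series (fun n => u n + v n)) = limn (series u) + limn (series v).
Proof. by move=> cu cv; exact: (lim_seriesD cu cv). Qed.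

Section dotH_theory.
Context {R : realType} {d : nat}.
Variable Omega : set 'rV[R]_d.
Hypothesis mO : measurable Omega.
Variables (phi : nat -> 'rV[R]_d -> R) (lam : nat -> R).
Hypothesis eigen : dirichlet_eigenbasis Omega phi lam.
Local Notation L2 := (L2 Omega).
Local Notation ip := (ip Omega).
Local Notation X := (L2_hilbert Omega phi).
Local Notation H := (dotH Omega phi lam).

Let hX := L2_prehilbert mO phi.
Let Lphi := L2_eigen eigen.

Lemma dotH_cvg r f : hdom (H r) f -> cvgn (series (fun n => lam n `^ r * ip f (phi n) ^+ 2)).
Proof.
move=> [_ foo]; apply: nneseries_lty_cvg => // n.
by apply: mulr_ge0; [exact: powR_ge0|exact: sqr_ge0].
Qed.

Lemma dotH_cvgM r f g : hdom (H r) f -> hdom (H r) g ->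
  cvgn (series (fun n => lam n `^ r * ip f (phi n) * ip g (phi n))).
Proof.
move=> /dotH_cvg cf /dotH_cvg cg; apply: normed_cvg.
apply: (@series_le_cvg _ _ (fun n => lam n `^ r * ip f (phi n) ^+ 2 + lam n `^ r * ip g (phi n) ^+ 2)).
- by move=> n; exact: normr_ge0.
- by move=> n; rewrite -mulrDr; apply: mulr_ge0; [exact: powR_ge0|rewrite addr_ge0 ?sqr_ge0].
- move=> n; rewrite -[leLHS]/(`|lam n `^ r * ip f (phi n) * ip g (phi n)|).
  rewrite -mulrA normrM ger0_norm ?powR_ge0// -mulrDr ler_wpM2l ?powR_ge0//.
  rewrite normrM -subr_ge0; have := sqr_ge0 (`|ip f (phi n)| - `|ip g (phi n)|).
  have := mulr_ge0 (normr_ge0 (ip f (phi n))) (normr_ge0 (ip g (phi n))).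
  by rewrite sqrrB !real_normK ?num_real// mulr2n; lra.
- exact: (cvg_series_add cf cg).
Qed.

Lemma dotH_sqr r f : hip (H r) f f = limn (series (fun n => lam n `^ r * ip f (phi n) ^+ 2)).
Proof. by rewrite /=; under eq_fun do rewrite -mulrA -expr2. Qed.

Lemma dotH_prehilbert r : prehilbert (H r).
Proof.
have ipP (a : R) f g n : L2 f -> L2 g -> ip (a *: f + g) (phi n) = a * ip f (phi n) + ip g (phi n).
  by move=> hf hg; exact: (ph_lin hX a hf hg (Lphi n)).
split.
- split; first exact: L20.
  rewrite eseries0 ?ltry// => i _ _.
  by rewrite -[ip 0 _]/(hip X 0 (phi i)) (hip0l hX (Lphi i)) expr0n mulr0.
- move=> a f g hf hg; have cf := dotH_cvg hf; have cg := dotH_cvg hg.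
  have [Lf _] := hf; have [Lg _] := hg; split; first exact: (ph_domP hX).
  have p0 k : 0 <= lam k `^ r by exact: powR_ge0.
  have c : cvgn (series (fun k => 2 * a ^+ 2 * (lam k `^ r * ip f (phi k) ^+ 2) +
      2 * (lam k `^ r * ip g (phi k) ^+ 2))).
    exact: (cvg_series_add (is_cvg_seriesM cf) (is_cvg_seriesM cg)).
  have b k : lam k `^ r * ip (a *: f + g) (phi k) ^+ 2 <=
      2 * a ^+ 2 * (lam k `^ r * ip f (phi k) ^+ 2) + 2 * (lam k `^ r * ip g (phi k) ^+ 2).
    rewrite ipP//; have := mulr_ge0 (p0 k) (sqr_ge0 (a * ip f (phi k) - ip g (phi k))).
    move=> h; rewrite -subr_ge0.
    suff -> : 2 * a ^+ 2 * (lam k `^ r * ip f (phi k) ^+ 2) +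
        2 * (lam k `^ r * ip g (phi k) ^+ 2) -
        lam k `^ r * (a * ip f (phi k) + ip g (phi k)) ^+ 2 =
      lam k `^ r * (a * ip f (phi k) - ip g (phi k)) ^+ 2 by [].
    by ring.
  pose w k := 2 * a ^+ 2 * (lam k `^ r * ip f (phi k) ^+ 2) + 2 * (lam k `^ r * ip g (phi k) ^+ 2).
  apply: (@le_lt_trans _ _ (\sum_(k <oo) (w k)%:E)%E).
    apply: lee_nneseries => [k _ _|k _]; rewrite lee_fin; last exact: b.
    exact: mulr_ge0 (sqr_ge0 _).
  rewrite nneseries_EFin ?ltry// => k; apply: le_trans (b k).
  exact: mulr_ge0 (sqr_ge0 _).
- by move=> f g _ _ /=; under eq_fun do rewrite mulrAC.
- move=> a f g h hf hg hh; have [Lf _] := hf; have [Lg _] := hg.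
  have c1 := dotH_cvgM hf hh; have c2 := dotH_cvgM hg hh.
  rewrite /= -(@lim_seriesM _ a _ c1) -(lim_series_add (@is_cvg_seriesM _ a _ c1) c2).
  by congr (limn (series _)); apply/funext => n; rewrite ipP//; ring.
- move=> f hf; rewrite dotH_sqr; apply: limr_ge; first exact: dotH_cvg.
  apply: nearW => n; apply: sumr_ge0 => i _.
  by apply: mulr_ge0; [exact: powR_ge0|exact: sqr_ge0].
Qed.

(** The basis vector carries the factor [lam n ^ (-1/2)] and the inner product the weight [lam n];
    one square root survives. *)
Lemma dotH_basis f n : hip (H 1) f (hbasis (n : hidx (H 1))) = Num.sqrt (lam n) * ip f (phi n).
Proof.
have l0 := eigen_gt0 eigen n.
have bE k : ip (lam n `^ (- 1 / 2) *: phi n) (phi k) = lam n `^ (- 1 / 2) * (n == k)%:R.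
  by rewrite -[LHS]/(hip X _ _) (hipZl hX _ (Lphi n) (Lphi k)) /= (eigen_orth eigen).
rewrite /=; under eq_fun do rewrite bE.
rewrite (_ : Num.sqrt _ * _ = lam n `^ 1 * ip f (phi n) * lam n `^ (- 1 / 2)); last first.
  rewrite mulrAC -gt0_powRD// (_ : 1 + -1 / 2 = 2^-1); last by field.
  by rewrite powR12_sqrt// ltW.
apply: lim_near_cst => //; exists n.+1 => // k /= nk; apply/eqP.
rewrite /series/= (bigD1_seq n) ?mem_index_iota ?iota_uniq//= eqxx mulr1.
by rewrite big1 ?addr0// => i /negbTE; rewrite eq_sym => ->; rewrite !mulr0.
Qed.

End dotH_theory.

Section sqrt_ereal.
Context {R : realType}.

Let half0 : 2^-1 != 0 :> R. Proof. by rewrite invr_eq0 pnatr_eq0. Qed.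

Lemma poweR_half_le (S : \bar R) (K : R) : (0 <= S)%E -> 0 <= K ->
  (S <= (K ^+ 2)%:E)%E -> (S `^ 2^-1 <= K%:E)%E.
Proof.
move=> S0 K0; case: S S0 => [s| |] S0; last 2 first.
- by rewrite leye_eq.
- by move: S0; rewrite leeNy_eq.
move: S0; rewrite poweR_EFin !lee_fin => s0 sK; rewrite powR12_sqrt//.
by rewrite -(ger0_norm K0) -sqrtr_sqr ler_sqrt// sqr_ge0.
Qed.

Lemma poweR_half_lty (S : \bar R) : (0 <= S)%E -> (S `^ 2^-1 < +oo)%E -> (S < +oo)%E.
Proof.
case: S => [s| |] S0; first by move=> _; rewrite ltry.
  by rewrite poweRyr// ltxx.
by move: S0; rewrite leeNy_eq.
Qed.

Lemma poweR_half_le1 (S : \bar R) : (0 <= S)%E -> (S `^ 2^-1 <= 1)%E -> (S <= 1)%E.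
Proof.
case: S => [s| |] S0.
- move: S0; rewrite poweR_EFin !lee_fin => s0; rewrite powR12_sqrt// => h.
  by rewrite -(sqr_sqrtr s0) expr_le1// sqrtr_ge0.
- by rewrite poweRyr// leye_eq.
- by move: S0; rewrite leeNy_eq.
Qed.

End sqrt_ereal.

(** * The duality pairing *)

Lemma integrable_EFinB d (T : measurableType d) (R : realType)
    (mu : {measure set T -> \bar R}) (D : set T) (f g : T -> R) : measurable D ->
  mu.-integrable D (EFin \o f) -> mu.-integrable D (EFin \o g) ->
  mu.-integrable D (EFin \o (fun x => f x - g x)).
Proof. by move=> mD fi gi; have := integrableB mD fi gi; exact: eq_integrable. Qed.

Section test_functions.
Context {R : realType}.
Local Notation mu := (@lebesgue_measure R).
Variables (T : R) (f : R -> R).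
Hypotheses (T0 : 0 < T) (hf : test_time T f).

Lemma test_time_derivable t : derivable f t 1.
Proof. by have [/(_ 0%N t)] := hf. Qed.

Lemma test_time_continuous : continuous f.
Proof.
by move=> t; apply: differentiable_continuous; apply/derivable1_diffP; exact: test_time_derivable.
Qed.

Lemma test_time_derive_continuous : continuous (derive1 f).
Proof.
move=> t; apply: differentiable_continuous; apply/derivable1_diffP.
by have [/(_ 1%N t)] := hf; rewrite derive1n1.
Qed.

Lemma test_time_out t : t \notin `]0, T[ -> f t = 0.
Proof.
move=> tT; have [_ [K [_ KT Kf]]] := hf; apply: Kf => /KT /=.
by move: tT => /negP.
Qed.

Lemma test_time_bounded : exists2 M : R, 0 <= M &
  forall t, t \in `]0, T[ -> `|f t| <= M /\ `|derive1 f t| <= M.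
Proof.
have bnd (g : R -> R) : continuous g -> exists2 M : R, 0 <= M & forall t, t \in `]0, T[ -> `|g t| <= M.
  move=> cg; have [B [_ HB]] : bounded_set (g @` `[0, T]).
    by apply: compact_bounded; apply: continuous_compact (@segment_compact _ _ _); exact: continuous_subspaceT.
  exists (`|B| + 1); first by rewrite addr_ge0.
  move=> t tT; apply: HB; first by rewrite ltr_pwDr// ler_norm.
  by exists t => //=; exact: subset_itv_oo_cc tT.
have [M1 M10 H1] := bnd _ test_time_continuous.
have [M2 M20 H2] := bnd _ test_time_derive_continuous.
exists (M1 + M2); first exact: addr_ge0.
move=> t tT; split; first by apply: le_trans (H1 t tT) _; rewrite lerDl.
by apply: le_trans (H2 t tT) _; rewrite lerDr.
Qed.

Lemma measurable_test_time : measurable_fun [set: R] f.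
Proof. by apply: continuous_measurable_fun; exact: test_time_continuous. Qed.

Lemma measurable_test_time_derive : measurable_fun [set: R] (derive1 f).
Proof. by apply: continuous_measurable_fun; exact: test_time_derive_continuous. Qed.

Lemma integral_test_time_derive s : s \in `[0, T[ ->
  (\int[mu]_(t in `]s, T[) (derive1 f t)%:E = (- f s)%:E)%E.
Proof.
rewrite in_itv/= => /andP[s0 sT].
rewrite -(@integral_itv_bndoo _ _ _ _ true false); last first.
  by apply/measurable_EFinP; apply: measurable_funTS; exact: measurable_test_time_derive.
rewrite (@continuous_FTC2 _ _ f s T sT)//.
- by rewrite -EFinB [f T]test_time_out ?sub0r// in_itv/= ltxx andbF.
- by apply: continuous_subspaceT; exact: test_time_derive_continuous.
split; first by move=> x _; exact: test_time_derivable.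
- by apply: cvg_at_right_filter; exact: test_time_continuous.
- by apply: cvg_at_left_filter; exact: test_time_continuous.
Qed.

Lemma integrable_bounded_itv (g : R -> R) (M : R) : measurable_fun [set: R] g ->
  (forall t, t \in `]0, T[ -> `|g t| <= M) -> mu.-integrable `]0, T[ (EFin \o g).
Proof.
move=> mg gM; apply: (@le_integrable _ _ _ mu _ (measurable_itv _) _ (EFin \o cst M)).
- by apply/measurable_EFinP; exact: measurable_funTS.
- move=> t /= tT; rewrite lee_fin; apply: le_trans (gM t tT) _; exact: ler_norm.
apply/integrableP; split; first exact/measurable_EFinP/measurable_cst.
rewrite [X in (X < _)%E](_ : _ = \int[mu]_(x in `]0%R, T[) cst (`|M|%:E) x)%E//.
rewrite integral_cst//= lebesgue_measure_itv/= lte_fin T0 -EFinB -EFinM.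
by rewrite ltry.
Qed.

Lemma integrable_relaxation (a lam t : R) (e p : R -> R) : relaxation a lam e p -> 0 < t ->
  mu.-integrable `]0, t[ (EFin \o p).
Proof.
move=> ep t0; apply: ge0_integrable.
- exact: measurable_itv.
- exact: measurable_funTS (relax_mp ep).
- by move=> x _; exact: relax_p0 ep x.
- by rewrite (relax_int0 ep t0) ltry.
Qed.

Lemma integrable_relaxation_test (a lam : R) (e p : R -> R) : relaxation a lam e p ->
  mu.-integrable `]0, T[ (EFin \o (fun t => p t * f t)).
Proof.
move=> ep; have [M M0 HM] := test_time_bounded; have p0 := relax_p0 ep.
apply: (@le_integrable _ _ _ mu _ (measurable_itv _) _ (EFin \o (fun t => M * p t))).
- apply/measurable_EFinP; apply: measurable_funTS.
  exact: measurable_funM (relax_mp ep) measurable_test_time.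
- move=> t /= /HM[ft _]; rewrite lee_fin normrM mulrC [leRHS]ger0_norm ?mulr_ge0//.
  by rewrite (ger0_norm (p0 t)) ler_wpM2r.
by apply: integrableMl_cst (integrable_relaxation ep T0); exact: measurable_itv.
Qed.

(** Write [e t] as 1 minus [lam] times the integral of [p] over []0, t[]. The constant contributes
    nothing, as [f] vanishes at both ends; in the rest, Fubini on the triangle [s < t] leaves the
    integral of [f'] over []s, T[], which is [- f s]. *)
Lemma integral_derive_relaxation (a lam : R) (e p : R -> R) :
  0 < lam -> relaxation a lam e p ->
  \int[mu]_(t in `]0, T[) (derive1 f t * e t) = lam * \int[mu]_(t in `]0, T[) (p t * f t).
Proof.
move=> lam0 ep; have [M M0 HM] := test_time_bounded.
have me := relax_me ep; have mp := relax_mp ep; have p0 := relax_p0 ep.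
have mdf := measurable_test_time_derive; have mf := measurable_test_time.
have intp t : 0 < t -> mu.-integrable `]0, t[ (EFin \o p) by exact: integrable_relaxation ep.
have eE t : 0 < t -> e t = 1 - lam * \int[mu]_(s in `]0, t[) p s.
  move=> t0; rewrite /Rintegral (relax_int0 ep t0)/= mulrC divfK ?gt_eqF//.
  by rewrite opprB addrC subrK.
(* The integrand on the triangle, extended by 0 to the plane; it is dominated by the product of a
   bounded function of [t] and an integrable function of [s], both supported in []0, T[]. *)
pose F (z : R * R) := if (0 < z.2) && (z.2 < z.1) && (z.1 < T) then derive1 f z.1 * p z.2 else 0.
have mF : measurable_fun [set: measurableTypeR R * measurableTypeR R] F.
  apply: measurable_fun_ifT.
    apply: measurable_and; first apply: measurable_and.
    - by apply: measurable_fun_ltr; [exact: measurable_cst|exact: measurable_snd].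
    - by apply: measurable_fun_ltr; [exact: measurable_snd|exact: measurable_fst].
    - by apply: measurable_fun_ltr; [exact: measurable_fst|exact: measurable_cst].
    by apply: measurable_funM; [exact: meas2_fst|exact: meas2_snd].
  exact: measurable_cst.
pose b t := if t \in `]0, T[ then M else 0; pose q s := if s \in `]0, T[ then p s else 0.
have b0 t : 0 <= b t by rewrite /b; case: ifP.
have q0 t : 0 <= q t by rewrite /q; case: ifP.
have mq : measurable_fun [set: R] q.
  by apply: measurable_fun_ifT => //; exact: measurable_in_itv.
have mb : measurable_fun [set: R] b.
  by apply: measurable_fun_ifT => //; exact: measurable_in_itv.
have Fbq t s : `|F (t, s)| <= b t * q s.
  rewrite /F /=; case: ifP => [/andP[/andP[s0 st] tT]|_]; last by rewrite normr0 mulr_ge0.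
  rewrite /b /q !in_itv/= s0 tT (lt_trans s0 st) (lt_trans st tT)/= normrM.
  rewrite (ger0_norm (p0 s)) ler_wpM2r//.
  by have [|_ +] := HM t; first by rewrite in_itv/= (lt_trans s0 st).
have iF : (mu \x mu)%E.-integrable [set: measurableTypeR R * measurableTypeR R] (EFin \o F).
  apply/integrable12ltyP; first by apply/measurable_EFinP; exact: mF.
  apply: (@le_lt_trans _ _ (\int[mu]_t \int[mu]_s (b t * q s)%:E)%E).
    apply: ge0_le_integral => //.
    - by move=> t _; apply: integral_ge0 => s _.
    - apply: (@measurable_fun_fubini_tonelli_F _ _ _ _ R mu (fun z => `|F z|%:E)) => //.
      by apply/measurable_EFinP; exact: measurableT_comp mF.
    - apply: (@measurable_fun_fubini_tonelli_F _ _ _ _ R mu (fun z => (b z.1 * q z.2)%:E)).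
        apply/measurable_EFinP; apply: measurable_funM; [exact: meas2_fst|exact: meas2_snd].
      by move=> z; rewrite lee_fin mulr_ge0.
    move=> t _; apply: ge0_le_integral => //.
    - apply/measurable_EFinP; apply: measurableT_comp => //.
      by have := measurableT_comp mF (measurable_pair1 t).
    - by apply/measurable_EFinP; apply: measurable_funM.
    - by move=> s _; rewrite lee_fin Fbq.
  have qE : (\int[mu]_s (q s)%:E = ((1 - e T) / lam)%:E)%E.
    by rewrite integral_itv_if (relax_int0 ep T0).
  under eq_integral => t _.
    under eq_integral do rewrite EFinM.
    rewrite ge0_integralZl ?lee_fin//; last 2 first.
    - exact/measurable_EFinP.
    - by move=> s _; rewrite lee_fin.
    rewrite qE; over.
  have l0 : 0 <= (1 - e T) / lam by apply: divr_ge0 (ltW lam0); rewrite subr_ge0 (relax_e1 ep).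
  rewrite ge0_integralZr ?lee_fin//; last 2 first.
  - exact/measurable_EFinP.
  - by move=> t _; rewrite lee_fin.
  rewrite integral_itv_if integral_cst//= lebesgue_measure_itv/= lte_fin T0 -EFinB -!EFinM.
  by rewrite ltry.
have FE1 : (\int[mu]_t \int[mu]_s (F (t, s))%:E =
    \int[mu]_(t in `]0%R, T[) (derive1 f t * \int[mu]_(s in `]0%R, t[) p s)%:E)%E.
  rewrite -integral_itv_if; apply: eq_integral => t _.
  case: ifPn => [|]; rewrite in_itv/=.
    move=> /andP[t0 tT]; rewrite EFinM /Rintegral fineK; last exact: integrable_fin_num (intp t t0).
    rewrite -integralZl; [|exact: measurable_itv|exact: intp].
    under [RHS]eq_integral do rewrite -EFinM.
    rewrite -integral_itv_if; apply: eq_integral => s _.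
    by rewrite /F /= tT andbT in_itv.
  move=> tT; rewrite integral0_eq// => s _; rewrite /F/=; case: ifP => // /andP[/andP[s0 st] tT'].
  by move: tT; rewrite tT' (lt_trans s0 st).
have FE2 : (\int[mu]_s \int[mu]_t (F (t, s))%:E =
    \int[mu]_(s in `]0%R, T[) (- (p s * f s))%:E)%E.
  rewrite -integral_itv_if; apply: eq_integral => s _.
  case: ifPn => [|]; rewrite in_itv/=.
    move=> /andP[s0 sT]; rewrite -mulrN EFinM -integral_test_time_derive ?in_itv/= ?(ltW s0)//.
    rewrite -integralZl; last 2 first.
    - exact: measurable_itv.
    - apply: (@integrableS _ _ _ mu `]0, T[); [exact: measurable_itv|exact: measurable_itv| |].
        by move=> x /=; rewrite !in_itv/= => /andP[/(lt_trans s0) -> ->].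
      by apply: (@integrable_bounded_itv _ M mdf) => x /HM[_].
    under [RHS]eq_integral do rewrite -EFinM.
    rewrite -integral_itv_if; apply: eq_integral => t _.
    by rewrite /F /= s0 in_itv/= mulrC.
  move=> sT; rewrite integral0_eq// => t _; rewrite /F/=; case: ifP => // /andP[/andP[s0 st] tT'].
  by move: sT; rewrite s0 (lt_trans st tT').
have := Fubini iF; rewrite /= FE1 FE2 => FF.
have ifp := integrable_relaxation_test ep.
have idf : mu.-integrable `]0, T[ (EFin \o (derive1 f)).
  by apply: (@integrable_bounded_itv _ M mdf) => x /HM[_].
have mI : measurable (`]0, T[ : set (measurableTypeR R)) by exact: measurable_itv.
have idfP : mu.-integrable `]0, T[ (EFin \o (fun t => derive1 f t * \int[mu]_(s in `]0, t[) p s)).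
  have c1 : mu.-integrable `]0, T[ (EFin \o (fun t => lam^-1 * (derive1 f t - derive1 f t * e t))).
    apply: integrableMl_cst; first exact: measurable_itv.
    have i1 : mu.-integrable `]0, T[ (EFin \o (fun t => derive1 f t * e t)).
      apply: (@integrable_bounded_itv (fun t => derive1 f t * e t) M); first exact: measurable_funM.
      move=> t /HM[_ h]; rewrite normrM; apply: le_trans h; rewrite ler_piMr//.
      by rewrite (ger0_norm (relax_e0 ep t)) (relax_e1 ep).
    exact: (integrable_EFinB mI idf i1).
  apply: (@eq_integrable _ _ _ mu _ mI _ _ _ c1) => t.
  rewrite inE/= in_itv/= => /andP[t0 _]; congr (_%:E); rewrite (eE t t0).
  by field; rewrite gt_eqF.
transitivity (\int[mu]_(t in `]0, T[) (derive1 f t - lam * (derive1 f t * \int[mu]_(s in `]0, t[) p s))).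
  apply: eq_Rintegral => t; rewrite inE/= in_itv/= => /andP[t0 _].
  by rewrite (eE t t0); ring.
rewrite RintegralB//; last by apply: integrableMl_cst.
rewrite RintegralZl// {1}/Rintegral integral_test_time_derive ?in_itv/= ?lexx//.
rewrite test_time_out ?in_itv/= ?ltxx// oppr0/= sub0r -mulrN; congr (_ * _).
rewrite [in LHS]/Rintegral FF -[LHS]/(- \int[mu]_(t in `]0, T[) (- (p t * f t))).
under [in LHS]eq_Rintegral do rewrite -mulN1r.
by rewrite RintegralZl// mulN1r opprK.
Qed.

End test_functions.

Section series_lemmas.
Context {R : realType}.

Lemma cvg_series_l2M (B : R) (c z b : nat -> R) :
  cvgn (series (fun n => c n ^+ 2)) -> cvgn (series (fun n => z n ^+ 2)) ->
  (forall n, `|b n| <= B) -> cvgn (series (fun n => `|c n * z n * b n|)).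
Proof.
move=> cc cz bB; have B0 : 0 <= B by apply: le_trans (bB 0%N).
apply: (@series_le_cvg _ _ (fun n => B * (c n ^+ 2 + z n ^+ 2))).
- by move=> n; exact: normr_ge0.
- by move=> n; apply: mulr_ge0 => //; rewrite addr_ge0 ?sqr_ge0.
- move=> n; rewrite normrM mulrC; apply: ler_pM => //; rewrite normrM -subr_ge0.
  have := sqr_ge0 (`|c n| - `|z n|); have := mulr_ge0 (normr_ge0 (c n)) (normr_ge0 (z n)).
  by rewrite sqrrB !real_normK ?num_real// mulr2n; lra.
by apply: is_cvg_seriesM; exact: (cvg_series_add cc cz).
Qed.

(** Tannery's theorem along a filter: the tail of the series of [a] bounds the tail uniformly, and
    the finitely many remaining terms tend to 0. *)
Lemma cvg_series_dominated0 (S : Type) (F : set_system S) {FF : Filter F}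
    (a : nat -> R) (w : nat -> S -> R) :
  (forall n, 0 <= a n) -> cvgn (series a) -> (forall n, w n @ F --> (0 : R)) ->
  (\forall s \near F, forall n, 0 <= w n s <= 1) ->
  (fun s => limn (series (fun n => a n * w n s))) @ F --> (0 : R).
Proof.
move=> a0 ca w0 w01; apply/cvgr0Pnorm_le => e e0.
have e2 : 0 < e / 2 by rewrite divr_gt0.
have [N _ HN] : \forall N \near \oo, `|limn (series a) - series a N| <= e / 2.
  by move/cvgrPdist_le : ca; apply.
have fin0 : (fun s => \sum_(0 <= n < N) a n * w n s) @ F --> (0 : R).
  rewrite -[X in _ --> X](_ : \sum_(0 <= n < N) 0 = 0 :> R); last by rewrite big1.
  apply: cvg_big => [|n _]; first exact: add_continuous.
  by rewrite -[X in _ --> X](mulr0 (a n)); apply: cvgM; [exact: cvg_cst|exact: w0].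
move/cvgr0Pnorm_le : fin0 => /(_ _ e2) fin0.
near=> s.
have ws : forall n, 0 <= w n s <= 1 by near: s.
have aw0 n : 0 <= a n * w n s by apply: mulr_ge0 => //; have /andP[] := ws n.
have awa n : a n * w n s <= a n by rewrite ler_piMr//; have /andP[] := ws n.
have caw : cvgn (series (fun n => a n * w n s)) by apply: series_le_cvg ca.
have L0 : 0 <= limn (series (fun n => a n * w n s)).
  by apply: limr_ge => //; apply: nearW => n; apply: sumr_ge0 => i _.
rewrite ger0_norm//; apply: limr_le => //.
exists N => // M /= NM; rewrite /series/= (big_cat_nat (leq0n N) NM)/= [leRHS]splitr.
apply: lerD; first by apply: le_trans (ler_norm _) _; near: s.
apply: (@le_trans _ _ (\sum_(N <= n < M) a n)); first by apply: ler_sum => n _.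
apply: le_trans (HN N (leqnn N)); apply: le_trans (ler_norm _).
rewrite lerBrDr addrC.
have -> : series a N + \sum_(N <= n < M) a n = series a M.
  by rewrite /series/= [RHS](big_cat_nat (leq0n N) NM).
apply: nondecreasing_cvgn_le => //; apply: nondecreasing_series => n _ _; exact: a0.
Unshelve. all: by end_near. Qed.

Lemma cvg_series_Rintegral d (S : measurableType d) (mu : {measure set S -> \bar R})
    (D : set S) (f : nat -> S -> R) (B : R) : measurable D ->
  (forall n, measurable_fun D (f n)) ->
  (\sum_(n <oo) \int[mu]_(x in D) `|f n x|%:E <= B%:E)%E ->
  [/\ forall n, mu.-integrable D (EFin \o f n),
      cvgn (series (fun n => \int[mu]_(x in D) f n x)) &
      `|limn (series (fun n => \int[mu]_(x in D) f n x))| <= B].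
Proof.
move=> mD mf fB.
have foo n : (\int[mu]_(x in D) `|f n x|%:E < +oo)%E.
  apply: le_lt_trans (ltry B); apply: le_trans fB.
  apply: (@nneseries_ge_term _ (fun n => \int[mu]_(x in D) `|f n x|%:E)%E).
  by move=> k; apply: integral_ge0 => x _; rewrite lee_fin.
have fi n : mu.-integrable D (EFin \o f n).
  by apply/integrableP; split; [exact/measurable_EFinP|exact: foo].
pose v n := \int[mu]_(x in D) `|f n x|.
have v0 n : 0 <= v n by apply: Rintegral_ge0 => x _.
have vE n : ((v n)%:E = \int[mu]_(x in D) `|f n x|%:E)%E.
  by rewrite /v /Rintegral fineK// ge0_fin_numE// integral_ge0// => x _; rewrite lee_fin.
have vB : (\sum_(n <oo) (v n)%:E <= B%:E)%E by under eq_eseriesr do rewrite vE.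
have cv : cvgn (series v) by apply: nneseries_lty_cvg => //; apply: le_lt_trans vB (ltry B).
have fv n : `|\int[mu]_(x in D) f n x| <= v n := le_normr_Rintegral mD (fi n).
have cn : cvgn [normed series (fun n => \int[mu]_(x in D) f n x)].
  by apply: (series_le_cvg _ v0 fv cv) => n; exact: normr_ge0.
split => //; first exact: normed_cvg.
apply: le_trans (lim_series_norm cn) _; apply: (@le_trans _ _ (limn (series v))).
  exact: lim_series_le.
by rewrite -lee_fin -nneseries_EFin.
Qed.

End series_lemmas.

(** * Series of relaxation modes *)

Section relaxed_series.
Context {R : realType}.
Local Notation mu := (@lebesgue_measure R).
Variables (a T : R) (lam c : nat -> R).
Hypotheses (a0 : 0 < a) (a1 : a < 1) (T0 : 0 < T).
Hypotheses (lam0 : forall n, 0 < lam n) (lam_ge : forall n, lam 0%N <= lam n).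
Hypothesis cc : cvgn (series (fun n => c n ^+ 2)).
Local Notation e n := (ml_fun a (lam n) 1).
Local Notation p n := (ml_fun a (lam n) a).

Local Opaque Gamma ml_fun.

Let ITv := (`]0%R, T[ : set (measurableTypeR R)).
Let mI : measurable ITv. Proof. exact: measurable_itv. Qed.
Let ep n : relaxation a (lam n) (e n) (p n).
Proof. exact: ml_fun_relaxation. Qed.
Let sqrt0 n : 0 < Num.sqrt (lam n). Proof. by rewrite sqrtr_gt0. Qed.

Let isqrt_sqr n : (lam n)^-1 = (Num.sqrt (lam n))^-1 ^+ 2.
Proof. by rewrite exprVn sqr_sqrtr// ltW. Qed.

Let isqrt_lam n : (Num.sqrt (lam n))^-1 * lam n = Num.sqrt (lam n).
Proof.
by rewrite -{2}(sqr_sqrtr (ltW (lam0 n))) expr2 mulrA mulVf ?mul1r// gt_eqF.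
Qed.

Let A := limn (series (fun n => c n ^+ 2)).

Definition pairing_term (h : nat -> R -> R) n (t : R) : R :=
  c n * (Num.sqrt (lam n) * ml_fun a (lam n) a t * h n t).

(* The common form of [du] and [Dgu]: [h n] is the [n]-th coefficient of the
   test function. *)
Definition pairing (h : nat -> R -> R) : R :=
  limn (series (fun n => \int[mu]_(t in `]0, T[) pairing_term h n t)).

Lemma eq_pairing h k : (forall n t, 0 < t < T -> h n t = k n t) -> pairing h = pairing k.
Proof.
move=> hk; rewrite /pairing; congr (limn (series _)); apply/funext => n.
apply: eq_Rintegral => t; rewrite inE/= in_itv/= => tT.
by rewrite /pairing_term hk.
Qed.

Let measurable_pairing_term h n : measurable_fun ITv (h n) ->
  measurable_fun ITv (pairing_term h n).
Proof.
move=> mh; apply: measurable_funM; first exact: measurable_cst.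
apply: measurable_funM mh; apply: measurable_funM; first exact: measurable_cst.
by apply: measurable_funTS; exact: relax_mp (ep n).
Qed.

Section bounds.
Variable CH : R.
Hypotheses (CH0 : 0 < CH)
  (hardy : forall h : R -> R, measurable_fun [set: R] h ->
    (\int[mu]_(t in `]0%R, T[) (t `^ (a - 1) * h t ^+ 2)%:E <=
     CH%:E * sobolev_time_normsq T ((1 - a) / 2) h)%E).

(** [pairing_relaxation] summed over [n]; the coefficients are set to 0 outside []0, T[], which
    makes them measurable on the line and leaves their Sobolev norms unchanged. *)
Let pairing_abs (theta S : R) h : 0 < theta -> (forall n, measurable_fun ITv (h n)) ->
  (\sum_(n <oo) sobolev_time_normsq T ((1 - a) / 2) (h n) <= S%:E)%E ->
  (\sum_(n <oo) \int[mu]_(t in `]0%R, T[) `|pairing_term h n t|%:E <=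
   (theta / (2 * Gamma a) * A + CH / (2 * theta) * S)%:E)%E.
Proof.
move=> th0 mh hS; pose h' n := h n \_ ITv.
have mh' n : measurable_fun [set: R] (h' n) by apply/(measurable_restrictT _ mI); exact: mh.
have hh' n t : t \in `]0, T[ -> h n t = h' n t.
  by move=> tT; rewrite /h' patchE mem_set.
have sE n : sobolev_time_normsq T ((1 - a) / 2) (h n) = sobolev_time_normsq T ((1 - a) / 2) (h' n).
  by apply: eq_sobolev_normsq => t; exact: hh'.
have G0 : 0 < Gamma a by exact: Gamma_gt0.
have q0 : 0 <= theta / (2 * Gamma a) by rewrite divr_ge0 ?mulr_ge0 ?ltW.
have r0 : 0 <= CH / (2 * theta) by rewrite divr_ge0 ?mulr_ge0 ?ltW.
apply: (@le_trans _ _ (\sum_(n <oo) ((theta / (2 * Gamma a) * c n ^+ 2)%:E +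
    (CH / (2 * theta))%:E * sobolev_time_normsq T ((1 - a) / 2) (h n)))%E).
  apply: lee_nneseries => [n _ _|n _].
    by apply: integral_ge0 => t _; rewrite lee_fin.
  have := pairing_relaxation a0 T0 (lam0 n) (ep n) (c n) th0 (mh' n) (hardy (mh' n)).
  rewrite sE mulrAC; apply: le_trans.
  rewrite le_eqVlt; apply/orP; left; apply/eqP; apply: eq_integral => t.
  by rewrite inE/= => tT; rewrite /pairing_term hh'.
rewrite nneseriesD; last 2 first.
- by move=> n _ _; rewrite lee_fin; exact: mulr_ge0 (sqr_ge0 _).
- by move=> n _ _; apply: mule_ge0; [rewrite lee_fin|exact: sobolev_normsq_ge0].
rewrite EFinD; apply: leeD.
  rewrite nneseries_EFin; first by rewrite lim_seriesM.
    by move=> n; exact: mulr_ge0 (sqr_ge0 _).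
  exact: is_cvg_seriesM.
rewrite nneseriesZl; last by move=> n _; exact: sobolev_normsq_ge0.
by rewrite (EFinM _ S); apply: lee_wpmul2l => //; rewrite lee_fin.
Qed.

Let A0 : 0 <= A.
Proof. by apply: limr_ge => //; apply: nearW => n; apply: sumr_ge0 => i _; exact: sqr_ge0. Qed.

Lemma pairing_wf h (S : R) : (forall n, measurable_fun ITv (h n)) ->
  (\sum_(n <oo) sobolev_time_normsq T ((1 - a) / 2) (h n) <= S%:E)%E ->
  (forall n, mu.-integrable `]0, T[ (EFin \o pairing_term h n)) /\
  cvgn (series (fun n => \int[mu]_(t in `]0, T[) pairing_term h n t)).
Proof.
move=> mh hS; have := pairing_abs ltr01 mh hS.
by move=> /(cvg_series_Rintegral mI (fun n => measurable_pairing_term (mh n)))[].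
Qed.

(** [theta = 1 / sqrt A] balances the two terms of Young's inequality, which yields a bound linear
    in the norm of the data; when [A = 0] all [c n] vanish. *)
Lemma pairing_bound h : (forall n, measurable_fun ITv (h n)) ->
  (\sum_(n <oo) sobolev_time_normsq T ((1 - a) / 2) (h n) <= 1)%E ->
  `|pairing h| <= ((2 * Gamma a)^-1 + CH / 2) * Num.sqrt A.
Proof.
move=> mh hS; have G0 : 0 < Gamma a by exact: Gamma_gt0.
have [A00|Ap] := eqVneq A 0.
  have c0 n : c n = 0.
    apply/eqP; rewrite -sqrf_eq0 eq_le sqr_ge0 andbT -A00.
    apply: le_trans (nondecreasing_cvgn_le _ cc n.+1).
      by rewrite /series/= big_nat_recr//= lerDr sumr_ge0// => i _; exact: sqr_ge0.
    by apply: nondecreasing_series => i _ _; exact: sqr_ge0.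
  rewrite A00 sqrtr0 mulr0 /pairing.
  rewrite (_ : (fun n => _) = fun=> 0); last first.
    apply/funext => n; rewrite /Rintegral; under eq_integral do rewrite /pairing_term c0 mul0r.
    by rewrite integral0.
  by rewrite (_ : series _ = cst 0) ?lim_cst ?normr0//; apply/funext => n; rewrite /series/= big1.
have A_gt0 : 0 < A by rewrite lt_neqAle eq_sym Ap.
have s0 : 0 < Num.sqrt A by rewrite sqrtr_gt0.
have th0 : 0 < (Num.sqrt A)^-1 by rewrite invr_gt0.
have := pairing_abs th0 mh hS.
move=> /(cvg_series_Rintegral mI (fun n => measurable_pairing_term (mh n)))[_ _].
move=> H; apply: le_trans H _.
rewrite -{2}(sqr_sqrtr A0) le_eqVlt; apply/orP; left; apply/eqP.
by field; rewrite !gt_eqF.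
Qed.

Lemma pairing_linear (k S1 S2 : R) h1 h2 :
  (forall n, measurable_fun ITv (h1 n)) -> (forall n, measurable_fun ITv (h2 n)) ->
  (\sum_(n <oo) sobolev_time_normsq T ((1 - a) / 2) (h1 n) <= S1%:E)%E ->
  (\sum_(n <oo) sobolev_time_normsq T ((1 - a) / 2) (h2 n) <= S2%:E)%E ->
  pairing (fun n t => k * h1 n t + h2 n t) = k * pairing h1 + pairing h2.
Proof.
move=> m1 m2 b1 b2; have [i1 c1] := pairing_wf m1 b1; have [i2 c2] := pairing_wf m2 b2.
rewrite /pairing -(@lim_seriesM _ k _ c1) -(lim_series_add (@is_cvg_seriesM _ k _ c1) c2).
congr (limn (series _)); apply/funext => n.
rewrite -RintegralZl// -RintegralD//; last exact: integrableMl_cst.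
by apply: eq_Rintegral => t _; rewrite /pairing_term; ring.
Qed.

End bounds.

Section square_summable.
Variable z : nat -> R.
Hypothesis cz : cvgn (series (fun n => z n ^+ 2)).

Let isqrt_le n : (Num.sqrt (lam n))^-1 <= (Num.sqrt (lam 0%N))^-1.
Proof. by rewrite lef_pV2 ?posrE// ler_sqrt// ltW. Qed.

Lemma weight_cvg (w : nat -> R) : (forall n, 0 <= w n <= 1) ->
  cvgn (series (fun n => `|c n * z n / Num.sqrt (lam n) * w n|)).
Proof.
move=> w01; under eq_fun do rewrite -mulrA.
apply: (@cvg_series_l2M _ (Num.sqrt (lam 0%N))^-1 c z (fun n => (Num.sqrt (lam n))^-1 * w n) cc cz) => n.
have /andP[w0 w1] := w01 n; rewrite ger0_norm ?mulr_ge0 ?invr_ge0 ?sqrtr_ge0//.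
by apply: le_trans (isqrt_le n); rewrite ler_piMr// invr_ge0 sqrtr_ge0.
Qed.

Lemma relaxed_series_cvg t : cvgn (series (fun n => c n * z n / Num.sqrt (lam n) * e n t)).
Proof.
by apply: normed_cvg; apply: weight_cvg => n; rewrite (relax_e0 (ep n)) (relax_e1 (ep n)).
Qed.

Lemma relaxed_series_cvg1 : cvgn (series (fun n => c n * z n / Num.sqrt (lam n))).
Proof.
have := @weight_cvg (fun=> 1); rewrite /=.
by under eq_fun do rewrite mulr1; move=> H; apply: normed_cvg; apply: H => n; rewrite ler01 lexx.
Qed.

(** [integral_derive_relaxation] in each term, then exchange of sum and integral: [f'] is bounded,
    [e n <= 1], and the coefficients [c n * z n / sqrt (lam n)] are absolutely summable as
    [lam n >= lam 0]. *)
Lemma pairing_test f : test_time T f ->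
  mu.-integrable `]0, T[ (EFin \o (fun t =>
    derive1 f t * limn (series (fun n => c n * z n / Num.sqrt (lam n) * e n t)))) /\
  pairing (fun n t => f t * z n) =
  \int[mu]_(t in `]0, T[) (derive1 f t *
    limn (series (fun n => c n * z n / Num.sqrt (lam n) * e n t))).
Proof.
move=> hf; have [M M0 HM] := test_time_bounded hf.
have mdf := measurable_test_time_derive hf.
pose G n t := derive1 f t * (c n * z n / Num.sqrt (lam n) * e n t).
have mG n : measurable_fun ITv (G n).
  apply: measurable_funM; first exact: measurable_funTS mdf.
  apply: measurable_funM; first exact: measurable_cst.
  exact: measurable_funTS (relax_me (ep n)).
have GM n t : t \in `]0, T[ -> `|G n t| <= M * `|c n * z n / Num.sqrt (lam n) * 1|.
  move=> /HM[_ dM]; rewrite /G normrM; apply: ler_pM => //.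
  rewrite mulr1 normrM ler_piMr// ger0_norm ?(relax_e0 (ep n))//.
  exact: relax_e1 (ep n) t.
have c1 : cvgn (series (fun n => `|c n * z n / Num.sqrt (lam n) * 1|)).
  by apply: weight_cvg => n; rewrite ler01 lexx.
have Goo : (\sum_(0 <= n <oo) \int[mu]_(t in `]0%R, T[) `|G n t|%:E < +oo)%E.
  apply: (@le_lt_trans _ _ (\sum_(0 <= n <oo) (T * M * `|c n * z n / Num.sqrt (lam n) * 1|)%:E)%E).
    apply: lee_nneseries => [n _ _|n _].
      by apply: integral_ge0 => t _; rewrite lee_fin.
    apply: (@le_trans _ _ (\int[mu]_(t in `]0%R, T[) (cst (M * `|c n * z n / Num.sqrt (lam n) * 1|)%:E) t)%E).
      apply: ge0_le_integral => //.
      - by apply/measurable_EFinP; apply: measurableT_comp => //; exact: mG.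
      - by move=> t tT; rewrite lee_fin; exact: GM.
    by rewrite integral_cst//= lebesgue_measure_itv/= lte_fin T0 -EFinB subr0 -EFinM lee_fin mulrC mulrA.
  rewrite nneseries_EFin ?ltry//; last exact: is_cvg_seriesM.
  by move=> n; rewrite !mulr_ge0// ltW.
have [|H1 H2] := Rintegral_series mI mG Goo.
  move=> t _; rewrite /G; apply: is_cvg_seriesM; exact: relaxed_series_cvg.
have GE t : limn (series (G ^~ t)) = derive1 f t *
    limn (series (fun n => c n * z n / Num.sqrt (lam n) * e n t)).
  by rewrite /G lim_seriesM//; exact: relaxed_series_cvg.
split.
  by apply: (@eq_integrable _ _ _ mu _ mI _ _ _ H1) => t _; rewrite /= GE.
transitivity (\int[mu]_(t in `]0, T[) limn (series (G ^~ t))); last first.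
  by apply: eq_Rintegral => t _; exact: GE.
rewrite /pairing -(cvg_lim _ H2)//; congr (limn (series _)); apply/funext => n.
have ide : mu.-integrable `]0, T[ (EFin \o (fun t => derive1 f t * e n t)).
  apply: (@integrable_bounded_itv R T T0 (fun t => derive1 f t * e n t) M).
    by apply: measurable_funM mdf (relax_me (ep n)).
  move=> t /HM[_ h]; rewrite normrM; apply: le_trans h; rewrite ler_piMr//.
  by rewrite (ger0_norm (relax_e0 (ep n) t)) (relax_e1 (ep n)).
have ipf := integrable_relaxation_test T0 hf (ep n).
transitivity (c n * z n * Num.sqrt (lam n) * \int[mu]_(t in `]0, T[) (p n t * f t)).
  rewrite -RintegralZl//; apply: eq_Rintegral => t _; rewrite /pairing_term; ring.
transitivity (c n * z n / Num.sqrt (lam n) * \int[mu]_(t in `]0, T[) (derive1 f t * e n t)).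
  rewrite (integral_derive_relaxation T0 hf (lam0 n) (ep n)) mulrA; congr (_ * _).
  by rewrite -[RHS]mulrA isqrt_lam.
by rewrite -RintegralZl//; apply: eq_Rintegral => t _; rewrite /G; ring.
Qed.

End square_summable.

Section frac_int.
Context {V : lmodType R}.
Variables (Y : hilbert V) (g : nat -> V).
Hypotheses (hY : prehilbert Y) (cY : complete_hilbert Y).
Hypotheses (g_dom : forall n, hdom Y (g n)).
Hypotheses (g_orth : forall m n, hip Y (g m) (g n) = (m == n)%:R).
Variable W : R -> V.
Hypothesis hW : forall t, 0 < t < T ->
  hsum Y (fun n => (Num.sqrt (lam n) * (e n t * c n)) *: g n) (W t).

Let coef_cvg y : hdom Y y -> cvgn (series (fun n => hip Y (g n) y ^+ 2)).
Proof.
move=> hy; have := Bessel_cvg hY g_dom g_orth hy.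
by rewrite (_ : (fun n => hip Y y (g n) ^+ 2) = fun n => hip Y (g n) y ^+ 2)//; apply/funext => n; rewrite (ph_sym hY).
Qed.

Let G0 : 0 < Gamma a. Proof. exact: Gamma_gt0. Qed.

Let Wt (t : R) (s : R) := (t - s) `^ (a - 1) *: W s.

(* Termwise, the convolution of [t^(a-1)] with [e n] is
   [Gamma a * (1 - e n) / lam n]. *)
Let hip_Wt t y : 0 < t < T -> hdom Y y ->
  mu.-integrable `]0, t[ (fun s => (hip Y (Wt t s) y)%:E) /\
  series (fun n => Gamma a * (c n * hip Y (g n) y / Num.sqrt (lam n) * (1 - e n t))) @ \oo -->
    \int[mu]_(s in `]0, t[) hip Y (Wt t s) y.
Proof.
move=> /andP[t0 tT] hy; have cz := coef_cvg hy.
have mIt : measurable (`]0, t[ : set (measurableTypeR R)) by exact: measurable_itv.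
pose k n := Num.sqrt (lam n) * c n * hip Y (g n) y * Gamma a.
pose q n s := (t - s) `^ (a - 1) / Gamma a * e n s.
have q0 n s : 0 <= q n s.
  by rewrite mulr_ge0 ?divr_ge0 ?powR_ge0 ?(ltW G0)// (relax_e0 (ep n)).
have mq n : measurable_fun (`]0, t[ : set (measurableTypeR R)) (q n).
  apply: measurable_funTS; apply: measurable_funM (relax_me (ep n)).
  apply: measurable_funM; last exact: measurable_cst.
  by apply: (measurableT_comp (measurable_powR _)); exact: measurable_funB.
have qE n : (\int[mu]_(s in `]0%R, t[) (q n s)%:E = ((1 - e n t) / lam n)%:E)%E.
  exact: relax_conv (ep n) t t0.
have F n s : k n * q n s = (t - s) `^ (a - 1) *
    (Num.sqrt (lam n) * (e n s * c n) * hip Y (g n) y).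
  by rewrite /k /q; field; rewrite gt_eqF.
have kE n : k n * ((1 - e n t) / lam n) =
    Gamma a * (c n * hip Y (g n) y / Num.sqrt (lam n) * (1 - e n t)).
  by rewrite /k isqrt_sqr; field; rewrite gt_eqF.
have e01 n : 0 <= 1 - e n t <= 1.
  by rewrite subr_ge0 (relax_e1 (ep n)) gerBl (relax_e0 (ep n)).
have cS s : s \in `]0, t[ ->
    series (fun n => k n * q n s) @ \oo --> hip Y (Wt t s) y.
  rewrite in_itv/= => /andP[s0 st].
  have hs : 0 < s < T by rewrite s0 (lt_trans st tT).
  have Hs := hW hs; have [hWs _] := Hs.
  rewrite /Wt (hipZl hY)//; under eq_fun do rewrite F.
  have H := hsum_series hY g_dom hy Hs.
  rewrite -(cvg_lim _ H)//; apply: cvg_seriesM; apply/cvg_ex; eexists; exact: H.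
have foo : (\sum_(0 <= n <oo) \int[mu]_(s in `]0%R, t[) `|k n * q n s|%:E < +oo)%E.
  have TE n : (\int[mu]_(s in `]0%R, t[) `|k n * q n s|%:E =
      (Gamma a * `|c n * hip Y (g n) y / Num.sqrt (lam n) * (1 - e n t)|)%:E)%E.
    under eq_integral => s _ do rewrite normrM [`|q n s|]ger0_norm// EFinM.
    rewrite ge0_integralZl//; last 2 first.
    - by apply/measurable_EFinP; exact: mq.
    - by move=> s _; rewrite lee_fin.
    have r0 : 0 <= (1 - e n t) / lam n.
      by apply: divr_ge0; [have /andP[] := e01 n|exact: ltW].
    by rewrite qE -EFinM -{1}(ger0_norm r0) -normrM kE normrM (gtr0_norm G0).
  under eq_eseriesr => n _ do rewrite TE.
  rewrite nneseries_EFin ?ltry//; last exact: is_cvg_seriesM (weight_cvg cz e01).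
  by move=> n; apply: mulr_ge0 => //; exact: ltW.
have [||H1 H2] := Rintegral_series (f := fun n s => k n * q n s) mIt _ foo.
- by move=> n; apply: measurable_funM; [exact: measurable_cst|exact: mq].
- by move=> s /cS cs; apply/cvg_ex; eexists; exact: cs.
have limE s : s \in `]0, t[ -> limn (series (fun n => k n * q n s)) = hip Y (Wt t s) y.
  by move=> /cS cs; exact: cvg_lim cs.
split.
  by apply: (@eq_integrable _ _ _ mu _ mIt _ _ _ H1) => s; rewrite inE => /limE ->.
have -> : \int[mu]_(s in `]0, t[) hip Y (Wt t s) y =
    \int[mu]_(s in `]0, t[) limn (series (fun n => k n * q n s)).
  by apply: eq_Rintegral => s; rewrite inE => /limE.
move: H2; rewrite (_ : (fun n => \int[mu]_(s in `]0, t[) (k n * q n s)) = fun n =>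
  Gamma a * (c n * hip Y (g n) y / Num.sqrt (lam n) * (1 - e n t)))//.
apply/funext => n; rewrite -kE /Rintegral; under eq_integral do rewrite EFinM.
rewrite integralZl//; first by rewrite qE.
apply: ge0_integrable; [exact: mIt|exact: mq|by move=> s _; exact: q0|].
by rewrite qE ltry.
Qed.

(** [hintegral] is a choice, so a vector with the right inner products has to be exhibited:
    Riesz-Fischer provides it from the coefficients [b n], which are square summable because
    [(1 - e n t)^2 / lam n <= 1 / lam 0]. *)
Lemma frac_int_relaxation t y : 0 < t < T -> hdom Y y ->
  hip Y (frac_int Y (1 - (1 - a)) W t) y =
  limn (series (fun n => c n * hip Y (g n) y / Num.sqrt (lam n) * (1 - e n t))).
Proof.
move=> tT hy; rewrite /frac_int (_ : 1 - (1 - a) = a); last by rewrite opprB addrC subrK.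
pose b n := Gamma a * (c n / Num.sqrt (lam n) * (1 - e n t)).
have cb : cvgn (series (fun n => b n ^+ 2)).
  rewrite (_ : (fun n => b n ^+ 2) = fun n => Gamma a ^+ 2 *
      `|c n * c n * ((lam n)^-1 * (1 - e n t) ^+ 2)|); last first.
    apply/funext => n; rewrite ger0_norm; last first.
      by rewrite -expr2 mulr_ge0 ?sqr_ge0// mulr_ge0 ?sqr_ge0// invr_ge0 ltW.
    by rewrite /b isqrt_sqr; field; rewrite gt_eqF.
  apply: is_cvg_seriesM.
  apply: (@cvg_series_l2M _ (lam 0%N)^-1 c c (fun n => (lam n)^-1 * (1 - e n t) ^+ 2) cc cc) => n.
  have e01 : 0 <= 1 - e n t <= 1.
    by rewrite subr_ge0 (relax_e1 (ep n)) gerBl (relax_e0 (ep n)).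
  have /andP[h0 h1] := e01.
  rewrite ger0_norm ?mulr_ge0 ?sqr_ge0 ?invr_ge0 ?(ltW (lam0 n))//.
  apply: (@le_trans _ _ (lam n)^-1); first by rewrite ler_piMr ?invr_ge0 ?(ltW (lam0 n))// expr_le1.
  by rewrite lef_pV2 ?posrE.
have [w Hw] := hsum_exists hY g_dom g_orth cY cb; have [hw _] := Hw.
pose P := [set w : V | hdom Y w /\ forall y, hdom Y y ->
    mu.-integrable `]0, t[ (fun s => (hip Y (Wt t s) y)%:E) /\
    hip Y w y = \int[mu]_(s in `]0, t[) hip Y (Wt t s) y].
have wP : hdom Y w /\ forall y, hdom Y y ->
    mu.-integrable `]0, t[ (fun s => (hip Y (Wt t s) y)%:E) /\
    hip Y w y = \int[mu]_(s in `]0, t[) hip Y (Wt t s) y.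
  split => // x hx; have [iW cW] := hip_Wt tT hx; split => //.
  apply: (cvg_unique _ _ cW) => //.
  have := hsum_series hY g_dom hx Hw.
  rewrite (_ : (fun n => b n * hip Y (g n) x) = fun n =>
    Gamma a * (c n * hip Y (g n) x / Num.sqrt (lam n) * (1 - e n t)))//.
  by apply/funext => n; rewrite /b; ring.
have [hh Hh] := @xgetPex _ 0 P (ex_intro _ w wP).
rewrite (hipZl hY)//; have [_ ->] := Hh y hy; have [_ cW] := hip_Wt tT hy.
rewrite -(cvg_lim _ cW)// lim_seriesM ?mulrA ?mulVf ?mul1r ?gt_eqF//.
apply: normed_cvg; apply: (weight_cvg (coef_cvg hy)) => n.
by rewrite subr_ge0 (relax_e1 (ep n)) gerBl (relax_e0 (ep n)).
Qed.

End frac_int.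

End relaxed_series.

Section constants.
Context {R : realType}.
Local Notation mu := (@lebesgue_measure R).
Variables (a T : R).
Hypotheses (a0 : 0 < a) (a1 : a < 1) (T0 : 0 < T).

Local Opaque Gamma ml_fun mittag_leffler.

(** [1 - E] is [lam] times the indefinite integral of the integrable function [p], hence continuous
    up to [t = 0]. *)
Lemma mittag_leffler_continuous (lam t : R) : 0 < lam -> 0 <= t <= T ->
  (fun s => mittag_leffler a 1 (- lam * s `^ a)) @ within `[0, T] (nbhs t) -->
  mittag_leffler a 1 (- lam * t `^ a).
Proof.
move=> lam0 tT; pose p := ml_fun a lam a.
have mp : measurable_fun [set: R] p by exact: measurable_ml_fun.
have intE s : 0 <= s -> (\int[mu]_(x in `[0%R, s]) (p x)%:E =
    ((1 - mittag_leffler a 1 (- lam * s `^ a)) / lam)%:E)%E.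
  move=> s0; rewrite integral_itv_bndoo ?integral_ml_fun//.
  by apply/measurable_EFinP; exact: measurable_funTS.
have EE s : s \in `[0, T] -> mittag_leffler a 1 (- lam * s `^ a) =
    1 - lam * \int[mu]_(x in `[0, s]) p x.
  rewrite in_itv/= => /andP[s0 _]; rewrite /Rintegral intE//=.
  by move: (mittag_leffler _ _ _) => x; field; rewrite gt_eqF.
have ip : mu.-integrable `[0, T] (EFin \o p).
  apply: ge0_integrable.
  - exact: measurable_itv.
  - exact: measurable_funTS.
  - by move=> x _; exact: ml_fun_ge0.
  - by rewrite intE ?ltry// ltW.
have cP := parameterized_integral_continuous (ltW T0) ip.
have tI : [set` `[0, T]] t by rewrite /= in_itv.
have c : (fun s => \int[mu]_(x in `[0, s]) p x) @ within `[0, T] (nbhs t) -->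
    \int[mu]_(x in `[0, t]) p x.
  by rewrite (nbhs_subspace_in tI); exact: cP.
rewrite EE; last exact: tI.
apply: (@cvg_trans _ ((fun s => 1 - lam * \int[mu]_(x in `[0, s]) p x) @ within `[0, T] (nbhs t))).
  apply: near_eq_cvg; near=> s; rewrite EE//.
  by near: s; exact: withinT.
by apply: cvgB; [exact: cvg_cst|apply: cvgM => //; exact: cvg_cst].
Unshelve. all: by end_near. Qed.

(* For [a = 1/2] the bound on [lam^g * |e|^2] blows up like [1 / (2 - g)],
   which is what [2 - g] compensates. *)
Lemma critical_bound : exists2 C : R, 0 <= C & forall g : R,
  (a != 2^-1 /\ g = Num.min 2 a^-1) \/ (a = 2^-1 /\ 1 <= g < 2) ->
  0 <= g <= 2 /\ exists K : R, [/\ 0 <= K,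
    (Num.sqrt (2 - g) + Num.sqrt `|2 * a - 1|) ^+ 2 * K <= C &
    forall (lam : R) (e p : R -> R), 0 < lam -> relaxation a lam e p ->
      ((lam `^ g)%:E * \int[mu]_(t in `]0%R, T[) (e t ^+ 2)%:E <= K%:E)%E].
Proof.
pose M := Num.max 1 (Gamma (a + 1)) ^+ 2.
have M0 : 0 <= M by exact: sqr_ge0.
have [a2|a2|a2] := ltgtP a 2^-1.
- have g2 : Num.min 2 a^-1 = 2.
    by apply/min_idPl; rewrite -[leLHS]invrK lef_pV2 ?posrE// ?invr_gt0// ltW.
  have a2' : 0 < 1 - a * 2 by lra.
  pose K := M * (T `^ (1 - a * 2) / (1 - a * 2)).
  have K0 : 0 <= K by rewrite mulr_ge0// divr_ge0 ?powR_ge0// ltW.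
  exists ((Num.sqrt (2 - 2) + Num.sqrt `|2 * a - 1|) ^+ 2 * K).
    by apply: mulr_ge0 => //; exact: sqr_ge0.
  move=> g [[_ ->]|[aE _]]; last by move: a2; rewrite aE ltxx.
  rewrite g2; split; first by rewrite lexx ler0n.
  exists K; split => // lam e p lam0 ep.
  by apply: (L2_relaxation_subcritical T0 lam0 ep) => //; lra.
- have g2 : Num.min 2 a^-1 = a^-1.
    by apply/min_idPr; rewrite -[leRHS]invrK lef_pV2 ?posrE// ?invr_gt0// ltW.
  pose K := 1 + M / (2 * a - 1).
  have a2' : 0 < 2 * a - 1 by lra.
  have K0 : 0 <= K by rewrite addr_ge0// divr_ge0// ltW.
  exists ((Num.sqrt (2 - a^-1) + Num.sqrt `|2 * a - 1|) ^+ 2 * K).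
    by apply: mulr_ge0 => //; exact: sqr_ge0.
  move=> g [[_ ->]|[aE _]]; last by move: a2; rewrite aE ltxx.
  rewrite g2; split.
    by rewrite invr_ge0 (ltW a0)/= -[leRHS]invrK lef_pV2 ?posrE// ?invr_gt0// ltW.
  exists K; split => // lam e p lam0 ep.
  exact: (L2_relaxation_supercritical T a0 lam0 ep a2).
(* At [a = 1/2] the square of the prefactor is [2 - g], which cancels the denominator [(2 - g) / 2]
   up to the factor 2; [T^((2 - g)/2) <= Num.max 1 T] as the exponent is at most 1. *)
- exists (2 * M * Num.max 1 T); first by rewrite !mulr_ge0// le_max ler01.
  move=> g [[/eqP//]|[_ /andP[g1 g2]]]; split; first by apply/andP; split; lra.
  have ag : 1 - a * g = (2 - g) / 2 by rewrite a2; field.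
  have ag0 : 0 < (2 - g) / 2 by lra.
  exists (M * (T `^ ((2 - g) / 2) / ((2 - g) / 2))); split.
  + by rewrite mulr_ge0// divr_ge0 ?powR_ge0// ltW.
  + rewrite a2 (_ : 2 * 2^-1 - 1 = 0); last by field.
    rewrite normr0 sqrtr0 addr0 sqr_sqrtr; last by lra.
    have F (x m y : R) : 0 < y -> y * (m * (x / (y / 2))) = 2 * m * x.
      by move=> y0; field; rewrite gt_eqF.
    rewrite F; last by lra.
    apply: ler_wpM2l; first exact: mulr_ge0.
    apply: (@le_trans _ _ (Num.max 1 T `^ ((2 - g) / 2))).
      by apply: ge0_ler_powR; rewrite ?nnegrE ?le_max ?ler01 ?lexx ?orbT// ltW.
    rewrite -[leRHS]powRr1 ?le_max ?ler01//; apply: ler_powR; first by rewrite le_max lexx.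
    by lra.
  + move=> lam e p lam0 ep; rewrite -ag.
    by apply: (L2_relaxation_subcritical T0 lam0 ep); rewrite ?a2; lra.
Qed.

End constants.

Section L2vec_Bessel.
Context {R : realType} {d : nat}.
Local Notation mu := (@lebesgue_measure R).
Variable Omega : set 'rV[R]_d.
Hypothesis mO : measurable Omega.
Variables (phi : nat -> 'rV[R]_d -> R) (lam : nat -> R).
Hypothesis eigen : dirichlet_eigenbasis Omega phi lam.
Local Notation Y := (L2vec_hilbert Omega phi).
Local Notation g n := (eigen_grad Omega phi lam n).

Let hY := L2vec_prehilbert mO phi.

Lemma esum_pair (f : nat -> 'I_d -> \bar R) : (forall n j, 0 <= f n j)%E ->
  (\sum_(n <oo) \sum_j f n j = \esum_(k in [set: nat * 'I_d]) f k.1 k.2)%E.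
Proof.
move=> f0; have -> : [set: nat * 'I_d] = [set: nat] `*`` (fun=> [set: 'I_d]).
  by apply/seteqP; split.
rewrite -(@esum_esum R _ _ setT (fun=> setT) f)//.
rewrite nneseries_esumT; last by move=> n; apply: sume_ge0 => j _.
apply: eq_esum => n _; rewrite esum_fset//; last exact: finite_finset.
rewrite fsbig_seq ?index_enum_uniq//; congr (\big[_/_]_(_ \in _) _).
by apply/seteqP; split => // i _ /=; rewrite mem_index_enum.
Qed.

(** The fields [g n] are orthonormal and the basis of [Y] satisfies Parseval, so Bessel's inequality
    compares the two families at each time and for each difference of two times; [sobolev_Bessel]
    lifts it to the norms. *)
Lemma L2vec_Bessel (T r : R) w : L2time Y T w ->
  (\sum_(n <oo) sobolev_time_normsq T r (fun t => hip Y (w t) (g n)) <=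
   \esum_(i in [set: hidx Y]) sobolev_time_normsq T r (fun t => hip Y (w t) (hbasis i)))%E.
Proof.
move=> hw; have [dw _ _] := hw.
have mI : measurable (`]0, T[ : set (measurableTypeR R)) by exact: measurable_itv.
have g_dom := eigen_grad_dom mO eigen; have g_orth := eigen_grad_orth mO eigen.
have b_dom (i : nat * 'I_d) : hdom Y (hbasis (i : hidx Y)).
  move=> j; rewrite (_ : (fun x => _) = if j == i.2 then phi i.1 else 0).
    by case: ifP => _; [exact: (L2_eigen eigen)|exact: L20].
  apply/funext => x; rewrite /= !mxE eqxx/=.
  by case: ifP => _; rewrite ?mulr1 ?mulr0.
pose h n := (fun t => hip Y (w t) (g n)) \_ `]0, T[.
pose k n j := (fun t => hip Y (w t) (hbasis ((n, j) : hidx Y))) \_ `]0, T[.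
have hE n t : t \in `]0, T[ -> h n t = hip Y (w t) (g n).
  by move=> tT; rewrite /h patchE mem_set.
have kE n j t : t \in `]0, T[ -> k n j t = hip Y (w t) (hbasis ((n, j) : hidx Y)).
  by move=> tT; rewrite /k patchE mem_set.
have wT t : t \in `]0, T[ -> hdom Y (w t) by rewrite in_itv; exact: dw.
have mh n : measurable_fun [set: R] (h n).
  by apply/(measurable_restrictT _ mI); exact: (L2time_measurable_hip hY hw).
have mk n j : measurable_fun [set: R] (k n j).
  by apply/(measurable_restrictT _ mI); exact: (L2time_measurable_hip hY hw).
have pointwise v : hdom Y v -> (\sum_(n <oo) (hip Y v (g n) ^+ 2)%:E <=
    \sum_(n <oo) \sum_j (hip Y v (hbasis ((n, j) : hidx Y)) ^+ 2)%:E)%E.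
  move=> hv; apply: le_trans (Bessel hY g_dom g_orth hv) _.
  have P := L2vec_Parseval mO eigen hv.
  under eq_eseriesr do rewrite sumEFin.
  rewrite nneseries_EFin; last 2 first.
  - by move=> n; apply: sumr_ge0 => j _; exact: sqr_ge0.
  - by apply/cvg_ex; eexists; exact: P.
  by rewrite lee_fin -(cvg_lim _ P).
rewrite -(@esum_pair (fun n j => sobolev_time_normsq T r (fun t => hip Y (w t) (hbasis ((n, j) : hidx Y))))%E); last first.
  by move=> n j; exact: sobolev_normsq_ge0.
under eq_eseriesr => n _ do rewrite -(@eq_sobolev_normsq _ T r (h n) _ (hE n)).
under [leRHS]eq_eseriesr => n _.
  under eq_bigr => j _ do rewrite -(@eq_sobolev_normsq _ T r (k n j) _ (kE n j)).
  over.
apply: sobolev_Bessel => //.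
  move=> t tT; under eq_eseriesr do rewrite hE//.
  by under [leRHS]eq_eseriesr do under eq_bigr do rewrite kE//; exact: pointwise (wT t tT).
move=> x y xT yT; have hx := wT x xT; have hy := wT y yT.
under eq_eseriesr do rewrite !hE// -(hipBl hY hx hy)//.
under [leRHS]eq_eseriesr do under eq_bigr do rewrite !kE// -(hipBl hY hx hy)//.
exact: pointwise (ph_domB hY hx hy).
Qed.

End L2vec_Bessel.

(** * The weak solution *)

Section weak_solution.
Context {R : realType} {d : nat}.
Local Notation mu := (@lebesgue_measure R).
Variables (a T : R).
Hypotheses (a0 : 0 < a) (a1 : a < 1) (T0 : 0 < T).
Variable Omega : set 'rV[R]_d.
Hypothesis mO : measurable Omega.
Variables (phi : nat -> 'rV[R]_d -> R) (lam : nat -> R).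
Hypothesis eigen : dirichlet_eigenbasis Omega phi lam.
Local Notation L2 := (L2 Omega).
Local Notation ip := (ip Omega).
Local Notation X := (L2_hilbert Omega phi).
Local Notation Y := (L2vec_hilbert Omega phi).
Local Notation H := (dotH Omega phi lam).
Local Notation g n := (eigen_grad Omega phi lam n).
Local Notation r := ((1 - a) / 2).
Variables (u0 : 'rV[R]_d -> R) (u : R -> 'rV[R]_d -> R).
Hypothesis hu0 : L2 u0.
Local Notation c n := (ip u0 (phi n)).
Local Notation E n t := (mittag_leffler a 1 (- lam n * t `^ a)).
Local Notation e n := (ml_fun a (lam n) 1).
Hypothesis hu : forall t, 0 <= t <= T ->
  hsum X (fun n => (E n t * c n) *: phi n) (u t).

Local Opaque Gamma ml_fun mittag_leffler.

Let hX := L2_prehilbert mO phi.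
Let hY := L2vec_prehilbert mO phi.
Let hH s := dotH_prehilbert mO eigen s.
Let Lphi := L2_eigen eigen.
Let phi_orth := eigen_orth eigen.
Let cY : complete_hilbert Y := @L2vec_complete _ _ _ mO phi.
Let g_dom := eigen_grad_dom mO eigen.
Let g_orth := eigen_grad_orth mO eigen.
Let lam0 := eigen_gt0 eigen.
Let ITv := (`]0%R, T[ : set (measurableTypeR R)).
Let mI : measurable ITv. Proof. exact: measurable_itv. Qed.

Let inI t : ITv t -> 0 < t < T.
Proof. by rewrite /ITv/= in_itv. Qed.

Let lam_ge n : lam 0%N <= lam n.
Proof. by have [_ _ _ _ [_ + _]] := eigen; apply. Qed.

Let ep n : relaxation a (lam n) (e n) (ml_fun a (lam n) a).
Proof. exact: ml_fun_relaxation. Qed.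

Let Parseval_L2 f : L2 f -> series (fun n => ip f (phi n) ^+ 2) @ \oo --> hnorm X f ^+ 2.
Proof. by move=> hf; exact: (Parseval hX Lphi phi_orth (eigen_hsum eigen hf)). Qed.

Let cc : cvgn (series (fun n => c n ^+ 2)).
Proof. by apply/cvg_ex; eexists; exact: Parseval_L2. Qed.

Let ccE : limn (series (fun n => c n ^+ 2)) = L2norm Omega u0 ^+ 2.
Proof. by apply/cvg_lim => //; exact: Parseval_L2. Qed.

Let N0 : 0 <= L2norm Omega u0. Proof. exact: sqrtr_ge0. Qed.

Let u_dom t : 0 <= t <= T -> L2 (u t).
Proof. by move=> /hu[]. Qed.

Let u_coef n t : 0 <= t <= T -> ip (u t) (phi n) = E n t * c n.
Proof. by move=> tT; exact: (hsum_coef hX Lphi phi_orth n (hu tT)). Qed.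

Let oc t : 0 < t < T -> 0 <= t <= T.
Proof. by move=> /andP[/ltW -> /ltW ->]. Qed.

Let u_coef_e n t : 0 < t < T -> ip (u t) (phi n) = e n t * c n.
Proof.
move=> tT; rewrite u_coef ?oc// ml_fun1E//; by case/andP: tT.
Qed.

(** Smoothing: at fixed [t > 0] the factors [lam n ^ s * e n t ^ 2] are bounded in [n], up to
    [s = 2]. *)
Let u_dotH s t : 0 <= s <= 2 -> 0 < t < T -> hdom (H s) (u t).
Proof.
move=> /andP[s0 s2] tT; split; first by apply: u_dom; exact: oc.
have t0 : 0 < t by case/andP: tT.
pose K := Num.max 1 (Gamma (a + 1)) ^+ 2 * t `^ (- (a * s)).
apply: (@le_lt_trans _ _ (\sum_(n <oo) (K * c n ^+ 2)%:E)%E).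
  apply: lee_nneseries => [n _ _|n _]; rewrite lee_fin.
    exact: mulr_ge0 (powR_ge0 _ _) (sqr_ge0 _).
  rewrite u_coef_e// exprMn mulrA; apply: ler_wpM2r; first exact: sqr_ge0.
  exact: (relax_e_bound (lam0 n) (ep n)).
rewrite nneseries_EFin ?ltry//; last exact: is_cvg_seriesM.
by move=> n; apply: mulr_ge0 (sqr_ge0 _); exact: mulr_ge0 (sqr_ge0 _) (powR_ge0 _ _).
Qed.

Let dotH1_hsum_grad v : hdom (H 1) v ->
  hsum Y (fun n => (Num.sqrt (lam n) * ip v (phi n)) *: g n) (weak_grad Omega v).
Proof.
move=> hv; have [Lv _] := hv; apply: (weak_grad_hsum mO eigen Lv).
have := dotH_cvg hv; rewrite (_ : (fun n => lam n `^ 1 * _) = fun n => lam n * ip v (phi n) ^+ 2)//.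
by apply/funext => n; rewrite powRr1// ltW.
Qed.

Let u_grad t : 0 < t < T ->
  hsum Y (fun n => (Num.sqrt (lam n) * (e n t * c n)) *: g n) (weak_grad Omega (u t)).
Proof.
move=> tT; have := dotH1_hsum_grad (@u_dotH 1 t _ tT); rewrite ler01 ler1n/= => /(_ isT).
rewrite (_ : (fun n => (Num.sqrt (lam n) * ip (u t) (phi n)) *: g n) =
  fun n => (Num.sqrt (lam n) * (e n t * c n)) *: g n)//.
by apply/funext => n; rewrite u_coef_e.
Qed.

Let coefH1 (v : R -> 'rV[R]_d -> R) n t := Num.sqrt (lam n) * ip (v t) (phi n).
Let coefY (w : R -> 'rV[R]_d -> 'rV[R]_d) n t := hip Y (w t) (g n).

(** The minus sign comes from [e' = - lam * p]: the coefficient of [u'] is [- lam n * p n * c n],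
    and [lam n] is shared as two square roots between [pairing_term] and the coefficient of [v] in
    [H 1]. *)
Definition solution_du (v : R -> 'rV[R]_d -> R) : R :=
  - pairing a T lam (fun n => c n) (fun n t => Num.sqrt (lam n) * ip (v t) (phi n)).

Definition solution_Dgu (w : R -> 'rV[R]_d -> 'rV[R]_d) : R :=
  pairing a T lam (fun n => c n) (fun n t => hip Y (w t) (g n)).

Let sumH1 v := (\sum_(n <oo) sobolev_time_normsq T r (coefH1 v n))%E.
Let sumY w := (\sum_(n <oo) sobolev_time_normsq T r (coefY w n))%E.

Let Htime_normH1 v : Htime_norm (H 1) T r v = (sumH1 v `^ 2^-1)%E.
Proof.
rewrite /Htime_norm -nneseries_esumT; last by move=> n; exact: sobolev_normsq_ge0.
have F n : (fun t => hip (H 1) (v t) (hbasis (n : hidx (H 1)))) = coefH1 v n.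
  by apply/funext => t; rewrite (dotH_basis mO eigen).
by under eq_eseriesr do rewrite F.
Qed.

Let sumH1_ge0 v : (0 <= sumH1 v)%E.
Proof. by apply: nneseries_ge0 => n _ _; exact: sobolev_normsq_ge0. Qed.

Let sumY_ge0 w : (0 <= sumY w)%E.
Proof. by apply: nneseries_ge0 => n _ _; exact: sobolev_normsq_ge0. Qed.

Let HtimeH1P v : Htime (H 1) T r v ->
  (forall n, measurable_fun ITv (coefH1 v n)) /\ (sumH1 v < +oo)%E.
Proof.
move=> [hv nv]; split; last by apply: poweR_half_lty => //; rewrite -Htime_normH1.
move=> n; apply: (eq_measurable_fun (fun t => hip (H 1) (v t) (hbasis (n : hidx (H 1))))).
  by move=> t _; rewrite (dotH_basis mO eigen).
apply: (L2time_measurable_hip (hH 1) hv).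
(* The basis vector has to be shown to lie in [H 1]: in the series of its squared norm a single term
   is nonzero. *)
split; first exact: (ph_domZ hX _ (Lphi n)).
apply: (@le_lt_trans _ _ (\sum_(k <oo) (if k == n then (lam n `^ 1 * ip (lam n `^ (- 1 / 2) *: phi n) (phi n) ^+ 2)%:E else 0))%E).
  apply: lee_nneseries => [k _ _|k _]; first by rewrite lee_fin mulr_ge0 ?powR_ge0 ?sqr_ge0.
  case: eqVneq => [->//|kn]; rewrite lee_fin.
  by rewrite -[ip _ _]/(hip X _ _) (hipZl hX _ (Lphi n) (Lphi k)) /= phi_orth eq_sym (negbTE kn) mulr0 expr0n mulr0.
have -> : (\sum_(k <oo) (if k == n then (lam n `^ 1 * ip (lam n `^ (- 1 / 2) *: phi n) (phi n) ^+ 2)%:E else 0) =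
   (lam n `^ 1 * ip (lam n `^ (- 1 / 2) *: phi n) (phi n) ^+ 2)%:E)%E.
  apply: lim_near_cst => //; exists n.+1 => // k /= nk; apply/eqP.
  rewrite (bigD1_seq n) ?mem_index_iota ?iota_uniq//= eqxx big1 ?addr0// => i /negbTE ->//.
exact: ltry.
Qed.

Let HtimeYP w : Htime Y T r w ->
  (forall n, measurable_fun ITv (coefY w n)) /\ (sumY w < +oo)%E.
Proof.
move=> [hw nw]; split; first by move=> n; exact: (L2time_measurable_hip hY hw (g_dom n)).
apply: le_lt_trans (L2vec_Bessel mO eigen _ hw) _; apply: poweR_half_lty nw.
by apply: esum_ge0 => i _; exact: sobolev_normsq_ge0.
Qed.

Let Htime_dual_intro V (Z : hilbert V) (F : (R -> V) -> R) (K : R) : 0 <= K ->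
  (forall v, Htime Z T r v -> (Htime_norm Z T r v <= 1)%E -> `|F v| <= K) ->
  (Htime_dual_norm Z T r F <= K%:E)%E.
Proof.
by move=> K0 FK; apply: ge_ereal_sup => _ [v [hv v1] <-]; rewrite lee_fin FK.
Qed.

Section duality.
Variable CH : R.
Hypotheses (CH0 : 0 < CH)
  (hardy : forall h : R -> R, measurable_fun [set: R] h ->
    (\int[mu]_(t in `]0%R, T[) (t `^ (a - 1) * h t ^+ 2)%:E <=
     CH%:E * sobolev_time_normsq T r h)%E).

Let K1 := (2 * Gamma a)^-1 + CH / 2.

Let K1_ge0 : 0 <= K1.
Proof.
by rewrite addr_ge0// ?invr_ge0 ?mulr_ge0 ?divr_ge0 ?(ltW CH0)// ltW// Gamma_gt0.
Qed.

Let sqrt_ccE : Num.sqrt (limn (series (fun n => c n ^+ 2))) = L2norm Omega u0.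
Proof. by rewrite ccE sqrtr_sqr ger0_norm. Qed.

Let fin S : (0 <= S)%E -> (S < +oo)%E -> exists s : R, (S <= s%:E)%E.
Proof. by move=> S0 Soo; exists (fine S); rewrite fineK// ge0_fin_numE. Qed.

Let inT V (Z : hilbert V) v : Htime Z T r v -> forall t, 0 < t < T -> hdom Z (v t).
Proof. by move=> [[]]. Qed.

Lemma solution_du_dual : Htime_dual (H 1) T r solution_du /\
  (Htime_dual_norm (H 1) T r solution_du <= (K1 * L2norm Omega u0)%:E)%E.
Proof.
have b : (Htime_dual_norm (H 1) T r solution_du <= (K1 * L2norm Omega u0)%:E)%E.
  apply: Htime_dual_intro; first exact: mulr_ge0.
  move=> v hv v1; have [mv sv] := HtimeH1P hv; rewrite normrN -sqrt_ccE.
  apply: (pairing_bound a0 a1 T0 lam0 cc CH0 hardy mv).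
  by apply: poweR_half_le1; [exact: sumH1_ge0|move: v1; rewrite Htime_normH1].
split; last exact: b.
split; last by apply: le_lt_trans b (ltry _).
move=> k v w hv hw; have [mv /(fin (sumH1_ge0 v))[s1 sv]] := HtimeH1P hv.
have [mw /(fin (sumH1_ge0 w))[s2 sw]] := HtimeH1P hw.
rewrite /solution_du (@eq_pairing _ a T lam _ _ (fun n t => k * coefH1 v n t + coefH1 w n t)).
  by rewrite (pairing_linear a0 a1 T0 lam0 cc CH0 hardy k mv mw sv sw) opprD mulrN.
move=> n t tT; have [Lv _] := inT hv tT; have [Lw _] := inT hw tT.
rewrite /coefH1 -[ip _ _]/(hip X (k *: v t + w t) (phi n)).
by rewrite (ph_lin hX k Lv Lw (Lphi n)) /=; ring.
Qed.

Lemma solution_Dgu_dual : Htime_dual Y T r solution_Dgu.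
Proof.
split; last first.
  apply: (@le_lt_trans _ _ (K1 * L2norm Omega u0)%:E); last exact: ltry.
  apply: Htime_dual_intro; first exact: mulr_ge0.
  move=> w hw w1; have [mw sw] := HtimeYP hw; rewrite -sqrt_ccE.
  apply: (pairing_bound a0 a1 T0 lam0 cc CH0 hardy mw).
  apply: le_trans (L2vec_Bessel mO eigen _ (proj1 hw)) _.
  by apply: poweR_half_le1 => //; apply: esum_ge0 => i _; exact: sobolev_normsq_ge0.
move=> k v w hv hw; have [mv /(fin (sumY_ge0 v))[s1 sv]] := HtimeYP hv.
have [mw /(fin (sumY_ge0 w))[s2 sw]] := HtimeYP hw.
rewrite /solution_Dgu (@eq_pairing _ a T lam _ _ (fun n t => k * coefY v n t + coefY w n t)).
  by rewrite (pairing_linear a0 a1 T0 lam0 cc CH0 hardy k mv mw sv sw).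
move=> n t tT; exact: (ph_lin hY k (inT hv tT) (inT hw tT) (g_dom n)).
Qed.

End duality.

(** The coefficients of [weak_grad Omega (v t)] along the [g n] are those of [v t] in the basis of
    [H 1], so both functionals are the same pairing with opposite signs. *)
Lemma solution_du_Dgu v : Htime (H 1) T r v ->
  solution_du v + solution_Dgu (fun t => weak_grad Omega (v t)) = 0.
Proof.
move=> [[dv _ _] _]; rewrite /solution_du /solution_Dgu.
rewrite (@eq_pairing _ a T lam _ _ (fun n t => hip Y (weak_grad Omega (v t)) (g n))) ?addNr//.
move=> n t tT; apply/esym.
exact: (hsum_coef hY g_dom g_orth n (dotH1_hsum_grad (dv t tT))).
Qed.

(** As [z n / sqrt (lam n)] is the L^2 coefficient of [y], the series in [pairing_test] is the
    expansion of the L^2 inner product of [u t] and [y]. *)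
Lemma solution_du_derivative : is_time_derivative X (H 1) T u solution_du.
Proof.
move=> f y hf hy; have [Ly _] := hy.
pose z n := Num.sqrt (lam n) * ip y (phi n).
have cz : cvgn (series (fun n => z n ^+ 2)).
  have := dotH_cvg hy; rewrite (_ : (fun n => lam n `^ 1 * _) = fun n => z n ^+ 2)//.
  by apply/funext => n; rewrite exprMn sqr_sqrtr ?powRr1// ltW.
rewrite /solution_du (@eq_pairing _ a T lam _ _ (fun n t => f t * z n)); last first.
  move=> n t tT; rewrite -[ip _ _]/(hip X (f t *: y) (phi n)) (hipZl hX _ Ly (Lphi n)).
  by rewrite /z /=; ring.
have [_ ->] := pairing_test a0 a1 T0 lam0 lam_ge cc cz hf; congr (- _).
apply: eq_Rintegral => t; rewrite inE => /inI tT; congr (_ * _).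
have S := hsum_series hX Lphi Ly (hu (oc tT)); rewrite -(cvg_lim _ S)//.
congr (limn (series _)); apply/funext => n.
rewrite ml_fun1E//; last by case/andP: tT.
have s0 : 0 < Num.sqrt (lam n) by rewrite sqrtr_gt0.
by rewrite [hip _ _ _]ipC /z; field; rewrite gt_eqF.
Qed.

(** The fractional integral of the gradient involves [1 - e n]. The part coming from 1 is constant
    in time and disappears against [f']; the part in [- e n] is the integral in [pairing_test]. *)
Lemma solution_Dgu_derivative :
  is_frac_derivative Y T (1 - a) (fun t => weak_grad Omega (u t)) solution_Dgu.
Proof.
move=> f y hf hy; pose z n := hip Y (g n) y.
have cz : cvgn (series (fun n => z n ^+ 2)).
  have := Bessel_cvg hY g_dom g_orth hy.
  rewrite (_ : (fun n => hip Y y (g n) ^+ 2) = fun n => z n ^+ 2)//.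
  by apply/funext => n; rewrite (ph_sym hY).
rewrite /solution_Dgu (@eq_pairing _ a T lam _ _ (fun n t => f t * z n)); last first.
  by move=> n t tT; rewrite (hipZl hY)// (ph_sym hY).
have [iS ->] := pairing_test a0 a1 T0 lam0 lam_ge cc cz hf.
pose S t := limn (series (fun n => c n * z n / Num.sqrt (lam n) * e n t)).
pose L := limn (series (fun n => c n * z n / Num.sqrt (lam n))).
have idf : mu.-integrable `]0, T[ (EFin \o (fun t => derive1 f t * L)).
  have [M M0 HM] := test_time_bounded hf.
  apply: integrableMr_cst => //.
  by apply: (@integrable_bounded_itv _ T T0 _ M (measurable_test_time_derive hf)) => t /HM[].
have -> : \int[mu]_(t in `]0, T[) (derive1 f t *
      hip Y (frac_int Y (1 - (1 - a)) (fun t => weak_grad Omega (u t)) t) y) =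
    \int[mu]_(t in `]0, T[) (derive1 f t * L - derive1 f t * S t).
  apply: eq_Rintegral => t; rewrite inE => /inI tT.
  rewrite (frac_int_relaxation a0 a1 lam0 lam_ge cc hY cY g_dom g_orth u_grad tT hy).
  rewrite -mulrBr; congr (_ * _).
  have c1 := @relaxed_series_cvg1 _ _ _ lam0 lam_ge cc _ cz.
  have c2 := @relaxed_series_cvg _ _ _ _ a0 a1 lam0 lam_ge cc _ cz t.
  rewrite /S /L -mulN1r -(@lim_seriesM _ (-1) _ c2) -(lim_series_add c1 (@is_cvg_seriesM _ (-1) _ c2)).
  by congr (limn (series _)); apply/funext => n; rewrite /z; ring.
rewrite RintegralB// RintegralZr//; last first.
  have [M M0 HM] := test_time_bounded hf.
  by apply: (@integrable_bounded_itv _ T T0 _ M (measurable_test_time_derive hf)) => t /HM[].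
rewrite {2}/Rintegral (integral_test_time_derive hf) ?in_itv/= ?lexx//.
by rewrite (test_time_out hf) ?in_itv/= ?ltxx// oppr0 mul0r sub0r opprK.
Qed.

Let E01 n t : 0 <= t -> 0 <= E n t <= 1.
Proof.
by move=> t0; rewrite (mittag_leffler_ge0 a0 a1 (lam0 n) t0) (mittag_leffler_le1 a0 a1 (lam0 n) t0).
Qed.

Let sqr_diff_le1 (x y : R) : 0 <= x <= 1 -> 0 <= y <= 1 -> (x - y) ^+ 2 <= 1.
Proof.
move=> /andP[x0 x1] /andP[y0 y1]; rewrite -real_normK ?num_real// expr_le1//.
by rewrite ler_norml; apply/andP; split; lra.
Qed.

(** Parseval turns the squared norm of [u s - u t] into a series dominated by that of [c n ^ 2],
    with factors that are at most 1 and tend to 0 for each [n]. *)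
Lemma solution_continuous : continuous_time X T u.
Proof.
split => [t /u_dom//|t tT].
have nE s : 0 <= s <= T -> hnorm X (u s - u t) ^+ 2 =
    limn (series (fun n => c n ^+ 2 * (E n s - E n t) ^+ 2)).
  move=> sT; have := Parseval_L2 (ph_domB hX (u_dom sT) (u_dom tT)) => /cvg_lim <-//.
  congr (limn (series _)); apply/funext => n; rewrite -exprMn; congr (_ ^+ 2).
  rewrite -[LHS]/(hip X (u s - u t) (phi n)) (hipBl hX (u_dom sT) (u_dom tT) (Lphi n)) /=.
  by rewrite !u_coef//; ring.
have c0 : (fun s => limn (series (fun n => c n ^+ 2 * (E n s - E n t) ^+ 2))) @
    within `[0, T] (nbhs t) --> (0 : R).
  apply: (cvg_series_dominated0 (fun n => sqr_ge0 (c n)) cc).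
    move=> n; have c1 : (fun s => E n s - E n t) @ within `[0, T] (nbhs t) --> (0 : R).
      rewrite -[X in _ --> X](subrr (E n t)); apply: cvgB; last exact: cvg_cst.
      exact: (mittag_leffler_continuous a0 a1 T0 (lam0 n) tT).
    rewrite -[X in _ --> X](expr0n R 2).
    exact: (cvg_comp _ _ c1 (@exprn_continuous R 2 0)).
  near=> s; have : s \in `[0, T] by near: s; exact: withinT.
  rewrite in_itv/= => /andP[s0 _] n; rewrite sqr_ge0/=.
  by have /andP[t0 _] := tT; apply: sqr_diff_le1; exact: E01.
have c1 := cvg_comp _ _ c0 (@sqrt_continuous R 0).
rewrite sqrtr0 in c1; apply: cvg_trans c1.
apply: near_eq_cvg; near=> s; have : s \in `[0, T] by near: s; exact: withinT.
by rewrite in_itv/= => sT; rewrite /= -nE// sqrtr_sqr ger0_norm// hnorm_ge0.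
Unshelve. all: by end_near. Qed.

(** Parseval again: each coefficient of [u0] is multiplied by a factor between 0 and 1. *)
Lemma solution_C_norm : (C_norm X T u <= (L2norm Omega u0)%:E)%E.
Proof.
apply: ge_ereal_sup => _ [t + <-]; rewrite /= in_itv/= => tT; rewrite lee_fin.
rewrite -(@ler_pXn2r _ 2) ?nnegrE ?hnorm_ge0// -ccE.
have P := Parseval_L2 (u_dom tT); rewrite -(cvg_lim _ P)//.
apply: lim_series_le => //; first by apply/cvg_ex; eexists; exact: P.
move=> n; rewrite u_coef// exprMn ler_piMl ?sqr_ge0//.
by have /andP[t0 _] := tT; have /andP[h1 h2] := E01 n t0; rewrite expr_le1.
Qed.

Let measurable_u_hip s x : 0 <= s <= 2 -> hdom (H s) x ->
  measurable_fun ITv (fun t => hip (H s) (u t) x).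
Proof.
move=> s2 hx; apply: (eq_measurable_fun (fun t => limn (series (fun n =>
    lam n `^ s * (e n t * c n) * ip x (phi n))))).
  move=> t; rewrite inE => /inI tT /=; congr (limn (series _)).
  by apply/funext => n; rewrite u_coef_e.
apply: (@measurable_fun_series _ _ _ ITv (fun n t => lam n `^ s * (e n t * c n) * ip x (phi n))).
  move=> n; apply: measurable_funM; last exact: measurable_cst.
  apply: measurable_funM; first exact: measurable_cst.
  apply: measurable_funM; last exact: measurable_cst.
  exact: measurable_funTS (relax_me (ep n)).
move=> t /inI tT; have := dotH_cvgM (u_dotH s2 tT) hx.
by under eq_fun do rewrite u_coef_e//.
Qed.

Let u_sqr s t : 0 <= s <= 2 -> 0 < t < T ->
  ((hip (H s) (u t) (u t))%:E = \sum_(n <oo) (lam n `^ s * (e n t * c n) ^+ 2)%:E)%E.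
Proof.
move=> s2 tT; have hc := dotH_cvg (u_dotH s2 tT).
rewrite dotH_sqr -nneseries_EFin//; last first.
  by move=> n; exact: mulr_ge0 (powR_ge0 _ _) (sqr_ge0 _).
by apply: eq_eseriesr => n _; rewrite u_coef_e.
Qed.

(** Monotone convergence exchanges the sum over modes with the time integral, so a bound per mode
    that is uniform in [n] suffices. *)
Let integral_u_sqr s K : 0 <= s <= 2 ->
  (forall n, ((lam n `^ s)%:E * \int[mu]_(t in `]0%R, T[) (e n t ^+ 2)%:E <= K%:E)%E) ->
  (\int[mu]_(t in `]0%R, T[) (hip (H s) (u t) (u t))%:E <= (K * L2norm Omega u0 ^+ 2)%:E)%E.
Proof.
move=> s2 HK; have -> : (\int[mu]_(t in `]0%R, T[) (hip (H s) (u t) (u t))%:E =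
    \int[mu]_(t in `]0%R, T[) (\sum_(n <oo) (lam n `^ s * (e n t * c n) ^+ 2)%:E))%E.
  by apply: eq_integral => t; rewrite inE => /inI tT; exact: u_sqr.
have t0 n t : (0 <= (lam n `^ s * (e n t * c n) ^+ 2)%:E)%E.
  by rewrite lee_fin; exact: mulr_ge0 (powR_ge0 _ _) (sqr_ge0 _).
rewrite integral_nneseries//; last first.
  move=> n; apply/measurable_EFinP; apply: measurable_funM; first exact: measurable_cst.
  apply: measurable_funX; apply: measurable_funM; last exact: measurable_cst.
  exact: measurable_funTS (relax_me (ep n)).
have K0 : 0 <= K.
  rewrite -lee_fin; apply: le_trans (HK 0%N); apply: mule_ge0; first by rewrite lee_fin powR_ge0.
  by apply: integral_ge0 => t _; rewrite lee_fin sqr_ge0.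
apply: (@le_trans _ _ (\sum_(n <oo) (K * c n ^+ 2)%:E)%E); last first.
  rewrite nneseries_EFin; first by rewrite lim_seriesM// ccE.
    by move=> n; exact: mulr_ge0 (sqr_ge0 _).
  exact: is_cvg_seriesM.
apply: lee_nneseries => [n _ _|n _]; first by apply: integral_ge0 => t _.
have -> : (\int[mu]_(t in `]0%R, T[) (lam n `^ s * (e n t * c n) ^+ 2)%:E =
    \int[mu]_(t in `]0%R, T[) ((c n ^+ 2 * lam n `^ s)%:E * (e n t ^+ 2)%:E))%E.
  by apply: eq_integral => t _; rewrite -EFinM; congr (_%:E); ring.
rewrite ge0_integralZl//; last 3 first.
- by apply/measurable_EFinP; apply: measurable_funTS; apply: measurable_funX; exact: relax_me (ep n).
- by move=> t _; rewrite lee_fin sqr_ge0.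
- by rewrite lee_fin; exact: mulr_ge0 (sqr_ge0 _) (powR_ge0 _ _).
rewrite (EFinM (c n ^+ 2)) -muleA (mulrC K) (EFinM (c n ^+ 2) K); apply: lee_wpmul2l (HK n).
by rewrite lee_fin sqr_ge0.
Qed.

Lemma solution_L2time s K : 0 <= s <= 2 -> 0 <= K ->
  (forall n, ((lam n `^ s)%:E * \int[mu]_(t in `]0%R, T[) (e n t ^+ 2)%:E <= K%:E)%E) ->
  L2time (H s) T u /\
  (L2time_norm (H s) T u <= (Num.sqrt K * L2norm Omega u0)%:E)%E.
Proof.
move=> s2 K0 HK; have iK := integral_u_sqr s2 HK.
have uu t : t \in `]0, T[ -> hnorm (H s) (u t) ^+ 2 = hip (H s) (u t) (u t).
  by rewrite in_itv/= => tT; rewrite (hnorm_sqr (hH s))//; exact: u_dotH.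
split; last first.
  apply: poweR_half_le.
  - by apply: integral_ge0 => t _; rewrite lee_fin sqr_ge0.
  - by rewrite mulr_ge0// sqrtr_ge0.
  rewrite exprMn sqr_sqrtr//; apply: le_trans iK.
  rewrite le_eqVlt; apply/orP; left; apply/eqP; apply: eq_integral => t.
  by rewrite inE => /uu ->.
apply: (L2time_intro (hH s)).
- by move=> t; exact: u_dotH.
- by move=> x hx; exact: measurable_u_hip.
- apply: (eq_measurable_fun (fun t => limn (series (fun n => lam n `^ s * (e n t * c n) ^+ 2)))).
    move=> t; rewrite inE => /inI tT; rewrite dotH_sqr; congr (limn (series _)).
    by apply/funext => n; rewrite u_coef_e.
  apply: (@measurable_fun_series _ _ _ ITv (fun n t => lam n `^ s * (e n t * c n) ^+ 2)).
    move=> n; apply: measurable_funM; first exact: measurable_cst.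
    apply: measurable_funX; apply: measurable_funM; last exact: measurable_cst.
    exact: measurable_funTS (relax_me (ep n)).
  move=> t /inI tT; have := dotH_cvg (u_dotH s2 tT).
  by under eq_fun do rewrite u_coef_e//.
- by apply: le_lt_trans iK (ltry _).
Qed.

(** The weight [lam n] of [H 1] is exactly the factor absorbed by [sobolev_relaxation]; membership
    in [L2time] follows with the same [K], since the Sobolev norm dominates the L^2 norm. *)
Lemma solution_Htime : let K := Gamma (a + 1) * (T `^ (1 - a) / (1 - a)) + 2 * (Gamma a / (1 - a)) in
  Htime (H 1) T r u /\ (Htime_norm (H 1) T r u <= (Num.sqrt K * L2norm Omega u0)%:E)%E.
Proof.
move=> K; have K0 : 0 <= K.
  have b0 : 0 <= 1 - a by rewrite subr_ge0 ltW.
  have G1 : 0 <= Gamma a by rewrite ltW// Gamma_gt0.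
  have G2 : 0 <= Gamma (a + 1) by rewrite ltW// Gamma_gt0// addr_gt0.
  by apply: addr_ge0; apply: mulr_ge0 => //; apply: divr_ge0 => //; exact: powR_ge0.
have sob n : ((lam n)%:E * sobolev_time_normsq T r (e n) <= K%:E)%E.
  exact: (sobolev_relaxation a0 a1 T0 (lam0 n) (ep n)).
have nb : (Htime_norm (H 1) T r u <= (Num.sqrt K * L2norm Omega u0)%:E)%E.
  rewrite Htime_normH1; apply: poweR_half_le => //; first by rewrite mulr_ge0// sqrtr_ge0.
  rewrite exprMn sqr_sqrtr//.
  apply: (@le_trans _ _ (\sum_(n <oo) (K * c n ^+ 2)%:E)%E); last first.
    rewrite nneseries_EFin; first by rewrite lim_seriesM// ccE.
      by move=> n; exact: mulr_ge0 (sqr_ge0 _).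
    exact: is_cvg_seriesM.
  apply: lee_nneseries => [n _ _|n _]; first exact: sobolev_normsq_ge0.
  rewrite (@eq_sobolev_normsq _ T r _ (fun t => Num.sqrt (lam n) * c n * e n t)); last first.
    move=> t; rewrite in_itv/= => tT; rewrite /coefH1 u_coef_e//; ring.
  rewrite (sobolev_normsqZ _ _ _ (relax_me (ep n))) exprMn sqr_sqrtr ?(ltW (lam0 n))//.
  rewrite [K * _]mulrC [lam n * _]mulrC !EFinM -muleA.
  by apply: lee_wpmul2l (sob n); rewrite lee_fin sqr_ge0.
split => //; split; last by apply: le_lt_trans nb (ltry _).
apply: (proj1 (@solution_L2time 1 K _ K0 _)); first by rewrite ler01 ler1n.
move=> n; apply: le_trans (sob n); rewrite powRr1 ?(ltW (lam0 n))//.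
apply: lee_wpmul2l; first by rewrite lee_fin ltW.
rewrite sobolev_normsqE leeDl//; apply: integral_ge0 => x _; apply: integral_ge0 => y _.
by rewrite lee_fin; exact: mulr_ge0 (sobolev_kernel_ge0 _ _ _ _) (sqr_ge0 _).
Qed.

End weak_solution.

Theorem theorem3p4 (R : realType) (alpha T : R) (halpha : 0 < alpha < 1)
    (hT : 0 < T) :
  exists C : R, 0 < C /\
  forall (d : nat) (Omega : set 'rV[R]_d) (phi : nat -> 'rV[R]_d -> R)
    (lam : nat -> R) (u0 : 'rV[R]_d -> R) (u : R -> 'rV[R]_d -> R) (gamma : R),
  (1 <= d <= 3)%N ->
  convex_polyhedral_domain Omega ->
  dirichlet_eigenbasis Omega phi lam ->
  L2 Omega u0 ->
  (forall t : R, 0 <= t <= T ->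
     hsum (L2_hilbert Omega phi)
       (fun n => (mittag_leffler alpha 1 (- lam n * t `^ alpha)
                  * ip Omega u0 (phi n)) *: phi n) (u t)) ->
  (alpha != 2^-1 /\ gamma = Num.min 2 alpha^-1) \/
  (alpha = 2^-1 /\ 1 <= gamma < 2) ->
  let H1 := dotH Omega phi lam 1 in
  let Hgamma := dotH Omega phi lam gamma in
  let L2s := L2_hilbert Omega phi in
  let L2v := L2vec_hilbert Omega phi in
  let r := (1 - alpha) / 2 in
  let eps := Num.sqrt (2 - gamma) + Num.sqrt `|2 * alpha - 1| in
  exists (du : (R -> 'rV[R]_d -> R) -> R)
         (Dgu : (R -> 'rV[R]_d -> 'rV[R]_d) -> R),
  [/\ Htime_dual H1 T r du /\ is_time_derivative L2s H1 T u du,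
      Htime_dual L2v T r Dgu /\
        is_frac_derivative L2v T (1 - alpha) (fun t => weak_grad Omega (u t)) Dgu,
      (forall v : R -> 'rV[R]_d -> R, Htime H1 T r v ->
         du v + Dgu (fun t => weak_grad Omega (v t)) = 0),
      [/\ continuous_time L2s T u, Htime H1 T r u & L2time Hgamma T u] &
      (Htime_dual_norm H1 T r du + C_norm L2s T u + Htime_norm H1 T r u
        + eps%:E * L2time_norm Hgamma T u
       <= (C * L2norm Omega u0)%:E)%E].
Proof.
have /andP[a0 a1] := halpha.
have [CH CH0 hardy] := fractional_Hardy a0 a1 hT.
have [C3 C30 crit] := critical_bound a0 hT.
have G0 : 0 < Gamma alpha by exact: Gamma_gt0.
pose K1 := (2 * Gamma alpha)^-1 + CH / 2.
have K10 : 0 <= K1.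
  by apply: addr_ge0; [rewrite invr_ge0 mulr_ge0// ltW|apply: divr_ge0 => //; exact: ltW].
pose K2 := Gamma (alpha + 1) * (T `^ (1 - alpha) / (1 - alpha)) +
  2 * (Gamma alpha / (1 - alpha)).
(* One summand per norm, in the order of the statement: dual norm of [du], supremum norm, Sobolev
   norm, weighted norm in [Hgamma]. *)
exists (K1 + 1 + Num.sqrt K2 + Num.sqrt C3); split.
  have := sqrtr_ge0 K2; have := sqrtr_ge0 C3; lra.
move=> d Omega phi lam u0 u gamma _ hpoly eigen hu0 hu hgamma H1 Hgamma L2s L2v r eps.
have mO := measurable_convex_polyhedral_domain hpoly.
have [gamma02 [K [K0 epsK HK]]] := crit gamma hgamma.
have lam0 := eigen_gt0 eigen.
have N0 : 0 <= L2norm Omega u0 by exact: sqrtr_ge0.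
have [du1 du2] := solution_du_dual a0 a1 hT mO eigen hu0 CH0 hardy.
have Dgu1 := solution_Dgu_dual a0 a1 hT mO eigen hu0 CH0 hardy.
have [uH uHn] := solution_Htime a0 a1 hT mO eigen hu0 hu.
have [uL uLn] := solution_L2time a0 a1 mO eigen hu0 hu gamma02 K0
  (fun n => HK _ _ _ (lam0 n) (ml_fun_relaxation a0 a1 (lam0 n))).
exists (solution_du alpha T Omega phi lam u0), (solution_Dgu alpha T Omega phi lam u0); split.
- by split => //; exact: solution_du_derivative.
- by split => //; exact: solution_Dgu_derivative.
- by move=> v; exact: solution_du_Dgu.
- by split; [exact: (solution_continuous a0 a1 hT mO eigen hu0 hu)|exact: uH|exact: uL].
have eps0 : 0 <= eps by apply: addr_ge0; exact: sqrtr_ge0.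
rewrite (mulrDl (K1 + 1 + _)) (mulrDl (K1 + 1)) (mulrDl K1) mul1r !EFinD; apply: leeD; last first.
  apply: (@le_trans _ _ (eps%:E * (Num.sqrt K * L2norm Omega u0)%:E)%E).
    by apply: lee_wpmul2l uLn; rewrite lee_fin.
  (* [eps * sqrt K] is the square root of [eps^2 * K], which [critical_bound] bounds by [C3]. *)
  rewrite -EFinM lee_fin mulrA; apply: ler_wpM2r => //.
  by rewrite -{1}(ger0_norm eps0) -sqrtr_sqr -sqrtrM ?sqr_ge0// ler_sqrt.
apply: leeD uHn; apply: leeD; first exact: du2.
exact: (solution_C_norm a0 a1 mO eigen hu0 hu).
Qed.
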